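(* Let $q>\frac d2+1$ and define on $\mathcal{D}^q(\mathbb{R}^d)$ \[d_q(\varphi_1,\varphi_2)=\|\varphi_1-\varphi_2\|_{H^q}+\big\|\det(d\varphi_1)^{-1}-\det(d\varphi_2)^{-1}\big\|_\infty.\] Then $(\mathcal{D}^q(\mathbb{R}^d),d_q)$ is a complete metric space and the metric topology is equivalent to the Hilbert manifold topology of $\mathcal{D}^q(\mathbb{R}^d)$.
   Context: For $q\ge0$, $H^q(\mathbb{R}^d,\mathbb{R}^d)$ is the space of $u\in L^2$ with $\|u\|_{H^q}^2=\int(1+|\xi|^2)^q|\hat u(\xi)|^2d\xi<\infty$, $\hat u(\xi)=\int e^{-2i\pi\langle x,\xi\rangle}u(x)dx$. For $q>\frac d2+1$, $\mathcal{D}^q(\mathbb{R}^d)=\{\mathrm{id}+f: f\in H^q(\mathbb{R}^d,\mathbb{R}^d),\ \det(I+df(x))>0\ \forall x\}$, equipped with the Hilbert manifold structure given by the global chart $\varphi\mapsto\varphi-\mathrm{id}$ onto an open subset of $H^q$. Here $\|\cdot\|_\infty$ is the supremum norm and $\det(d\varphi)^{-1}$ is the function $x\mapsto 1/\det(d\varphi(x))$. *)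

(* Defs.v *)
From mathcomp Require Import all_boot all_order all_algebra.
From mathcomp Require Import all_classical all_reals all_analysis.
Set Implicit Arguments. Unset Strict Implicit. Unset Printing Implicit Defensive.
Import Order.TTheory GRing.Theory Num.Theory.
Import numFieldNormedType.Exports.
Local Open Scope classical_set_scope.
Local Open Scope ring_scope.

Section SobolevDefs.
Variable R : realType.

Definition sqn {d : nat} (x : 'rV[R]_d) : R := \sum_(i < d) x 0 i ^+ 2.
Definition dotp {d : nat} (x y : 'rV[R]_d) : R := \sum_(i < d) x 0 i * y 0 i.

(* Measurability of a real function on R^d, via the product sigma-algebra
   on d.-tuple R (coordinatewise). *)
Definition rv_measurable {d : nat} (g : 'rV[R]_d -> R) : Prop :=
  measurable_fun [set: d.-tuple R] (fun t : d.-tuple R => g (\row_i tnth t i)).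

(* Lebesgue integral on R^d of a nonnegative function, computed as the
   iterated integral over the coordinates (Tonelli). *)
Fixpoint iint (n : nat) : ('rV[R]_n -> \bar R) -> \bar R :=
  match n return ('rV[R]_n -> \bar R) -> \bar R with
  | 0 => fun f => f 0
  | n'.+1 => fun f =>
      (\int[@lebesgue_measure R]_(x in [set: R])
          iint (fun v : 'rV[R]_n' => f (row_mx (\row_(j < 1) x) v)))%E
  end.

Definition Iint {d : nat} (f : 'rV[R]_d -> R) : R :=
  fine (iint (fun x => (Num.max (f x) 0)%:E))
  - fine (iint (fun x => (Num.max (- f x) 0)%:E)).

(* Real and imaginary parts of the Fourier transform
   xi |-> int_{|x| <= N} e^{-2 i pi <x,xi>} u(x) dx  of the truncation of u
   to the closed Euclidean ball of radius N. *)
Definition FT_re {d : nat} (u : 'rV[R]_d -> R) (N : nat) (xi : 'rV[R]_d) : R :=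
  Iint (fun x => if sqn x <= (N%:R) ^+ 2
                 then u x * cos (2 * pi * dotp x xi) else 0).
Definition FT_im {d : nat} (u : 'rV[R]_d -> R) (N : nat) (xi : 'rV[R]_d) : R :=
  - Iint (fun x => if sqn x <= (N%:R) ^+ 2
                   then u x * sin (2 * pi * dotp x xi) else 0).

Definition L2 {d : nat} (u : 'rV[R]_d -> R) : Prop :=
  rv_measurable u /\ (iint (fun x => (u x ^+ 2)%:E) < +oo)%E.

(* (gr, gi) is (real part, imaginary part of) the L^2 (Plancherel)
   Fourier transform of u in L^2: the L^2-limit of the Fourier transforms
   of the truncations u 1_{|x| <= N}. *)
Definition is_FT {d : nat} (u : 'rV[R]_d -> R) (gr gi : 'rV[R]_d -> R) : Prop :=
  rv_measurable gr /\ rv_measurable gi /\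
  (fun N : nat => iint (fun xi =>
      ((gr xi - FT_re u N xi) ^+ 2 + (gi xi - FT_im u N xi) ^+ 2)%:E))
    @ \oo --> (0 : \bar R)%E.

Definition comp {d : nat} (u : 'rV[R]_d -> 'rV[R]_d) (i : 'I_d) : 'rV[R]_d -> R :=
  fun x => u x 0 i.

Definition Hq_weighted {d : nat} (q : R) (gr gi : 'I_d -> 'rV[R]_d -> R) : \bar R :=
  iint (fun xi => ((1 + sqn xi) `^ q *
                   \sum_(i < d) (gr i xi ^+ 2 + gi i xi ^+ 2))%:E).

Definition in_Hq {d : nat} (q : R) (u : 'rV[R]_d -> 'rV[R]_d) : Prop :=
  (forall i, L2 (comp u i)) /\
  exists gr gi : 'I_d -> 'rV[R]_d -> R,
    (forall i, is_FT (comp u i) (gr i) (gi i)) /\ (Hq_weighted q gr gi < +oo)%E.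

(* ||u||_{H^q}^2 (the weighted integral does not depend on the chosen
   representative of the Fourier transform; we take the infimum over all
   of them, which avoids any choice) *)
Definition Hq_sqnorm {d : nat} (q : R) (u : 'rV[R]_d -> 'rV[R]_d) : \bar R :=
  ereal_inf [set v | exists gr gi : 'I_d -> 'rV[R]_d -> R,
     (forall i, is_FT (comp u i) (gr i) (gi i)) /\ v = Hq_weighted q gr gi].

Definition Hq_norm {d : nat} (q : R) (u : 'rV[R]_d -> 'rV[R]_d) : R :=
  Num.sqrt (fine (Hq_sqnorm q u)).

Definition jac_det {d : nat} (phi : 'rV[R]_d -> 'rV[R]_d) (x : 'rV[R]_d) : R :=
  \det (lin1_mx ('d phi x)).

(* D^q(R^d) = { id + f : f in H^q, det(I + df(x)) > 0 for all x }.
   (f is required to be differentiable everywhere, i.e. we take the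
   (unique) C^1 representative of its class.) *)
Definition Dq {d : nat} (q : R) (phi : 'rV[R]_d -> 'rV[R]_d) : Prop :=
  in_Hq q (phi \- id) /\
  (forall x, differentiable phi x) /\
  (forall x, 0 < jac_det phi x).

Definition supnorm_e {d : nat} (g : 'rV[R]_d -> R) : \bar R :=
  ereal_sup (range (fun x => (`|g x|)%:E)).

Definition invdet_dist_e {d : nat} (phi1 phi2 : 'rV[R]_d -> 'rV[R]_d) : \bar R :=
  supnorm_e (fun x => (jac_det phi1 x)^-1 - (jac_det phi2 x)^-1).

Definition dq {d : nat} (q : R) (phi1 phi2 : 'rV[R]_d -> 'rV[R]_d) : R :=
  Hq_norm q (phi1 \- phi2) + fine (invdet_dist_e phi1 phi2).

Definition dq_open {d : nat} (q : R) (U : set ('rV[R]_d -> 'rV[R]_d)) : Prop :=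
  forall phi, U phi -> exists2 e : R, 0 < e &
    forall psi, Dq q psi -> dq q phi psi < e -> U psi.

(* open subsets of D^q for the Hilbert manifold topology, i.e. the topology
   transported from H^q by the global chart phi |-> phi - id
   (note (psi - id) - (phi - id) = psi - phi) *)
Definition manifold_open {d : nat} (q : R) (U : set ('rV[R]_d -> 'rV[R]_d)) : Prop :=
  forall phi, U phi -> exists2 e : R, 0 < e &
    forall psi, Dq q psi -> Hq_norm q (psi \- phi) < e -> U psi.

End SobolevDefs.

(* Main.v *)
(* The chart [phi |-> phi - id] identifies D^q with a set of functions u = F^-1 g, where g
   lies in the weighted space L^2((1 + |xi|^2)^q dxi). As q > d/2 + 1, Cauchy-Schwarz gives
   |xi| g in L^1 with a norm bounded by that of g, so u is C^1 and the sup norms of u and du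
   are bounded by the H^q norm. Fourier inversion (by Gaussian regularization) identifies the
   differentiable representative u with this integral. The derivative du is uniformly
   continuous and lies in L^2, hence vanishes at infinity, so that det(I + du) > 0 is bounded
   away from 0 and 1/det depends continuously on u for the H^q norm: both topologies agree.
   For completeness, weighted L^2 is complete, and the limit of a d_q-Cauchy sequence has
   positive jacobian because the functions 1/det converge uniformly, hence stay bounded. *)

Require Import Defs.
From HB Require Import structures.
From mathcomp Require Import all_boot all_order all_algebra.
From mathcomp Require Import all_classical all_reals all_analysis.
From mathcomp Require Import measurable_realfun normal_distribution.
From mathcomp Require Import lebesgue_integral_under perm ring lra.
Import Order.TTheory GRing.Theory Num.Theory.
Import numFieldNormedType.Exports.
Local Open Scope classical_set_scope.
Local Open Scope ring_scope.

Set Implicit Arguments.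
Unset Strict Implicit.
Unset Printing Implicit Defensive.

(** * The Borel structure and Lebesgue measure of R^n *)

(** Complex values are carried as pairs of real functions, and [invFT] is the real part of an
    inverse transform. The definitions speak of iterated integrals and of L^2 limits of transforms
    of truncations, so they are first rewritten as integrals against a measure [leb n]. Pairs and
    functions are then linked in two directions. Given u with its transform, Gaussian damping turns
    the L^2 limit into a pointwise identity wherever u is continuous. Conversely, completeness
    produces a limit pair that must be recognised as the transform of its own [invFT]: Bessel's
    inequality controls the error uniformly in the truncation radius, so that being a transform pair
    is a closed property. Estimates of Cauchy-Schwarz type are obtained from AM-GM with a free
    parameter t, fixed only once the integrals are known. The embedding constant and the triangle
    inequality for the H^q norm both come out of this choice of t. The condition on q enters through
    the integrability of (1 + |xi|^2)^-(q - 1), where q - 1 > d/2. *)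

Section rV_measurable_structure.
Context {R : realType} {d : nat}.

Definition row_of_tuple (t : d.-tuple R) : 'rV[R]_d := \row_i tnth t i.
Definition tuple_of_row (x : 'rV[R]_d) : d.-tuple R := [tuple x 0 i | i < d].

Lemma tuple_of_rowK : cancel tuple_of_row row_of_tuple.
Proof. by move=> x; apply/rowP => i; rewrite mxE tnth_mktuple. Qed.

(** The sigma-algebra transported from tuples, so that [rv_measurable] unfolds to measurability for
    this structure. *)
Definition rV_measurable_set : set (set 'rV[R]_d) :=
  [set A | measurable (row_of_tuple @^-1` A)].

Let rV0 : rV_measurable_set set0.
Proof. by rewrite /rV_measurable_set/= preimage_set0. Qed.

Let rVC A : rV_measurable_set A -> rV_measurable_set (~` A).
Proof. by rewrite /rV_measurable_set/= preimage_setC; exact: measurableC. Qed.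

Let rVU (F : (set 'rV[R]_d)^nat) : (forall i, rV_measurable_set (F i)) ->
  rV_measurable_set (\bigcup_i F i).
Proof. by rewrite /rV_measurable_set/= preimage_bigcup => ?; exact: bigcupT_measurable. Qed.

HB.instance Definition _ := @isMeasurable.Build
  (measure_tuple_display default_measure_display)
  'rV[R]_d rV_measurable_set rV0 rVC rVU.

End rV_measurable_structure.

Section rV_measurability.
Context {R : realType}.

Lemma rv_measurableE (d : nat) (f : 'rV[R]_d -> R) :
  rv_measurable f <-> measurable_fun [set: 'rV[R]_d] f.
Proof.
split=> mf _ B mB; have := mf measurableT B mB; rewrite !setTI.
  by [].
by [].
Qed.

Lemma measurable_row_of_tuple (d : nat) : measurable_fun [set: d.-tuple R] (@row_of_tuple R d).
Proof. by move=> _ B mB; rewrite setTI. Qed.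

Lemma measurable_coord (d : nat) (i : 'I_d) :
  measurable_fun [set: 'rV[R]_d] (fun x : 'rV[R]_d => x 0 i).
Proof.
apply: (rv_measurableE _).1; rewrite /rv_measurable.
under eq_fun => t do rewrite mxE.
exact: measurable_tnth.
Qed.

Lemma measurable_fun_rowP d0 (T : measurableType d0) (d : nat) (f : T -> 'rV[R]_d) :
  (forall i, measurable_fun [set: T] (fun x => f x 0 i)) -> measurable_fun [set: T] f.
Proof.
move=> mf.
rewrite (_ : f = @row_of_tuple R d \o (@tuple_of_row R d \o f)); last first.
  by apply/funext => x; rewrite /= tuple_of_rowK.
apply: (measurableT_comp (@measurable_row_of_tuple d)).
apply/measurable_fun_tnthP => i; rewrite /comp.
under eq_fun do rewrite tnth_mktuple.
exact: mf.
Qed.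

End rV_measurability.

Section lebesgue_rV.
Context {R : realType}.

(** The same block expression as in [iint], so that one step of the iterated integral is a
    composition with [row_cons]. *)
Definition row_cons (n : nat) (p : R * 'rV[R]_n) : 'rV[R]_n.+1 :=
  row_mx (\row_(j < 1) p.1) p.2.
Definition row_uncons (n : nat) (x : 'rV[R]_n.+1) : R * 'rV[R]_n :=
  (x 0 ord0, \row_i x 0 (lift ord0 i)).

Lemma row_cons0 n (p : R * 'rV[R]_n) : row_cons p 0 ord0 = p.1.
Proof.
rewrite /row_cons; have -> : (ord0 : 'I_n.+1) = lshift n (ord0 : 'I_1) by apply/val_inj.
by rewrite (@row_mxEl _ 1 1 n) mxE.
Qed.

Lemma row_consS n (p : R * 'rV[R]_n) i : row_cons p 0 (lift ord0 i) = p.2 0 i.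
Proof.
rewrite /row_cons; have -> : lift ord0 i = rshift 1 i by apply/val_inj.
by rewrite (@row_mxEr _ 1 1 n).
Qed.

Lemma row_consK n : cancel (@row_cons n) (@row_uncons n).
Proof.
move=> [x v]; rewrite /row_uncons row_cons0; congr pair.
by apply/rowP => i; rewrite mxE row_consS.
Qed.

Lemma row_unconsK n : cancel (@row_uncons n) (@row_cons n).
Proof.
move=> x; apply/rowP => i; case: (unliftP ord0 i) => [j|] ->.
  by rewrite row_consS mxE.
by rewrite row_cons0.
Qed.

Lemma measurable_row_cons n : measurable_fun [set: R * 'rV[R]_n] (@row_cons n).
Proof.
apply: measurable_fun_rowP => i; case: (unliftP ord0 i) => [j|] ->.
  under eq_fun do rewrite row_consS.
  by apply: (measurableT_comp (measurable_coord j)).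
under eq_fun do rewrite row_cons0.
exact: measurable_fst.
Qed.

Lemma measurable_row_uncons n : measurable_fun [set: 'rV[R]_n.+1] (@row_uncons n).
Proof.
have h1 : measurable_fun setT (fun x : 'rV[R]_n.+1 => x 0 ord0) by exact: measurable_coord.
suff h2 : measurable_fun setT (fun x : 'rV[R]_n.+1 => (\row_i x 0 (lift ord0 i) : 'rV[R]_n)).
  exact: measurable_fun_pair h1 h2.
apply: measurable_fun_rowP => i; under eq_fun do rewrite mxE.
exact: measurable_coord.
Qed.

Section push.
Variables (n : nat) (m : {sigma_finite_measure set 'rV[R]_n -> \bar R}).

Definition push_row : set 'rV[R]_n.+1 -> \bar R :=
  pushforward (@lebesgue_measure R \x m)%E (@row_cons n).

Let mpush A : measurable A -> measurable (@row_cons n @^-1` A).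
Proof. by move=> mA; rewrite -[X in measurable X]setTI; exact: measurable_row_cons. Qed.

Let push0 : push_row set0 = 0%E.
Proof. by rewrite /push_row /pushforward preimage_set0 measure0. Qed.

Let push_ge0 A : (0 <= push_row A)%E.
Proof. by rewrite /push_row /pushforward. Qed.

Let push_sigma_additive : semi_sigma_additive push_row.
Proof.
move=> F mF tF mUF; rewrite /push_row /pushforward preimage_bigcup.
apply: measure_semi_sigma_additive.
- by move=> k; exact: mpush.
- apply/trivIsetP => /= i j _ _ ij; rewrite -preimage_setI.
  by move/trivIsetP : tF => /(_ _ _ _ _ ij) ->//; rewrite preimage_set0.
- by rewrite -preimage_bigcup; exact: mpush.
Qed.

HB.instance Definition _ := isMeasure.Build _ _ _ push_row push0 push_ge0 push_sigma_additive.

Lemma push_row_sigma_finite : sigma_finite setT push_row.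
Proof.
have /sigma_finiteP[F [UF ndF mF]] := @sigma_finiteT _ _ _ (@lebesgue_measure R).
have /sigma_finiteP[G [UG ndG mG]] := sigma_finiteT m.
exists (fun k => @row_uncons n @^-1` (F k `*` G k)).
  rewrite -preimage_bigcup (_ : \bigcup_k (F k `*` G k) = setT) ?preimage_setT//.
  rewrite -setXTT UF UG predeqE => -[x y]; split.
    by move=> [k _ []/= ? ?]; split; exists k.
  move=> [/= [k _ Fkx] [l _ Gly]]; exists (maxn k l) => //; split.
  - by move: x Fkx; exact/subsetPset/ndF/leq_maxl.
  - by move: y Gly; exact/subsetPset/ndG/leq_maxr.
move=> k; have [mFk Fk] := mF k; have [mGk Gk] := mG k; split.
  by rewrite -[X in measurable X]setTI; apply: measurable_row_uncons => //; exact: measurableX.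
rewrite /push_row /pushforward -comp_preimage (_ : _ \o _ = id); last first.
  by apply/funext => p /=; rewrite row_consK.
by rewrite preimage_id product_measure1E// lte_mul_pinfty// ge0_fin_numE.
Qed.

HB.instance Definition _ := Measure_isSigmaFinite.Build _ _ _ push_row push_row_sigma_finite.

End push.

(** The recursion mirrors [iint]: the Dirac mass at the only point of R^0 matches its base case.
    Sigma-finiteness is carried along because each product step requires it. *)
Fixpoint leb (n : nat) : {sigma_finite_measure set 'rV[R]_n -> \bar R} :=
  match n return {sigma_finite_measure set 'rV[R]_n -> \bar R} with
  | 0 => \d_(0 : 'rV[R]_0)
  | n'.+1 => push_row (leb n')
  end.

End lebesgue_rV.

(** * Integrable real functions *)

Section real_integrable.
Context d (T : measurableType d) (R : realType) (mu : {measure set T -> \bar R}).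
Implicit Types f g h : T -> R.

Definition Rsummable f := mu.-integrable setT (EFin \o f).

Lemma Rsummable_measurable f : Rsummable f -> measurable_fun setT f.
Proof. by move=> /integrableP[/measurable_EFinP]. Qed.

Lemma le_Rsummable f g : measurable_fun setT f -> (forall x, `|f x| <= g x) ->
  Rsummable g -> Rsummable f.
Proof.
move=> mf fg; apply: le_integrable => //; first exact/measurable_EFinP.
by move=> x _; rewrite /= lee_fin (le_trans (fg x))// ler_norm.
Qed.

Lemma RsummableD f g : Rsummable f -> Rsummable g -> Rsummable (fun x => f x + g x).
Proof. by move=> If Ig; have := integrableD measurableT If Ig. Qed.

Lemma RsummableB f g : Rsummable f -> Rsummable g -> Rsummable (fun x => f x - g x).
Proof. by move=> If Ig; have := integrableB measurableT If Ig. Qed.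

Lemma RsummableZ c f : Rsummable f -> Rsummable (fun x => c * f x).
Proof. by move=> If; have := integrableZl measurableT c If. Qed.

Lemma Rsummable_norm f : Rsummable f -> Rsummable (fun x => `|f x|).
Proof. exact: integrable_norm. Qed.

Lemma Rsummable_sum (I : Type) (s : seq I) (F : I -> T -> R) :
  (forall i, Rsummable (F i)) -> Rsummable (fun x => \sum_(i <- s) F i x).
Proof.
move=> IF; elim: s => [|i s ih].
  under [X in Rsummable X]eq_fun do rewrite big_nil.
  exact: integrable0.
under [X in Rsummable X]eq_fun do rewrite big_cons.
exact: RsummableD.
Qed.

Lemma Rsummable_Mbounded f h (M : R) : Rsummable f -> measurable_fun setT h ->
  (forall x, `|h x| <= M) -> Rsummable (fun x => f x * h x).
Proof.
move=> If mh hM; apply: (@le_Rsummable _ (fun x => M * `|f x|)).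
- by apply: measurable_funM => //; exact: (Rsummable_measurable If).
- by move=> x; rewrite normrM mulrC ler_wpM2r.
- exact/RsummableZ/Rsummable_norm.
Qed.

Lemma ge0_RsummableP f : measurable_fun setT f -> (forall x, 0 <= f x) ->
  Rsummable f <-> (\int[mu]_x (f x)%:E < +oo)%E.
Proof.
move=> mf f0.
split=> [/integrableP[_]|foo].
  by under eq_integral do rewrite /= ger0_norm//.
apply/integrableP; split; first exact/measurable_EFinP.
by under eq_integral do rewrite /= ger0_norm//.
Qed.

Lemma RintegralE f : Rsummable f ->
  ((\int[mu]_x f x)%R%:E = \int[mu]_x (f x)%:E)%E.
Proof. by move=> If; rewrite fineK//; exact: integrable_fin_num. Qed.

Lemma EFin_RintegralE f c : (\int[mu]_x (f x)%:E = c%:E)%E -> \int[mu]_x f x = c.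
Proof. by rewrite /Rintegral => ->. Qed.

Lemma Rsummable_mul f g : measurable_fun setT f -> measurable_fun setT g ->
  Rsummable (fun x => f x ^+ 2) -> Rsummable (fun x => g x ^+ 2) ->
  Rsummable (fun x => f x * g x).
Proof.
move=> mf mg If Ig; apply: (le_Rsummable _ _ (RsummableD If Ig)).
  exact: measurable_funM.
move=> x; rewrite ler_norml; nra.
Qed.

Lemma RsumZ c f : Rsummable f -> \int[mu]_x (c * f x) = c * \int[mu]_x f x.
Proof. exact: RintegralZl. Qed.

Lemma RsumD f g : Rsummable f -> Rsummable g ->
  \int[mu]_x (f x + g x) = \int[mu]_x f x + \int[mu]_x g x.
Proof. exact: RintegralD. Qed.

Lemma RsumB f g : Rsummable f -> Rsummable g ->
  \int[mu]_x (f x - g x) = \int[mu]_x f x - \int[mu]_x g x.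
Proof. exact: RintegralB. Qed.

Lemma ler_Rintegral f g : Rsummable f -> Rsummable g -> (forall x, f x <= g x) ->
  \int[mu]_x f x <= \int[mu]_x g x.
Proof. by move=> If Ig fg; apply: le_Rintegral. Qed.

Lemma ler_norm_Rintegral f g : measurable_fun setT f -> Rsummable g ->
  (forall x, `|f x| <= g x) -> `|\int[mu]_x f x| <= \int[mu]_x g x.
Proof.
move=> mf Ig fg; have If := le_Rsummable mf fg Ig.
apply: (le_trans (le_normr_Rintegral measurableT If)).
by apply: ler_Rintegral => //; exact: Rsummable_norm.
Qed.

Lemma Rintegral_sum (I : Type) (s : seq I) (F : I -> T -> R) :
  (forall i, Rsummable (F i)) ->
  \int[mu]_x (\sum_(i <- s) F i x) = \sum_(i <- s) \int[mu]_x F i x.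
Proof.
move=> IF; elim: s => [|i s ih].
  under eq_Rintegral do rewrite big_nil.
  by rewrite big_nil Rintegral_cst// mul0r.
under eq_Rintegral do rewrite big_cons.
by rewrite big_cons RsumD ?ih//; exact: Rsummable_sum.
Qed.

Lemma Rintegral_dominated (f_ : nat -> T -> R) f g :
  (forall n, measurable_fun setT (f_ n)) -> measurable_fun setT f ->
  (forall x, f_ n x @[n --> \oo] --> f x) ->
  Rsummable g -> (forall n x, `|f_ n x| <= g x) ->
  Rsummable f /\ \int[mu]_x f_ n x @[n --> \oo] --> \int[mu]_x f x.
Proof.
move=> mf_ mf ff Ig fg.
have [If _ cf] : [/\ Rsummable f,
    [sequence \int[mu]_x `|(f_ n x)%:E - (f x)%:E|]_n @ \oo --> 0 &
    [sequence \int[mu]_x (f_ n x)%:E]_n @ \oo --> \int[mu]_x (f x)%:E]%E.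
  apply: (@dominated_convergence _ _ _ mu _ measurableT (fun n x => (f_ n x)%:E)
    (EFin \o f) (EFin \o g)) => //.
  - by move=> n; exact/measurable_EFinP.
  - exact/measurable_EFinP.
  - by apply: aeW => x _ /=; apply: cvg_EFin; [exact: nearW|exact: ff].
  - by apply: aeW => x n _; rewrite /= lee_fin.
split=> //; move: cf; rewrite -(RintegralE If).
exact: fine_cvg.
Qed.

End real_integrable.

Section cvge0.
Context (R : realType).
Local Open Scope ereal_scope.

(** A bound by a real [e] also forces the terms to be finite from some rank on. *)
Lemma cvge0P (f : nat -> \bar R) : (forall N, 0 <= f N) ->
  f @ \oo --> 0 <-> forall e : R, (0 < e)%R -> \forall N \near \oo, f N < e%:E.
Proof.
move=> f0; split.
  move=> /fine_cvgP[ff /cvgr_lt flt] e e0.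
  near=> N.
  have fN : f N \is a fin_num by near: N.
  by rewrite -(fineK fN) lte_fin; near: N; exact: flt.
move=> fe; apply/fine_cvgP; split.
  apply: filterS (fe 1%R ltr01) => N fN.
  by rewrite ge0_fin_numE// (lt_trans fN)// ltry.
apply/cvgrPdist_lt => /= e e0; apply: filterS (fe e e0) => N fN.
rewrite sub0r normrN ger0_norm ?fine_ge0// -lte_fin fineK//.
by rewrite ge0_fin_numE// (lt_trans fN)// ltry.
Unshelve. all: by end_near. Qed.

End cvge0.

(** * Fubini for two summable functions coupled by a bounded kernel *)

Section kernel_fubini.
Context d1 d2 (T1 : measurableType d1) (T2 : measurableType d2) (R : realType).
Variables (m1 : {sigma_finite_measure set T1 -> \bar R})
  (m2 : {sigma_finite_measure set T2 -> \bar R}).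
Variables (a : T1 -> R) (b : T2 -> R) (k : T1 * T2 -> R) (M : R).
Hypotheses (Ia : Rsummable m1 a) (Ib : Rsummable m2 b)
  (mk : measurable_fun setT k) (kM : forall p, `|k p| <= M).

Let mk1 x : measurable_fun setT (fun y => k (x, y)).
Proof. exact: (measurableT_comp mk (measurable_pair1 x)). Qed.

Let mk2 y : measurable_fun setT (fun x => k (x, y)).
Proof. exact: (measurableT_comp mk (measurable_pair2 y)). Qed.

Let f (p : T1 * T2) := a p.1 * (b p.2 * k p).

Let mf : measurable_fun setT f.
Proof.
apply: measurable_funM; first exact: measurableT_comp (Rsummable_measurable Ia) _.
by apply: measurable_funM mk; exact: measurableT_comp (Rsummable_measurable Ib) _.
Qed.

Let I1 x : Rsummable m2 (fun y => b y * k (x, y)).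
Proof. exact: (@Rsummable_Mbounded _ _ _ _ _ _ M). Qed.

Let I2 y : Rsummable m1 (fun x => a x * k (x, y)).
Proof. exact: (@Rsummable_Mbounded _ _ _ _ _ _ M). Qed.

Let If : (m1 \x m2)%E.-integrable setT (EFin \o f).
Proof.
apply/integrable12ltyP; first exact/measurable_EFinP.
apply: (@le_lt_trans _ _ (\int[m1]_x (`|a x| * (M * \int[m2]_y `|b y|)%R)%:E)%E).
  apply: ge0_le_integral => //.
  - by move=> x _; exact: integral_ge0.
  - apply: (measurable_fun_fubini_tonelli_F (fun p => `|(f p)%:E|)%E) => //.
    by apply: measurableT_comp => //; exact/measurable_EFinP.
  - apply/measurable_EFinP; apply: measurable_funM => //.
    by apply: measurableT_comp => //; exact: (Rsummable_measurable Ia).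
  move=> x _.
  have Ix : Rsummable m2 (fun y => `|a x| * (M * `|b y|)).
    exact/RsummableZ/RsummableZ/Rsummable_norm.
  have -> : ((`|a x| * (M * \int[m2]_y `|b y|)) = \int[m2]_y (`|a x| * (M * `|b y|)))%R.
    rewrite RintegralZl//; last exact/RsummableZ/Rsummable_norm.
    by rewrite RintegralZl//; exact: Rsummable_norm.
  rewrite (RintegralE Ix); apply: ge0_le_integral => //.
  - apply: measurableT_comp => //; apply/measurable_EFinP.
    exact: (Rsummable_measurable (RsummableZ (a x) (I1 x))).
  - exact: (measurable_int m2).
  - move=> y _; rewrite /= lee_fin /f /= !normrM ler_wpM2l// mulrC ler_wpM2r//.
have -> : (\int[m1]_x (`|a x| * (M * \int[m2]_y `|b y|)%R)%:E =
   (\int[m1]_x (`|a x| * (M * \int[m2]_y `|b y|)))%:E)%E.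
  rewrite RintegralE//.
  have := RsummableZ (M * \int[m2]_y `|b y|) (Rsummable_norm Ia).
  by under [X in Rsummable _ X]eq_fun do rewrite mulrC.
exact: ltry.
Qed.

Lemma kernel_fubini_summable1 : Rsummable m1 (fun x => a x * \int[m2]_y (b y * k (x, y))).
Proof.
have := integrable_fubini_F If; apply: eq_integrable => // x _.
rewrite /fubini_F /f /= -RintegralE; last exact: RsummableZ.
by rewrite RsumZ.
Qed.

Lemma kernel_fubini : \int[m1]_x (a x * \int[m2]_y (b y * k (x, y))) =
  \int[m2]_y (b y * \int[m1]_x (a x * k (x, y))).
Proof.
have := Fubini If; rewrite /f /= => E.
congr fine.
transitivity (\int[m1]_x \int[m2]_y (a x * (b y * k (x, y)))%:E)%E.
  apply: eq_integral => x _.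
  by rewrite -RintegralE ?RsumZ//; exact: RsummableZ.
rewrite E; apply: eq_integral => y _.
under eq_integral do rewrite mulrCA.
by rewrite -RintegralE ?RsumZ//; exact: RsummableZ.
Qed.

Lemma measurable_kernel_integral :
  measurable_fun setT (fun x => \int[m2]_y (b y * k (x, y))).
Proof.
apply/measurable_EFinP.
have mg : measurable_fun setT (fun p : T1 * T2 => (b p.2 * k p)%:E).
  apply/measurable_EFinP; apply: measurable_funM mk.
  exact: measurableT_comp (Rsummable_measurable Ib) _.
(* Tonelli gives measurability of partial integrals of nonnegative functions, hence the split into
   positive and negative parts. *)
rewrite (_ : EFin \o _ =
    (fun x => \int[m2]_y ((fun p => (b p.2 * k p)%:E)^\+ (x, y))
            - \int[m2]_y ((fun p => (b p.2 * k p)%:E)^\- (x, y)))%E).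
  apply: emeasurable_funB.
  - by apply: measurable_fun_fubini_tonelli_F => //; exact: measurable_funepos.
  - by apply: measurable_fun_fubini_tonelli_F => //; exact: measurable_funeneg.
apply/funext => x; rewrite /comp (RintegralE (I1 x)) [LHS]integralE.
by congr (_ - _)%E; apply: eq_integral => y _; rewrite ?funeposE ?funenegE.
Qed.

End kernel_fubini.

Section iterated_integral.
Context {R : realType}.
Local Notation lam := (@lebesgue_measure R).

Lemma ge0_integral_lebS n (f : 'rV[R]_n.+1 -> \bar R) :
  measurable_fun setT f -> (forall x, 0 <= f x)%E ->
  (\int[leb n.+1]_x f x = \int[lam]_x \int[leb n]_v f (row_cons (x, v)))%E.
Proof.
move=> mf f0.
have mc := @measurable_row_cons R n.
rewrite /= /push_row ge0_integral_pushforward//.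
rewrite preimage_setT fubini_tonelli1//; last first.
  by move=> p; exact: f0.
exact: (measurableT_comp mf mc).
Qed.

(** Tonelli, one coordinate at a time. Through this bridge every integral of the definitions becomes
    an integral against [leb n]. *)
Lemma iint_lebE n (f : 'rV[R]_n -> \bar R) :
  measurable_fun setT f -> (forall x, 0 <= f x)%E ->
  iint f = (\int[leb n]_x f x)%E.
Proof.
elim: n f => [|n ih] f mf f0.
  by rewrite /= integral_dirac// diracT mul1e.
rewrite ge0_integral_lebS//=; apply: eq_integral => x _.
rewrite ih//.
have mx : measurable_fun setT (fun v : 'rV[R]_n => row_cons (x, v)).
  exact: (measurableT_comp (@measurable_row_cons R n) (measurable_pair1 x)).
exact: (measurableT_comp mf mx).
Qed.

Lemma Rsummable_lebS n (f : 'rV[R]_n.+1 -> R) : Rsummable (leb n.+1) f ->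
  (lam \x leb n)%E.-integrable setT (EFin \o (f \o @row_cons R n)).
Proof.
move=> /integrableP[mf foo]; apply/integrableP; split.
  exact: (measurableT_comp mf (@measurable_row_cons R n)).
move: foo; rewrite /= /push_row ge0_integral_pushforward//.
- exact: measurable_row_cons.
- apply/measurable_EFinP; apply: measurableT_comp => //; exact/measurable_EFinP.
Qed.

(** Reduces Gaussians and product majorants on R^n to one variable. *)
Lemma leb_prod n (h : 'I_n -> R -> R) (c : 'I_n -> R) :
  (forall i x, 0 <= h i x) -> (forall i, measurable_fun setT (h i)) ->
  (forall i, \int[lam]_x (h i x)%:E = (c i)%:E)%E ->
  (\int[leb n]_x (\prod_i h i (x 0 i))%:E = (\prod_i c i)%:E)%E.
Proof.
have mprod m (g : 'I_m -> R -> R) : (forall i, measurable_fun setT (g i)) ->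
    measurable_fun setT (fun x : 'rV[R]_m => (\prod_i g i (x 0 i))%:E).
  move=> mg; apply/measurable_EFinP; apply: measurable_prod => i _.
  exact: (measurableT_comp (mg i) (measurable_coord i)).
elim: n h c => [|n ih] h c h0 mh hc.
  by rewrite /= integral_dirac// ?diracT ?mul1e ?big_ord0//; exact: mprod.
rewrite ge0_integral_lebS//; last 2 first.
- exact: mprod.
- by move=> x; rewrite lee_fin prodr_ge0.
transitivity (\int[lam]_x ((h ord0 x)%:E * (\prod_i c (lift ord0 i))%:E))%E.
  apply: eq_integral => x _.
  under eq_integral => v _.
    rewrite big_ord_recl row_cons0.
    under eq_bigr do rewrite row_consS.
    rewrite EFinM /=.
    over.
  rewrite ge0_integralZl_EFin//.
  - by rewrite (ih (fun i => h (lift ord0 i)) (fun i => c (lift ord0 i))).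
  - by move=> v _; rewrite lee_fin prodr_ge0.
  - by apply: (mprod _ (fun i => h (lift ord0 i))) => i; exact: mh.
rewrite ge0_integralZr//.
- by rewrite hc -EFinM big_ord_recl.
- by apply/measurable_EFinP; exact: (mh ord0).
- by move=> x _; rewrite lee_fin.
- rewrite lee_fin prodr_ge0// => i _.
  by rewrite -lee_fin -hc integral_ge0// => x _; rewrite lee_fin.
Qed.

End iterated_integral.

(** * Fourier transform of the Gaussian *)

Section derivatives.
Context {R : realType}.

Lemma is_derive_linear (b x : R) : is_derive x 1 (fun y : R => b * y) b.
Proof.
apply: (@is_derive_eq _ _ _ (b \*: (@id R)) _ _ _ _ (is_deriveZ _ _)).
by rewrite /GRing.scale /= mulr1.
Qed.

Lemma is_derive_expR_quad (c x : R) :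
  is_derive x 1 (fun y : R => expR (c * y ^+ 2)) (2 * c * x * expR (c * x ^+ 2)).
Proof.
have h : is_derive x 1 (fun y : R => c * y ^+ 2) (2 * c * x).
  apply: (@is_derive_eq _ _ _ (c \*: ((@id R) ^+ 2)) _ _ _ _ (is_deriveZ _ _)).
  by rewrite /GRing.scale /= expr1; ring.
apply: (@is_derive_eq _ _ _ (expR \o (fun y : R => c * y ^+ 2)) _ _ _ _ (is_derive1_comp (is_derive_expR _) h)).
by rewrite mulrC.
Qed.

Lemma is_derive_continuous (F F' : R -> R) :
  (forall x : R, is_derive x 1 F (F' x)) -> continuous F.
Proof.
move=> dF x; apply: differentiable_continuous; apply/derivable1_diffP.
by have [] := dF x.
Qed.

(** Integration by parts on the whole line: the fundamental theorem of calculus on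
    [-(n + 1), n + 1], then dominated convergence. The index is shifted so that no interval is
    degenerate. *)
Lemma Rintegral_derivative_eq0 (F F' : R -> R) :
  (forall x : R, is_derive x 1 F (F' x)) -> continuous F' ->
  Rsummable (@lebesgue_measure R) F' ->
  F n%:R @[n --> \oo] --> 0 -> F (- n%:R) @[n --> \oo] --> 0 ->
  \int[@lebesgue_measure R]_x F' x = 0.
Proof.
move=> dF cF' IF' Fp Fm.
have mF' := Rsummable_measurable IF'.
have mf_ (n : nat) : measurable_fun setT (fun x => F' x * \1_(`[- n.+1%:R, n.+1%:R] : set R) x).
  by apply: measurable_funM => //; exact: measurable_indic.
have [_ h] : Rsummable (@lebesgue_measure R) F' /\
    \int[lebesgue_measure]_x (F' x * \1_(`[- n.+1%:R, n.+1%:R] : set R) x) @[n --> \oo]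
    --> \int[@lebesgue_measure R]_x F' x.
  apply: (@Rintegral_dominated _ _ _ (@lebesgue_measure R) _ _ (fun x => `|F' x|) mf_ mF') => [x||n x]; last 2 first.
  - exact: Rsummable_norm.
  - by rewrite indicE normrM ler_piMr// ger0_norm; case: (_ \in _).
  - apply: cvg_near_cst.
    near=> n; rewrite indicE mem_set ?mulr1//= in_itv/=.
    have : `|(x : R)| <= n.+1%:R.
      near: n; exists (Num.trunc `|(x : R)|) => //= n /= xn.
      by rewrite ltW// (lt_le_trans (truncnS_gt _))// ler_nat ltnS.
    by rewrite ler_norml.
apply: (@cvg_unique _ _ (\int[lebesgue_measure]_x (F' x * \1_(`[- n.+1%:R, n.+1%:R] : set R) x) @[n --> \oo])).
- exact: Rhausdorff.
- exact: h.
- have -> : (fun n => \int[lebesgue_measure]_x (F' x * \1_(`[- n.+1%:R, n.+1%:R] : set R) x)) =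
    (fun n => F n.+1%:R - F (- n.+1%:R)).
    apply/funext => n; rewrite -[RHS]/(fine (F n.+1%:R - F (- n.+1%:R))%:E).
    have n0 : - n.+1%:R < n.+1%:R :> R by rewrite gtrN.
    have dFb a : derivable F a 1 by have [] := dF a.
    have cF := is_derive_continuous dF.
    rewrite EFinB -(@continuous_FTC2 _ F' F _ _ n0).
    + rewrite /Rintegral; congr fine.
      rewrite [RHS]integral_mkcond; apply: eq_integral => x _.
      by rewrite /= restrict_EFin patch_indic.
    + exact: continuous_subspaceT.
    + split; [by move=> a _|exact/cvg_at_right_filter/cF|exact/cvg_at_left_filter/cF].
    + by move=> a _; rewrite derive1E; have [_ ->] := dF a.
  have Fp1 : F n.+1%:R @[n --> \oo] --> 0 by rewrite (cvg_shiftS (fun n => F n%:R)).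
  have Fm1 : F (- n.+1%:R) @[n --> \oo] --> 0 by rewrite (cvg_shiftS (fun n => F (- n%:R))).
  suff : (F n.+1%:R - F (- n.+1%:R)) @[n --> \oo] --> (0 - 0 : R) by rewrite subrr.
  exact: cvgB.
Unshelve. all: by end_near. Qed.

End derivatives.

Section gaussian.
Context {R : realType}.
Local Notation lam := (@lebesgue_measure R).

(** The normalisation for which the Fourier transform is [a^-1 * gauss a^-1]. *)
Definition gauss (a x : R) := expR (- (pi * a ^+ 2) * x ^+ 2).

Lemma gauss_ge0 a x : 0 <= gauss a x. Proof. exact: expR_ge0. Qed.

Lemma gauss_le1 a x : gauss a x <= 1.
Proof.
rewrite /gauss -[leRHS]expR0 ler_expR mulNr oppr_le0.
by rewrite mulr_ge0 ?sqr_ge0// mulr_ge0 ?pi_ge0 ?sqr_ge0.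
Qed.

Lemma measurable_gauss a : measurable_fun [set: R] (gauss a).
Proof.
apply: measurableT_comp => //; apply: measurable_funM => //.
Qed.

Lemma integral_gauss_center (a m : R) : 0 < a ->
  (\int[lam]_x (gauss a (x - m))%:E = (a^-1)%:E)%E.
Proof.
(* The standard deviation for which the normal density has exponent - pi a^2 (x - m)^2. *)
move=> a0; pose s := (a * Num.sqrt (pi *+ 2))^-1.
have p0 : 0 < Num.sqrt (pi *+ 2) :> R by rewrite sqrtr_gt0 mulrn_wgt0// pi_gt0.
have s0 : s != 0 by rewrite invr_neq0// mulf_neq0 ?gt_eqF.
have s2 : s ^+ 2 * (pi *+ 2) = a ^- 2.
  rewrite /s exprVn exprMn sqr_sqrtr; last by rewrite mulrn_wge0// pi_ge0.
  by move: (pi : R) (pi_gt0 R) => p pp; field; rewrite !gt_eqF.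
have := @integral_normal_pdf R m s.
rewrite normal_pdfE// /normal_peak.
have -> : Num.sqrt (s ^+ 2 * pi *+ 2) = a^-1.
  by rewrite -mulrnAr s2 -exprVn sqrtr_sqr gtr0_norm// invr_gt0.
rewrite invrK.
have E x : normal_fun m s x = gauss a (x - m).
  rewrite /normal_fun /gauss; congr expR.
  have -> : a ^+ 2 = (s ^+ 2 * (pi *+ 2))^-1 by rewrite s2 invrK.
  by move: (pi : R) (pi_gt0 R) => p pp; field; rewrite s0 gt_eqF.
under eq_integral do rewrite E EFinM.
rewrite ge0_integralZl_EFin//=; last 3 first.
- by move=> x _; rewrite lee_fin gauss_ge0.
- apply/measurable_EFinP; apply: measurableT_comp; first exact: measurable_gauss.
  exact: measurable_funB.
- exact: ltW.
move=> /(congr1 (fun z => (a^-1)%:E * z)%E).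
by rewrite muleA -EFinM mulVf ?gt_eqF// mul1e mule1.
Qed.

Lemma integral_gauss (a : R) : 0 < a -> (\int[lam]_x (gauss a x)%:E = (a^-1)%:E)%E.
Proof.
move=> a0; rewrite -(integral_gauss_center 0 a0).
by apply: eq_integral => x _; rewrite subr0.
Qed.

Lemma Rsummable_gauss (a : R) : 0 < a -> Rsummable lam (gauss a).
Proof.
move=> a0; apply/ge0_RsummableP.
- exact: measurable_gauss.
- exact: gauss_ge0.
- by rewrite integral_gauss// ltry.
Qed.

Lemma Rintegral_gauss (a : R) : 0 < a -> \int[lam]_x gauss a x = a^-1.
Proof.
by move=> a0; rewrite /Rintegral integral_gauss.
Qed.

(** A factor [gauss (a / 2)] is set aside to keep summability; the remaining exp(- c x^2), with c =
    pi (a^2 - a^2 / 4), absorbs |x|. *)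
Lemma norm_mul_gauss_le (a x : R) : 0 < a ->
  `|x| * gauss a x <= (1 + (pi * a ^+ 2 * 3 / 4)^-1) * gauss (a / 2) x.
Proof.
move=> a0; set c := pi * a ^+ 2 * 3 / 4.
have c0 : 0 < c by rewrite /c !mulr_gt0// ?pi_gt0 ?exprn_gt0.
have -> : gauss a x = expR (- c * x ^+ 2) * gauss (a / 2) x.
  by rewrite /gauss -expRD; congr expR; rewrite /c; move: (pi : R) => p; field.
rewrite mulrA ler_wpM2r ?gauss_ge0//.
rewrite mulNr expRN ler_pdivrMr ?expR_gt0//.
have h1 : 1 + c * x ^+ 2 <= expR (c * x ^+ 2) by exact: expR_ge1Dx.
have h2 : `|x| <= (1 + c^-1) * (1 + c * x ^+ 2).
  have -> : (1 + c^-1) * (1 + c * x ^+ 2) = 1 + x ^+ 2 + c^-1 + c * x ^+ 2.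
    by field; rewrite gt_eqF.
  have : 0 <= c^-1 by rewrite invr_ge0 ltW.
  have : 0 <= c * x ^+ 2 by rewrite mulr_ge0 ?sqr_ge0// ltW.
  have : `|x| ^+ 2 = x ^+ 2 by rewrite -normrX ger0_norm ?sqr_ge0.
  by move=> <- ? ?; nra.
by apply: (le_trans h2); rewrite ler_wpM2l// addr_ge0// invr_ge0 ltW.
Qed.

Lemma Rsummable_norm_mul_gauss (a : R) : 0 < a ->
  Rsummable lam (fun x => `|x| * gauss a x).
Proof.
move=> a0; apply: (@le_Rsummable _ _ _ lam _
  (fun x => (1 + (pi * a ^+ 2 * 3 / 4)^-1) * gauss (a / 2) x)).
- apply: measurable_funM; last exact: measurable_gauss.
  exact: normr_measurable.
- by move=> x; rewrite ger0_norm ?norm_mul_gauss_le// mulr_ge0// gauss_ge0.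
- by apply: RsummableZ; apply: Rsummable_gauss; rewrite divr_gt0.
Qed.

Lemma gauss_cvg0 (a : R) : 0 < a ->
  exists C, forall n : nat, gauss a n%:R <= C * harmonic n.
Proof.
move=> a0; exists (2 + (pi * a ^+ 2 * 3 / 4)^-1) => n.
rewrite /harmonic/= ler_pdivlMr ?ltr0n//.
have := norm_mul_gauss_le n%:R a0; rewrite ger0_norm//.
have c0 : 0 <= (pi * a ^+ 2 * 3 / 4)^-1.
  by rewrite invr_ge0 ltW // !mulr_gt0// ?pi_gt0 ?exprn_gt0.
have := gauss_le1 a n%:R; have := gauss_le1 (a / 2) n%:R.
have := gauss_ge0 (a / 2) n%:R.
rewrite -natr1; move: (gauss _ _) (gauss _ _) c0; move: (_^-1) => c g1 g2 c0 *; nra.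
Qed.

Section gaussian_fourier.
Variables (a t : R).
Hypothesis a0 : 0 < a.

Let h (b x : R) := gauss a x * cos (2 * pi * (b * x) + t).

Let mlin b : measurable_fun [set: R] (fun x => 2 * pi * (b * x) + t).
Proof. by apply: measurable_funD => //; apply: measurable_funM => //; apply: measurable_funM. Qed.

Let mcos b : measurable_fun [set: R] (fun x => cos (2 * pi * (b * x) + t)).
Proof.
have mcos : measurable_fun setT (@cos R).
  by apply: continuous_measurable_fun; exact: continuous_cos.
exact: measurableT_comp mcos (mlin b).
Qed.

Let msin b : measurable_fun [set: R] (fun x => sin (2 * pi * (b * x) + t)).
Proof.
have msin : measurable_fun setT (@sin R).
  by apply: continuous_measurable_fun; exact: continuous_sin.
exact: measurableT_comp msin (mlin b).
Qed.

Let Ih b : Rsummable lam (h b).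
Proof.
apply: (@Rsummable_Mbounded _ _ _ _ _ _ 1 (Rsummable_gauss a0) (mcos b)).
by move=> x; exact: cos_max.
Qed.

Let dcos (g : R -> R) (x b : R) : is_derive x 1 g b ->
  is_derive x 1 (cos \o g) (- sin (g x) * b).
Proof. exact: is_derive1_comp. Qed.

Let dsin (g : R -> R) (x b : R) : is_derive x 1 g b ->
  is_derive x 1 (sin \o g) (cos (g x) * b).
Proof. exact: is_derive1_comp. Qed.

Let dlinx (b x : R) : is_derive x 1 (fun x => 2 * pi * (b * x) + t) (2 * pi * b).
Proof.
rewrite (_ : (fun x => _) = (fun x => (2 * pi * b) * x) + cst t); last first.
  by apply/funext => y; rewrite /= mulrA.
apply: (@is_derive_eq _ _ _ _ _ _ _ _ (is_deriveD (is_derive_linear _ x) (is_derive_cst _ _ _))).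
by rewrite addr0.
Qed.

Let dlinb (b x : R) : is_derive b 1 (fun b => 2 * pi * (b * x) + t) (2 * pi * x).
Proof.
rewrite (_ : (fun x => _) = (fun b => (2 * pi * x) * b) + cst t); last first.
  by apply/funext => y; rewrite /= mulrA mulrAC.
apply: (@is_derive_eq _ _ _ _ _ _ _ _ (is_deriveD (is_derive_linear _ b) (is_derive_cst _ _ _))).
by rewrite addr0.
Qed.

Let dh (b x : R) : is_derive b 1 (h ^~ x)
  (- (2 * pi * (x * gauss a x * sin (2 * pi * (b * x) + t)))).
Proof.
have d1 := dcos (dlinb b x).
apply: (@is_derive_eq _ _ _ (gauss a x \*: (cos \o (fun b => 2 * pi * (b * x) + t))) _ _ _ _ (is_deriveZ _ d1)).
by rewrite /GRing.scale/=; move: (pi : R) => p; ring.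
Qed.

Let sinpart b x := gauss a x * sin (2 * pi * (b * x) + t).
Let sinpart' b x := - (2 * pi * a ^+ 2) * (x * gauss a x * sin (2 * pi * (b * x) + t)) + 2 * pi * b * h b x.

Let dsinpart (b x : R) : is_derive x 1 (sinpart b) (sinpart' b x).
Proof.
have d1 := dsin (dlinx b x).
have d2 := is_derive_expR_quad (- (pi * a ^+ 2)) x.
apply: (@is_derive_eq _ _ _ (gauss a * (sin \o (fun x => 2 * pi * (b * x) + t))) _ _ _ _ (is_deriveM d2 d1)).
rewrite /GRing.scale/= /sinpart' /h -/(gauss a x).
by move: (pi : R) (gauss a x) (sin _) (cos _) => p g s c; ring.
Qed.

Let Ixs b : Rsummable lam (fun x => x * gauss a x * sin (2 * pi * (b * x) + t)).
Proof.
apply: (@Rsummable_Mbounded _ _ _ lam (fun x => x * gauss a x) _ 1 _ (msin b)); last first.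
  by move=> x; exact: sin_max.
apply: (le_Rsummable _ _ (Rsummable_norm_mul_gauss a0)).
  by apply: measurable_funM => //; exact: measurable_gauss.
by move=> x; rewrite normrM (ger0_norm (gauss_ge0 _ _)).
Qed.

Let J b := \int[lam]_x h b x.
Let S b := \int[lam]_x (x * gauss a x * sin (2 * pi * (b * x) + t)).

(** Integration by parts: [sinpart b] vanishes at both infinities, so its derivative has integral
    zero, and the two terms of that derivative are the two sides. *)
Let SE b : a ^+ 2 * S b = b * J b.
Proof.
have cs : continuous (sinpart' b).
  have c1 : continuous (fun x : R => x * gauss a x * sin (2 * pi * (b * x) + t)).
    move=> x; apply: cvgM.
      apply: cvgM; first exact: cvg_id.
      exact: (is_derive_continuous (is_derive_expR_quad _)).
    have ds y := dsin (dlinx b y).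
    exact: (is_derive_continuous ds).
  have c2 : continuous (h b).
    move=> x; apply: cvgM.
      exact: (is_derive_continuous (is_derive_expR_quad _)).
    have ds y := dcos (dlinx b y).
    exact: (is_derive_continuous ds).
  move=> x; apply: cvgD; apply: cvgM; [exact: cvg_cst|exact: c1|exact: cvg_cst|exact: c2].
have sE : sinpart' b = (fun x => - (2 * pi * a ^+ 2) * (x * gauss a x * sin (2 * pi * (b * x) + t)) + 2 * pi * b * h b x) by [].
have Is : Rsummable lam (sinpart' b).
  by rewrite sE; apply: RsummableD; apply: RsummableZ; [exact: Ixs|exact: Ih].
have [C hC] := gauss_cvg0 a0.
have hcv : C * harmonic n @[n --> \oo] --> (0 : R).
  rewrite -(mulr0 C); apply: cvgM; [exact: cvg_cst|exact: cvg_harmonic].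
have hcv' : - (C * harmonic n) @[n --> \oo] --> (0 : R) by rewrite -oppr0; exact: cvgN.
have sb y n : gauss a y = gauss a n%:R -> - (C * harmonic n) <= sinpart b y <= C * harmonic n.
  move=> yn; rewrite -ler_norml /sinpart normrM (ger0_norm (gauss_ge0 _ _)) yn.
  by rewrite (le_trans _ (hC n))// ler_piMr ?gauss_ge0// sin_max.
have := Rintegral_derivative_eq0 (dsinpart b) cs Is.
rewrite sE RsumD; [|exact: RsummableZ (Ixs b)|exact: RsummableZ (Ih b)].
rewrite (RsumZ _ (Ixs b)) (RsumZ _ (Ih b)) -/(S b) -/(J b) => /(_ _ _)-H.
have {}H : - (2 * pi * a ^+ 2) * S b + 2 * pi * b * J b = 0.
  apply: H.
  - by apply: squeeze_cvgr hcv' hcv; apply: nearW => n; exact: sb.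
  - apply: squeeze_cvgr hcv' hcv; apply: nearW => n; apply: sb.
    by rewrite /gauss sqrrN.
have p0 := pi_gt0 R; move: (pi : R) p0 H => p p0 H.
apply: (@mulfI _ (2 * p)); first by rewrite mulf_neq0// gt_eqF.
by apply/eqP; rewrite -subr_eq0; apply/eqP; rewrite -[RHS]oppr0 -[in RHS]H; ring.
Qed.

Let dJ (b : R) : is_derive b 1 J (- (2 * pi * S b)).
Proof.
have bI : b \in `](b - 1), (b + 1)[ by rewrite in_itv/= ltrBlDr ltrDl ltr01.
have I1 x : `](b - 1), (b + 1)[%classic x -> lam.-integrable setT (EFin \o h x) by move=> _; exact: Ih.
have d1 x y : `](b - 1), (b + 1)[%classic x -> setT y -> derivable (h ^~ y) x 1.
  by move=> _ _; have [] := dh x y.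
have pE x y : partial1of2 h x y = - (2 * pi * (y * gauss a y * sin (2 * pi * (x * y) + t))).
  by rewrite partial1of2E; have [_ ->] := dh x y.
pose G y := 2 * pi * (`|y| * gauss a y).
have G0 y : 0 <= G y by rewrite !mulr_ge0 ?pi_ge0// gauss_ge0.
have IG : lam.-integrable setT (EFin \o G) by apply: RsummableZ; exact: Rsummable_norm_mul_gauss.
have Gub x y : `](b - 1), (b + 1)[%classic x -> setT y -> `|partial1of2 h x y| <= G y.
  move=> _ _; rewrite pE normrN /G normrM ger0_norm ?mulr_ge0 ?pi_ge0//.
  rewrite ler_wpM2l ?mulr_ge0 ?pi_ge0// 2!normrM (ger0_norm (gauss_ge0 _ _)).
  by rewrite ler_piMr ?mulr_ge0 ?gauss_ge0// sin_max.
have der := @derivable_under_integral _ _ _ lam h setT measurableT b (b - 1) (b + 1) bI I1 d1 G G0 IG Gub.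
have val := @differentiation_under_integral _ _ _ lam h setT measurableT b (b - 1) (b + 1) bI I1 d1 G G0 IG Gub.
apply: DeriveDef; first exact: der.
rewrite -derive1E val /S -mulNr -RsumZ//.
  by apply: eq_Rintegral => y _; rewrite pE mulNr.
Qed.

(** Differentiation under the integral and [SE] give J' = - (2 pi b / a^2) J, so that J times exp(pi
    b^2 / a^2) is constant. The phase [t] is there for the induction on the dimension. *)
Lemma Rintegral_gauss_cos b :
  \int[lam]_x (gauss a x * cos (2 * pi * (b * x) + t)) = cos t * a^-1 * gauss a^-1 b.
Proof.
rewrite -/(J b).
have dH (x : R) : is_derive x 1 (J * (fun y => expR (pi * a ^- 2 * y ^+ 2))) 0.
  have d2 := is_derive_expR_quad (pi * a ^- 2) x.
  apply: (@is_derive_eq _ _ _ _ _ _ _ _ (is_deriveM (dJ x) d2)).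
  rewrite /GRing.scale/=.
  have -> : S x = a ^- 2 * (x * J x) by rewrite -SE mulrA mulVf ?mul1r// expf_neq0// gt_eqF.
  move: (J x) (expR (pi / a ^+ 2 * x ^+ 2)) => j e.
  by move: (pi : R) => p; field; rewrite gt_eqF.
have H : J b * expR (pi * a ^- 2 * b ^+ 2) = J 0 * expR (pi * a ^- 2 * 0 ^+ 2).
  exact: (is_derive_0_is_cst b 0 dH).
move: H; rewrite expr0n/= mulr0 expR0 mulr1.
have -> : J 0 = cos t * a^-1.
  rewrite /J /h.
  under eq_Rintegral do rewrite mul0r mulr0 add0r mulrC.
  by rewrite RsumZ ?Rintegral_gauss//; exact: Rsummable_gauss.
move=> <-; rewrite /gauss -[RHS]mulrA -expRD exprVn mulNr addrN expR0 mulr1//.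
Qed.

End gaussian_fourier.

End gaussian.

Section row_functions.
Context {R : realType}.

Lemma sqn_row_cons n (x : R) (v : 'rV[R]_n) : sqn (row_cons (x, v)) = x ^+ 2 + sqn v.
Proof.
rewrite /sqn big_ord_recl row_cons0; congr (_ + _).
by apply: eq_bigr => i _; rewrite row_consS.
Qed.

Lemma dotp_row_cons n (z : 'rV[R]_n.+1) (x : R) (v : 'rV[R]_n) :
  dotp z (row_cons (x, v)) = z 0 ord0 * x + dotp (row_uncons z).2 v.
Proof.
rewrite /dotp big_ord_recl row_cons0; congr (_ + _).
by apply: eq_bigr => i _; rewrite row_consS mxE.
Qed.

Lemma sqn_uncons n (z : 'rV[R]_n.+1) : sqn z = z 0 ord0 ^+ 2 + sqn (row_uncons z).2.
Proof. by rewrite -[in LHS](row_unconsK z) sqn_row_cons. Qed.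

Lemma sqn_ge0 n (x : 'rV[R]_n) : 0 <= sqn x.
Proof. by rewrite /sqn sumr_ge0// => i _; exact: sqr_ge0. Qed.

Lemma sqnN n (x : 'rV[R]_n) : sqn (- x) = sqn x.
Proof. by apply: eq_bigr => i _; rewrite mxE sqrrN. Qed.

Lemma dotpC n (x y : 'rV[R]_n) : dotp x y = dotp y x.
Proof. by apply: eq_bigr => i _; rewrite mulrC. Qed.

Lemma dotpDl n (x y z : 'rV[R]_n) : dotp (x + y) z = dotp x z + dotp y z.
Proof. by rewrite /dotp -big_split; apply: eq_bigr => i _; rewrite mxE mulrDl. Qed.

Lemma dotpBl n (x y z : 'rV[R]_n) : dotp (x - y) z = dotp x z - dotp y z.
Proof. by rewrite /dotp -sumrB; apply: eq_bigr => i _; rewrite !mxE mulrBl. Qed.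

Lemma measurable_cos : measurable_fun [set: R] (@cos R).
Proof. by apply: continuous_measurable_fun; exact: continuous_cos. Qed.

Lemma measurable_sin : measurable_fun [set: R] (@sin R).
Proof. by apply: continuous_measurable_fun; exact: continuous_sin. Qed.

Lemma measurable_sqn n : measurable_fun [set: 'rV[R]_n] (@sqn R n).
Proof.
apply: measurable_sum => i; apply: measurable_funX; exact: measurable_coord.
Qed.

Lemma measurable_fun_dotp d (T : measurableType d) n (f g : T -> 'rV[R]_n) :
  measurable_fun setT f -> measurable_fun setT g ->
  measurable_fun setT (fun t => dotp (f t) (g t)).
Proof.
move=> mf mg; apply: measurable_sum => i; apply: measurable_funM.
- exact: measurableT_comp (measurable_coord i) mf.
- exact: measurableT_comp (measurable_coord i) mg.
Qed.

Lemma measurable_fun_subrow d (T : measurableType d) n (f g : T -> 'rV[R]_n) :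
  measurable_fun setT f -> measurable_fun setT g ->
  measurable_fun setT (fun t => f t - g t).
Proof.
move=> mf mg; apply: measurable_fun_rowP => i.
under eq_fun do rewrite mxE [X in _ + X]mxE.
apply: measurable_funB.
- exact: measurableT_comp (measurable_coord i) mf.
- exact: measurableT_comp (measurable_coord i) mg.
Qed.

End row_functions.

Section gaussian_rV.
Context {R : realType}.
Local Notation lam := (@lebesgue_measure R).

Lemma Rintegral_lebS n (f : 'rV[R]_n.+1 -> R) : Rsummable (leb n.+1) f ->
  (forall x, Rsummable (leb n) (fun v => f (row_cons (x, v)))) ->
  \int[leb n.+1]_x f x = \int[lam]_x \int[leb n]_v f (row_cons (x, v)).
Proof.
move=> If Ifx; have Ic := Rsummable_lebS If.
rewrite /Rintegral; congr fine.
have mf : measurable_fun setT (EFin \o f).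
  by apply/measurable_EFinP; exact: (Rsummable_measurable If).
have mc := @measurable_row_cons R n.
rewrite /= /push_row integral_pushforward//.
rewrite preimage_setT -(integral12_prod_meas1 Ic).
apply: eq_integral => x _; rewrite /fubini_F fineK//.
by apply: integrable_fin_num => //; exact: Ifx.
Qed.

Definition gaussd (a : R) n (x : 'rV[R]_n) := expR (- (pi * a ^+ 2) * sqn x).

Lemma gaussdE (a : R) n (x : 'rV[R]_n) : gaussd a x = \prod_i gauss a (x 0 i).
Proof. by rewrite /gaussd /sqn mulr_sumr expR_sum. Qed.

Lemma gaussd_row_cons (a : R) n (x : R) (v : 'rV[R]_n) :
  gaussd a (row_cons (x, v)) = gauss a x * gaussd a v.
Proof. by rewrite /gaussd sqn_row_cons mulrDr expRD. Qed.

Lemma gaussd_ge0 (a : R) n (x : 'rV[R]_n) : 0 <= gaussd a x.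
Proof. exact: expR_ge0. Qed.

Lemma gaussd_le1 (a : R) n (x : 'rV[R]_n) : gaussd a x <= 1.
Proof.
rewrite /gaussd -[leRHS]expR0 ler_expR mulNr oppr_le0.
by rewrite mulr_ge0 ?sqn_ge0// mulr_ge0 ?pi_ge0 ?sqr_ge0.
Qed.

Lemma gaussdN (a : R) n (x : 'rV[R]_n) : gaussd a (- x) = gaussd a x.
Proof. by rewrite /gaussd sqnN. Qed.

Lemma measurable_gaussd (a : R) n : measurable_fun [set: 'rV[R]_n] (@gaussd a n).
Proof.
apply: measurableT_comp => //; apply: measurable_funM => //.
exact: measurable_sqn.
Qed.

Lemma measurable_gaussd_center (a : R) n (y : 'rV[R]_n) :
  measurable_fun [set: 'rV[R]_n] (fun x => gaussd a (x - y)).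
Proof.
apply: measurableT_comp; first exact: measurable_gaussd.
exact: measurable_fun_subrow.
Qed.

Lemma integral_gaussd_center (a : R) n (y : 'rV[R]_n) : 0 < a ->
  (\int[leb n]_x (gaussd a (x - y))%:E = (a ^- n)%:E)%E.
Proof.
move=> a0.
under eq_integral => x _.
  rewrite gaussdE.
  under eq_bigr do rewrite mxE [X in _ + X]mxE.
  over.
rewrite (@leb_prod _ _ (fun i x => gauss a (x - y 0 i)) (fun=> a^-1)).
- by rewrite prodr_const card_ord exprVn.
- by move=> i x; exact: gauss_ge0.
- move=> i; apply: measurableT_comp; first exact: measurable_gauss.
  exact: measurable_funB.
- by move=> i; exact: integral_gauss_center.
Qed.

Lemma Rsummable_gaussd_center (a : R) n (y : 'rV[R]_n) : 0 < a ->
  Rsummable (leb n) (fun x => gaussd a (x - y)).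
Proof.
move=> a0; apply/ge0_RsummableP.
- exact: measurable_gaussd_center.
- by move=> x; exact: gaussd_ge0.
- by rewrite integral_gaussd_center// ltry.
Qed.

Lemma Rintegral_gaussd_center (a : R) n (y : 'rV[R]_n) : 0 < a ->
  \int[leb n]_x gaussd a (x - y) = a ^- n.
Proof. by move=> a0; rewrite /Rintegral integral_gaussd_center. Qed.

Lemma Rsummable_gaussd (a : R) n : 0 < a -> Rsummable (leb n) (@gaussd a n).
Proof.
move=> /(@Rsummable_gaussd_center _ n 0).
by under [X in Rsummable _ X]eq_fun do rewrite subr0.
Qed.

Lemma Rsummable_gaussd_cos (a t : R) n (z : 'rV[R]_n) : 0 < a ->
  Rsummable (leb n) (fun x => gaussd a x * cos (2 * pi * dotp z x + t)).
Proof.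
move=> a0; apply: (@Rsummable_Mbounded _ _ _ (leb n) (@gaussd a n) _ 1).
- exact: Rsummable_gaussd.
- apply: (measurableT_comp measurable_cos); apply: measurable_funD => //.
  by apply: measurable_funM => //; exact: measurable_fun_dotp.
- by move=> x; exact: cos_max.
Qed.

(** For a fixed first coordinate, its share of the dot product is a phase for the remaining ones;
    hence the induction over an arbitrary [t]. *)
Lemma Rintegral_gaussd_cos (a t : R) n (z : 'rV[R]_n) : 0 < a ->
  \int[leb n]_x (gaussd a x * cos (2 * pi * dotp z x + t)) =
  cos t * a ^- n * gaussd a^-1 z.
Proof.
move=> a0; elim: n z t => [|n ih] z t.
  have -> : dotp z = cst 0 by apply/funext => x; rewrite /dotp big_ord0.
  have -> : @gaussd a 0 = cst 1.
    by apply/funext => x; rewrite /gaussd /sqn big_ord0 mulr0 expR0.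
  rewrite /Rintegral integral_dirac//.
    rewrite /dirac indicE mem_set// mul1e /gaussd /sqn big_ord0.
    by rewrite /= !mulr0 expR0 add0r mul1r expr0 invr1 !mulr1.
  exact: (@measurable_cst _ _ _ _ _ (1 * cos (2 * pi * 0 + t))%:E).
have E x v : gaussd a (row_cons (x, v)) * cos (2 * pi * dotp z (row_cons (x, v)) + t) =
  gauss a x * (gaussd a v * cos (2 * pi * dotp (row_uncons z).2 v +
     (2 * pi * (z 0 ord0 * x) + t))).
  rewrite gaussd_row_cons dotp_row_cons mulrA; congr (_ * cos _).
  by rewrite [_ + dotp _ _]addrC mulrDr addrA.
rewrite Rintegral_lebS; last 2 first.
- exact: Rsummable_gaussd_cos.
- move=> x; under [X in Rsummable _ X]eq_fun do rewrite E.
  by apply: RsummableZ; exact: Rsummable_gaussd_cos.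
transitivity (\int[lam]_x ((a ^- n * gaussd a^-1 (row_uncons z).2) *
    (gauss a x * cos (2 * pi * (z 0 ord0 * x) + t)))).
  apply: eq_Rintegral => x _.
  under eq_Rintegral do rewrite E.
  rewrite RsumZ; last exact: Rsummable_gaussd_cos.
  by rewrite ih; ring.
rewrite RsumZ; last first.
  apply: (@Rsummable_Mbounded _ _ _ lam _ _ 1 (Rsummable_gauss a0)).
    apply: (measurableT_comp measurable_cos); apply: measurable_funD => //.
    by apply: measurable_funM => //; apply: measurable_funM.
  by move=> x; exact: cos_max.
rewrite Rintegral_gauss_cos// [in RHS]/gaussd sqn_uncons mulrDr expRD.
rewrite -/(gauss _ _) -/(gaussd _ _) exprS invfM.
by ring.
Qed.

End gaussian_rV.

(** * Integrability of (1 + |x|^2)^-s for s > n/2 *)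

Section integrable_weight.
Context {R : realType}.
Local Notation lam := (@lebesgue_measure R).

Lemma is_derive_powR1D (a x : R) : 0 < 1 + x ->
  is_derive x 1 (fun y : R => (1 + y) `^ a) (a * (1 + x) `^ (a - 1)).
Proof.
move=> x0.
have d1 : is_derive x 1 (fun y : R => 1 + y) 1.
  rewrite (_ : (fun y => _) = cst 1 + id); last by apply/funext.
  apply: (@is_derive_eq _ _ _ _ _ _ _ _ (is_deriveD (is_derive_cst (1 : R) x 1) (is_derive_id x 1))).
  by rewrite add0r.
apply: (@is_derive_eq _ _ _ ((fun z => powR z a) \o (fun y : R => 1 + y)) _ _ _ _
  (is_derive1_comp (is_derive1_powR a x0) d1)).
by rewrite mulr1.
Qed.

Lemma integral_powR1D_lty (p : R) : 0 < p ->
  (\int[lam]_(x in `[0%R, +oo[) ((1 + x) `^ (- p - 1))%:E < +oo)%E.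
Proof.
move=> p0.
have pos x : 0 <= x -> 0 < 1 + x :> R by move=> x0; rewrite ltr_wpDr.
have dF (x : R) : 0 < 1 + x -> is_derive x 1 (fun y : R => - p^-1 * (1 + y) `^ (- p)) ((1 + x) `^ (- p - 1)).
  move=> x0.
  apply: (@is_derive_eq _ _ _ ((- p^-1) \*: (fun y : R => (1 + y) `^ (- p))) _ _ _ _ (is_deriveZ _ (is_derive_powR1D (- p) x0))).
  by rewrite /GRing.scale/= mulrA mulNr mulrN opprK mulVf ?mul1r// gt_eqF.
have cF (x : R) : 0 < 1 + x -> {for x, continuous (fun y : R => - p^-1 * (1 + y) `^ (- p))}.
  move=> x0; apply: differentiable_continuous; apply/derivable1_diffP.
  by have [] := dF x x0.
have cvF : - p^-1 * (1 + x) `^ (- p) @[x --> +oo] --> (- p^-1 * 0 : R).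
  apply: cvgMl_tmp; apply/cvgrPdist_le => /= e e0.
  near=> x.
  have x0 : 0 <= x by near: x; exact: nbhs_pinfty_ge.
  have xe : (e^-1) `^ (p^-1) <= x by near: x; apply: nbhs_pinfty_ge; exact: num_real.
  rewrite sub0r normrN ger0_norm ?powR_ge0// powRN.
  rewrite invf_ple ?posrE ?powR_gt0 ?pos//.
  have -> : e^-1 = ((e^-1) `^ (p^-1)) `^ p.
    by rewrite -powRrM mulVf ?gt_eqF// powRr1// invr_ge0 ltW.
  apply: ge0_ler_powR; rewrite ?nnegrE ?powR_ge0//; first exact: ltW.
    by rewrite ltW// pos.
  by rewrite (le_trans xe)// lerDr.
rewrite (@ge0_continuous_FTC2y _ _ (fun y : R => - p^-1 * (1 + y) `^ (- p)) 0 (- p^-1 * 0)).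
- by rewrite -EFinB ltry.
- by move=> x _; exact: powR_ge0.
- apply: continuous_in_subspaceT => x; rewrite inE/= in_itv/= andbT => x0.
  apply: differentiable_continuous; apply/derivable1_diffP.
  by have [] := is_derive_powR1D (- p - 1) (pos _ x0).
- exact: cvF.
- by move=> x x0; have [] := dF x (pos _ (ltW x0)).
- by apply: cvg_at_right_filter; apply: cF; rewrite addr0.
- move=> x; rewrite in_itv/= andbT => x0; rewrite derive1E.
  by have [_ ->] := dF x (pos _ (ltW x0)).
Unshelve. all: by end_near. Qed.

Lemma continuous_powR1Dsqr (r : R) : continuous (fun x : R => (1 + x ^+ 2) `^ r).
Proof.
move=> x; apply: differentiable_continuous; apply/derivable1_diffP.
have x0 : 0 < 1 + x ^+ 2 by rewrite ltr_wpDr ?sqr_ge0.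
have d1 : is_derive x 1 (fun y : R => 1 + y ^+ 2) (2 * x).
  rewrite (_ : (fun y => _) = cst 1 + id ^+ 2); last by apply/funext.
  apply: (@is_derive_eq _ _ _ _ _ _ _ _ (is_deriveD (is_derive_cst (1 : R) x 1) (is_deriveX 2 (is_derive_id x 1)))).
  by rewrite add0r /GRing.scale /= expr1 mulr1.
by have [] := @is_derive1_comp _ (fun z => powR z r) (fun y : R => 1 + y ^+ 2) _ _ _ (is_derive1_powR r x0) d1.
Qed.

(** By symmetry only the half-line matters, and there (1 + x)^2 <= 2 (1 + x^2) reduces the integrand
    to a power of 1 + x with an explicit primitive. *)
Lemma integral_powR1Dsqr_lty (r : R) : 2^-1 < r ->
  (\int[lam]_x ((1 + x ^+ 2) `^ (- r))%:E < +oo)%E.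
Proof.
move=> r12.
rewrite (@ge0_symfun_integralT _ (fun x => (1 + x ^+ 2) `^ (- r))); last 3 first.
- by move=> x; exact: powR_ge0.
- exact: continuous_powR1Dsqr.
- by move=> x /=; rewrite sqrrN.
rewrite -set_itvcy.
have r0 : 0 < r by apply: lt_trans r12; rewrite invr_gt0.
have p0 : 0 < 2 * r - 1 by lra.
have mf : measurable_fun setT (fun x : R => (1 + x) `^ (- (2 * r - 1) - 1)).
  have m1 : measurable_fun setT (fun x : R => 1 + x) by exact: measurable_funD.
  exact: (measurableT_comp (@measurable_powR R (- (2 * r - 1) - 1)) m1).
have le1 : (\int[lam]_(x in `[0%R, +oo[) ((1 + x ^+ 2) `^ (- r))%:E <=
   (2 `^ r)%:E * \int[lam]_(x in `[0%R, +oo[) ((1 + x) `^ (- (2 * r - 1) - 1))%:E)%E.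
  rewrite -ge0_integralZl_EFin//; last 2 first.
  - by move=> x _; rewrite lee_fin powR_ge0.
  - by apply/measurable_EFinP; exact: measurable_funTS.
  apply: ge0_le_integral => //.
  - by move=> x _; rewrite lee_fin powR_ge0.
  - apply/measurable_EFinP; apply: measurable_funTS.
    by apply: continuous_measurable_fun; exact: continuous_powR1Dsqr.
  - apply/measurable_EFinP; apply: measurable_funTS.
    exact: measurable_funM.
  move=> x; rewrite /= in_itv/= andbT => x0; rewrite -EFinM lee_fin.
  have -> : - (2 * r - 1) - 1 = 2 * (- r) by ring.
  have xp : 0 < 1 + x by rewrite ltr_wpDr.
  have x2 : 0 < 1 + x ^+ 2 by rewrite ltr_wpDr ?sqr_ge0.
  rewrite powRrM powR_mulrn ?(ltW xp)// !powRN.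
  rewrite ler_pdivlMr ?powR_gt0 ?exprn_gt0// mulrC ler_pdivrMr ?powR_gt0//.
  rewrite -powRM ?(ltW x2)//.
  apply: ge0_ler_powR; rewrite ?nnegrE; [exact: ltW|exact: sqr_ge0|by rewrite mulr_ge0// ltW|].
  by have := sqr_ge0 (1 - x); rewrite !expr2; lra.
apply: lte_mul_pinfty => //; apply: (le_lt_trans le1).
apply: lte_mul_pinfty; [by rewrite lee_fin powR_ge0|by []|exact: integral_powR1D_lty].
Qed.

(** Since 1 + x_i^2 <= 1 + |x|^2 for each i, the weight is at most the product of the (1 + x_i^2)^-r
    as soon as r n <= s, and r > 1/2 makes every factor integrable. *)
Lemma Rsummable_weight (n : nat) (s : R) : n%:R / 2 < s ->
  Rsummable (leb n) (fun x : 'rV[R]_n => (1 + sqn x) `^ (- s)).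
Proof.
move=> ns.
have s0 : 0 < s by apply: le_lt_trans ns; rewrite divr_ge0.
(* The exponent is s / n; in dimension 0 any r > 1/2 will do, and 1 is taken. *)
have [r r12 rns] : exists2 r, 2^-1 < r & r * n%:R <= s.
  case: n ns => [|n] ns; first by exists 1; rewrite ?mulr0 ?ltW// invf_lt1// ltr1n.
  exists (s / n.+1%:R); last by rewrite divfK.
  by rewrite ltr_pdivlMr// mulrC.
have mh : measurable_fun setT (fun x : R => (1 + x ^+ 2) `^ (- r)).
  by apply: continuous_measurable_fun; exact: continuous_powR1Dsqr.
have hlt := integral_powR1Dsqr_lty r12.
have Ih : Rsummable lam (fun x : R => (1 + x ^+ 2) `^ (- r)).
  by apply/ge0_RsummableP => // x; exact: powR_ge0.
have mw : measurable_fun setT (fun x : 'rV[R]_n => (1 + sqn x) `^ (- s)).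
  have m1 : measurable_fun setT (fun x : 'rV[R]_n => 1 + sqn x).
    by apply: measurable_funD => //; exact: measurable_sqn.
  exact: (measurableT_comp (@measurable_powR R (- s)) m1).
apply/ge0_RsummableP => //; first by move=> x; exact: powR_ge0.
apply: (@le_lt_trans _ _ (\int[leb n]_x (\prod_(i < n) (1 + x 0 i ^+ 2) `^ (- r))%:E)%E).
  apply: ge0_le_integral => //.
  - by move=> x _; rewrite lee_fin powR_ge0.
  - exact/measurable_EFinP.
  - apply/measurable_EFinP; apply: measurable_prod => i _.
    exact: measurableT_comp mh (measurable_coord i).
  move=> x _; rewrite lee_fin.
  have x1 : 1 <= 1 + sqn x by rewrite lerDl sqn_ge0.
  have x0 : 0 <= 1 + sqn x by exact: le_trans x1.
  apply: (@le_trans _ _ ((1 + sqn x) `^ (- (r * n%:R)))).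
    by apply: ler_powR => //; rewrite lerN2.
  rewrite -mulNr powRrM powR_mulrn ?powR_ge0//.
  have -> : (1 + sqn x) `^ (- r) ^+ n = \prod_(i < n) (1 + sqn x) `^ (- r).
    by rewrite prodr_const card_ord.
  apply: ler_prod => i _; rewrite powR_ge0 /=.
  rewrite !powRN lef_pV2 ?posrE ?powR_gt0//; last 2 first.
  - exact: lt_le_trans x1.
  - by rewrite ltr_wpDr ?sqr_ge0.
  apply: ge0_ler_powR; rewrite ?nnegrE//.
  - by rewrite ltW// (lt_trans _ r12)// invr_gt0.
  - by rewrite addr_ge0 ?sqr_ge0.
  rewrite lerD2l /sqn (bigD1 i)//= lerDl.
  by apply: sumr_ge0 => j _; exact: sqr_ge0.
rewrite (@leb_prod _ _ (fun=> (fun x => (1 + x ^+ 2) `^ (- r)))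
  (fun=> \int[lam]_x ((1 + x ^+ 2) `^ (- r)))) ?ltry//.
- by move=> i x; exact: powR_ge0.
- by move=> i; rewrite RintegralE.
Qed.

End integrable_weight.

(** * Bessel inequality and Fourier inversion *)

Section fatou_le.
Context d (T : measurableType d) (R : realType) (mu : {measure set T -> \bar R}).
Local Open Scope ereal_scope.

Lemma fatou_le (f_ : nat -> T -> \bar R) (f : T -> \bar R) (c : \bar R) :
  (forall m, measurable_fun setT (f_ m)) -> measurable_fun setT f ->
  (forall m x, 0 <= f_ m x) ->
  {ae mu, forall x, f_ m x @[m --> \oo] --> f x} ->
  (forall m, \int[mu]_x f_ m x <= c) -> \int[mu]_x f x <= c.
Proof.
move=> mf_ mf f_0 ff fc.
have mi : measurable_fun setT (fun x => limn_einf (f_ ^~ x)).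
  under eq_fun do rewrite limn_einf_lim.
  apply: (emeasurable_fun_cvg (fun m x => einfs (f_ ^~ x) m)).
    by move=> m; exact: measurable_fun_einfs.
  by move=> x _; exact: is_cvg_einfs.
rewrite (ae_eq_integral (fun x => limn_einf (f_ ^~ x)))//; last first.
  apply: filterS ff => x ffx _.
  by rewrite is_cvg_limn_einfE; [apply/esym/cvg_lim|apply/cvg_ex; exists (f x)].
apply: (le_trans (fatou _ _ _ _)) => //.
rewrite limn_einf_lim; apply: lime_le; first exact: is_cvg_einfs.
apply: nearW => m; apply: (le_trans _ (fc m)).
by apply: ereal_inf_lbound; exists m => /=.
Qed.

End fatou_le.

#[local] Opaque expR cos sin pi Rintegral.

Section fourier_summable.
Context {R : realType} {n : nat}.
Local Notation mu := (@leb R n).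
Implicit Types (v : 'rV[R]_n -> R) (x y xi : 'rV[R]_n).

(** The Fourier transform of a summable real v is [FTc v] - i [FTs v]. *)
Definition FTc v xi := \int[mu]_x (v x * cos (2 * pi * dotp x xi)).
Definition FTs v xi := \int[mu]_x (v x * sin (2 * pi * dotp x xi)).

Lemma measurable_phase d (T : measurableType d) (f g : T -> 'rV[R]_n) :
  measurable_fun setT f -> measurable_fun setT g ->
  measurable_fun setT (fun t => 2 * pi * dotp (f t) (g t)).
Proof. by move=> mf mg; apply: measurable_funM => //; exact: measurable_fun_dotp. Qed.

Lemma measurable_cos_phase d (T : measurableType d) (f g : T -> 'rV[R]_n) :
  measurable_fun setT f -> measurable_fun setT g ->
  measurable_fun setT (fun t => cos (2 * pi * dotp (f t) (g t))).
Proof. by move=> mf mg; apply: (measurableT_comp measurable_cos); exact: measurable_phase. Qed.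

Lemma measurable_sin_phase d (T : measurableType d) (f g : T -> 'rV[R]_n) :
  measurable_fun setT f -> measurable_fun setT g ->
  measurable_fun setT (fun t => sin (2 * pi * dotp (f t) (g t))).
Proof. by move=> mf mg; apply: (measurableT_comp measurable_sin); exact: measurable_phase. Qed.

Lemma Rsummable_cos v xi : Rsummable mu v ->
  Rsummable mu (fun x => v x * cos (2 * pi * dotp x xi)).
Proof.
move=> Iv; apply: (@Rsummable_Mbounded _ _ _ mu _ _ 1 Iv).
  exact: measurable_cos_phase.
by move=> x; exact: cos_max.
Qed.

Lemma Rsummable_sin v xi : Rsummable mu v ->
  Rsummable mu (fun x => v x * sin (2 * pi * dotp x xi)).
Proof.
move=> Iv; apply: (@Rsummable_Mbounded _ _ _ mu _ _ 1 Iv).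
  exact: measurable_sin_phase.
by move=> x; exact: sin_max.
Qed.

Lemma norm_FTc_le v xi : Rsummable mu v -> `|FTc v xi| <= \int[mu]_x `|v x|.
Proof.
move=> Iv; apply: ler_norm_Rintegral.
- exact: Rsummable_measurable (Rsummable_cos xi Iv).
- exact: Rsummable_norm.
- by move=> x; rewrite normrM ler_piMr// cos_max.
Qed.

Lemma norm_FTs_le v xi : Rsummable mu v -> `|FTs v xi| <= \int[mu]_x `|v x|.
Proof.
move=> Iv; apply: ler_norm_Rintegral.
- exact: Rsummable_measurable (Rsummable_sin xi Iv).
- exact: Rsummable_norm.
- by move=> x; rewrite normrM ler_piMr// sin_max.
Qed.

Lemma measurable_FTc v : Rsummable mu v -> measurable_fun setT (FTc v).
Proof.
move=> Iv; apply: (@measurable_kernel_integral _ _ _ _ _ mu v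
  (fun p : 'rV[R]_n * 'rV[R]_n => cos (2 * pi * dotp p.2 p.1)) 1) => //.
- exact: measurable_cos_phase.
- by move=> p; exact: cos_max.
Qed.

Lemma measurable_FTs v : Rsummable mu v -> measurable_fun setT (FTs v).
Proof.
move=> Iv; apply: (@measurable_kernel_integral _ _ _ _ _ mu v
  (fun p : 'rV[R]_n * 'rV[R]_n => sin (2 * pi * dotp p.2 p.1)) 1) => //.
- exact: measurable_sin_phase.
- by move=> p; exact: sin_max.
Qed.

(** The Gaussian weight makes the double integral absolutely convergent. After the exchange, the
    inner integral is the transform of a Gaussian, so the damped inversion integral is a convolution
    of v with an approximate identity. *)
Lemma gauss_regularization (a : R) v y : 0 < a -> Rsummable mu v ->
  \int[mu]_xi (gaussd a xi * (FTc v xi * cos (2 * pi * dotp y xi)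
                            + FTs v xi * sin (2 * pi * dotp y xi))) =
  \int[mu]_x (v x * (a ^- n * gaussd a^-1 (x - y))).
Proof.
move=> a0 Iv.
pose k (p : 'rV[R]_n * 'rV[R]_n) := cos (2 * pi * dotp (p.2 - y) p.1).
have mk : measurable_fun setT k.
  by apply: measurable_cos_phase => //; exact: measurable_fun_subrow.
have := @kernel_fubini _ _ _ _ _ mu mu (@gaussd R a n) v k 1
  (Rsummable_gaussd n a0) Iv mk (fun p => cos_max _).
rewrite /k /= => E.
transitivity (\int[mu]_x (gaussd a x * \int[mu]_z (v z * cos (2 * pi * dotp (z - y) x)))).
  apply: eq_Rintegral => xi _; congr (_ * _).
  rewrite /FTc /FTs ![_ * cos (2 * pi * dotp y xi)]mulrC ![_ * sin (2 * pi * dotp y xi)]mulrC.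
  rewrite -(RsumZ _ (Rsummable_cos xi Iv)) -(RsumZ _ (Rsummable_sin xi Iv)).
  rewrite -RsumD.
  - by apply: eq_Rintegral => x _; rewrite dotpBl mulrBr cosB; ring.
  - exact/RsummableZ/Rsummable_cos.
  - exact/RsummableZ/Rsummable_sin.
rewrite E; apply: eq_Rintegral => x _; congr (_ * _).
have := @Rintegral_gaussd_cos R a 0 n (x - y) a0.
by under eq_Rintegral do rewrite addr0; rewrite cos0 mul1r.
Qed.

Lemma measurable_FTcs_sqr v : Rsummable mu v ->
  measurable_fun setT (fun xi => FTc v xi ^+ 2 + FTs v xi ^+ 2).
Proof.
move=> Iv; apply: measurable_funD; apply: measurable_funX.
- exact: measurable_FTc.
- exact: measurable_FTs.
Qed.

Lemma measurable_gauss_convolution (a : R) :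
  measurable_fun setT (fun p : 'rV[R]_n * 'rV[R]_n => a ^- n * gaussd a^-1 (p.2 - p.1)).
Proof.
apply: measurable_funM => //; apply: (measurableT_comp (@measurable_gaussd R a^-1 n)).
exact: measurable_fun_subrow.
Qed.

(** Bounds v(x) v(y) by half of v(x)^2 + v(y)^2. The kernel is symmetric of mass one, so by Tonelli
    each half contributes half of the squared norm of v. *)
Lemma gauss_convolution_le (a : R) v : 0 < a -> Rsummable mu v ->
  Rsummable mu (fun x => v x ^+ 2) ->
  \int[mu]_y (v y * \int[mu]_x (v x * (a ^- n * gaussd a^-1 (x - y)))) <=
  \int[mu]_x v x ^+ 2.
Proof.
move=> a0 Iv Iv2.
pose K (p : 'rV[R]_n * 'rV[R]_n) := a ^- n * gaussd a^-1 (p.2 - p.1).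
have K0 p : 0 <= K p by rewrite mulr_ge0 ?gaussd_ge0// invr_ge0 exprn_ge0// ltW.
have KM p : `|K p| <= a ^- n.
  by rewrite ger0_norm// ler_piMr ?gaussd_le1// invr_ge0 exprn_ge0// ltW.
have mK := measurable_gauss_convolution a.
have IK y : Rsummable mu (fun x => K (y, x)).
  by apply: RsummableZ; apply: Rsummable_gaussd_center; rewrite invr_gt0.
have K1 y : \int[mu]_x K (y, x) = 1.
  rewrite RsumZ; last by apply: Rsummable_gaussd_center; rewrite invr_gt0.
  rewrite Rintegral_gaussd_center ?invr_gt0// exprVn invrK mulVf//.
  by rewrite expf_neq0// gt_eqF.
have KC y x : K (y, x) = K (x, y) by rewrite /K /= -opprB gaussdN.
have mv := Rsummable_measurable Iv.
have mK1 y : measurable_fun setT (fun x => K (y, x)) := Rsummable_measurable (IK y).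
have Iv2K y : Rsummable mu (fun x => v x ^+ 2 * K (y, x)).
  by apply: (@Rsummable_Mbounded _ _ _ mu _ _ (a ^- n) Iv2).
have IvK y : Rsummable mu (fun x => v x * K (y, x)).
  by apply: (@Rsummable_Mbounded _ _ _ mu _ _ (a ^- n) Iv).
pose g y := \int[mu]_x (v x ^+ 2 * K (y, x)).
have g0 y : 0 <= g y by apply: Rintegral_ge0 => x _; rewrite mulr_ge0 ?sqr_ge0.
have mg : measurable_fun setT g.
  exact: (@measurable_kernel_integral _ _ _ _ _ mu (fun x => v x ^+ 2) K (a ^- n)).
have gE : (\int[mu]_y (g y)%:E = (\int[mu]_x v x ^+ 2)%R%:E)%E.
  transitivity (\int[mu]_y \int[mu]_x (v x ^+ 2 * K (y, x))%:E)%E.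
    by apply: eq_integral => y _; rewrite -RintegralE.
  rewrite (fubini_tonelli (fun p => (v p.2 ^+ 2 * K p)%:E)); last 2 first.
  - apply/measurable_EFinP; apply: measurable_funM => //.
    by apply: measurable_funX; exact: measurableT_comp mv _.
  - by move=> p; rewrite lee_fin mulr_ge0 ?sqr_ge0.
  rewrite RintegralE//; apply: eq_integral => x _ /=.
  under eq_integral do rewrite KC.
  rewrite -RintegralE; last exact: (RsummableZ _ (IK x)).
  by rewrite (RsumZ _ (IK x)) K1 mulr1.
have Ig : Rsummable mu g by apply/ge0_RsummableP => //; rewrite gE ltry.
have gE' : \int[mu]_y g y = \int[mu]_x v x ^+ 2 by exact: EFin_RintegralE.
apply: (@le_trans _ _ (\int[mu]_y (2^-1 * (v y ^+ 2) + 2^-1 * g y))).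
  apply: ler_Rintegral.
  - exact: (@kernel_fubini_summable1 _ _ _ _ _ mu mu v v K (a ^- n)).
  - by apply: RsummableD; exact: RsummableZ.
  move=> y.
  rewrite -RsumZ; last exact: IvK.
  have -> : 2^-1 * v y ^+ 2 + 2^-1 * g y =
      \int[mu]_x (2^-1 * v y ^+ 2 * K (y, x) + 2^-1 * (v x ^+ 2 * K (y, x))).
    rewrite RsumD; [|exact: (RsummableZ _ (IK y))|exact: (RsummableZ _ (Iv2K y))].
    by rewrite (RsumZ _ (IK y)) (RsumZ _ (Iv2K y)) K1 mulr1.
  apply: ler_Rintegral.
  - exact/RsummableZ/IvK.
  - by apply: RsummableD; apply: RsummableZ.
  move=> x; rewrite -/(K (y, x)); have := K0 (y, x); move: (K _) => c c0.
  have : 0 <= (v x - v y) ^+ 2 * c by rewrite mulr_ge0 ?sqr_ge0.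
  by rewrite sqrrB; nra.
rewrite RsumD ?RsumZ//; try exact: RsummableZ.
by rewrite gE' -mulrDl -[2^-1]mul1r -mulrDl divff// mul1r.
Qed.

(** Integrating [gauss_regularization] against v(y) turns its left-hand side into the damped squared
    norm of the transform and its right-hand side into the double integral of
    [gauss_convolution_le]. *)
Lemma bessel_regularized (a : R) v : 0 < a -> Rsummable mu v ->
  Rsummable mu (fun x => v x ^+ 2) ->
  Rsummable mu (fun xi => gaussd a xi * (FTc v xi ^+ 2 + FTs v xi ^+ 2)) /\
  \int[mu]_xi (gaussd a xi * (FTc v xi ^+ 2 + FTs v xi ^+ 2)) <= \int[mu]_x v x ^+ 2.
Proof.
move=> a0 Iv Iv2.
pose M := \int[mu]_x `|v x|.
have IA : Rsummable mu (fun xi => gaussd a xi * FTc v xi).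
  apply: (@Rsummable_Mbounded _ _ _ mu _ _ M (Rsummable_gaussd n a0)).
    exact: measurable_FTc.
  by move=> x; exact: norm_FTc_le.
have IB : Rsummable mu (fun xi => gaussd a xi * FTs v xi).
  apply: (@Rsummable_Mbounded _ _ _ mu _ _ M (Rsummable_gaussd n a0)).
    exact: measurable_FTs.
  by move=> x; exact: norm_FTs_le.
have IAA : Rsummable mu (fun xi => gaussd a xi * FTc v xi * FTc v xi).
  apply: (@Rsummable_Mbounded _ _ _ mu _ _ M IA); first exact: measurable_FTc.
  by move=> x; exact: norm_FTc_le.
have IBB : Rsummable mu (fun xi => gaussd a xi * FTs v xi * FTs v xi).
  apply: (@Rsummable_Mbounded _ _ _ mu _ _ M IB); first exact: measurable_FTs.
  by move=> x; exact: norm_FTs_le.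
have E : (fun xi => gaussd a xi * (FTc v xi ^+ 2 + FTs v xi ^+ 2)) =
   (fun xi => gaussd a xi * FTc v xi * FTc v xi + gaussd a xi * FTs v xi * FTs v xi).
  by apply/funext => xi; ring.
split; first by rewrite E; exact: RsummableD.
rewrite E (RsumD IAA IBB).
apply: le_trans (gauss_convolution_le a0 Iv Iv2).
pose kc (p : 'rV[R]_n * 'rV[R]_n) := cos (2 * pi * dotp p.2 p.1).
pose ks (p : 'rV[R]_n * 'rV[R]_n) := sin (2 * pi * dotp p.2 p.1).
have mkc : measurable_fun setT kc by exact: measurable_cos_phase.
have mks : measurable_fun setT ks by exact: measurable_sin_phase.
have Fc := @kernel_fubini _ _ _ _ _ mu mu _ v kc 1 IA Iv mkc (fun p => cos_max _).
have Fs := @kernel_fubini _ _ _ _ _ mu mu _ v ks 1 IB Iv mks (fun p => sin_max _).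
have IAk y : Rsummable mu (fun xi => gaussd a xi * FTc v xi * cos (2 * pi * dotp y xi)).
  apply: (@Rsummable_Mbounded _ _ _ mu _ _ 1 IA); last by move=> ?; exact: cos_max.
  exact: measurable_cos_phase.
have IBk y : Rsummable mu (fun xi => gaussd a xi * FTs v xi * sin (2 * pi * dotp y xi)).
  apply: (@Rsummable_Mbounded _ _ _ mu _ _ 1 IB); last by move=> ?; exact: sin_max.
  exact: measurable_sin_phase.
have S1 : Rsummable mu (fun y => v y * \int[mu]_xi (gaussd a xi * FTc v xi * cos (2 * pi * dotp y xi))).
  apply: (@kernel_fubini_summable1 _ _ _ _ _ mu mu v _ (fun p => cos (2 * pi * dotp p.1 p.2)) 1 Iv IA).
    exact: measurable_cos_phase.
  by move=> p; exact: cos_max.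
have S2 : Rsummable mu (fun y => v y * \int[mu]_xi (gaussd a xi * FTs v xi * sin (2 * pi * dotp y xi))).
  apply: (@kernel_fubini_summable1 _ _ _ _ _ mu mu v _ (fun p => sin (2 * pi * dotp p.1 p.2)) 1 Iv IB).
    exact: measurable_sin_phase.
  by move=> p; exact: sin_max.
rewrite [X in X + _](_ : _ = \int[mu]_y (v y * \int[mu]_xi (gaussd a xi * FTc v xi * cos (2 * pi * dotp y xi)))); last first.
  exact: Fc.
rewrite [X in _ + X](_ : _ = \int[mu]_y (v y * \int[mu]_xi (gaussd a xi * FTs v xi * sin (2 * pi * dotp y xi)))); last first.
  exact: Fs.
rewrite -(RsumD S1 S2) le_eqVlt; apply/orP; left; apply/eqP.
apply: eq_Rintegral => y _; rewrite -mulrDr; congr (_ * _).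
rewrite -(gauss_regularization y a0 Iv) -(RsumD (IAk y) (IBk y)).
by apply: eq_Rintegral => xi _; ring.
Qed.

Lemma gaussd_cvg1 xi : gaussd (m.+1%:R^-1) xi @[m --> \oo] --> (1 : R).
Proof.
suff : gaussd (m.+1%:R^-1) xi @[m --> \oo] --> expR (- (pi * (0 * 0)) * sqn xi).
  by rewrite !mulr0 oppr0 mul0r expR0.
apply: (cvg_comp _ expR); last exact: continuous_expR.
apply: cvgMr_tmp; apply: cvgN; apply: cvgMl_tmp.
have h : m.+1%:R^-1 @[m --> \oo] --> (0 : R) by exact: cvg_harmonic.
exact: (cvgM h h).
Qed.

(** The Gaussian weight tends to 1 pointwise as its parameter 1/(m + 1) tends to 0; Fatou then gives
    summability and bound together. *)
Lemma bessel v : Rsummable mu v -> Rsummable mu (fun x => v x ^+ 2) ->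
  Rsummable mu (fun xi => FTc v xi ^+ 2 + FTs v xi ^+ 2) /\
  \int[mu]_xi (FTc v xi ^+ 2 + FTs v xi ^+ 2) <= \int[mu]_x v x ^+ 2.
Proof.
move=> Iv Iv2.
pose f xi := FTc v xi ^+ 2 + FTs v xi ^+ 2.
have f0 xi : 0 <= f xi by rewrite addr_ge0 ?sqr_ge0.
have mf : measurable_fun setT f := measurable_FTcs_sqr Iv.
pose w (m : nat) (xi : 'rV[R]_n) := gaussd (m.+1%:R^-1) xi.
have m0 (m : nat) : 0 < m.+1%:R^-1 :> R by rewrite invr_gt0.
have main : (\int[mu]_xi (f xi)%:E <= (\int[mu]_x v x ^+ 2)%R%:E)%E.
  apply: (@fatou_le _ _ _ mu (fun m xi => (w m xi * f xi)%:E)).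
  - move=> m; apply/measurable_EFinP; apply: measurable_funM => //.
    exact: measurable_gaussd.
  - exact/measurable_EFinP.
  - by move=> m xi; rewrite lee_fin mulr_ge0// gaussd_ge0.
  - apply: aeW => xi; apply: cvg_EFin; first exact: nearW.
    by rewrite -[X in _ --> X]mul1r; apply: cvgMr_tmp; exact: gaussd_cvg1.
  - move=> m; have [I le] := bessel_regularized (m0 m) Iv Iv2.
    by rewrite -RintegralE// lee_fin.
have If : Rsummable mu f.
  by apply/ge0_RsummableP => //; rewrite (le_lt_trans main)// ltry.
by split => //; rewrite -lee_fin RintegralE.
Qed.

End fourier_summable.

(** * Fourier inversion at a point of continuity *)

Section fourier_inversion.
Context {R : realType} {n : nat}.
Local Notation mu := (@leb R n).
Implicit Types (u : 'rV[R]_n -> R) (x y xi : 'rV[R]_n).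

Definition trunc u (N : nat) x := if sqn x <= N%:R ^+ 2 then u x else 0.

(** The real part of the integral of (gr + i gi) exp(2 i pi <x, xi>). *)
Definition invFT (gr gi : 'rV[R]_n -> R) x := FTc gr x - FTs gi x.

Lemma measurable_trunc u N : measurable_fun setT u -> measurable_fun setT (trunc u N).
Proof.
move=> mu_; apply: measurable_fun_ifT => //.
by apply: measurable_fun_ler => //; exact: measurable_sqn.
Qed.

Lemma norm_trunc_le u N x : `|trunc u N x| <= `|u x|.
Proof. by rewrite /trunc; case: ifP => // _; rewrite normr0. Qed.

Lemma trunc_sqr_le u N x : trunc u N x ^+ 2 <= u x ^+ 2.
Proof. by rewrite /trunc; case: ifP => // _; rewrite expr0n/= sqr_ge0. Qed.

(* On the ball of radius N the Gaussian is bounded below, so that the ball has finite measure. *)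
Lemma Rsummable_trunc u N : measurable_fun setT u ->
  Rsummable mu (fun x => u x ^+ 2) -> Rsummable mu (trunc u N).
Proof.
move=> mu_ Iu2.
apply: (@le_Rsummable _ _ _ mu _ (fun x => u x ^+ 2 + expR (pi * N%:R ^+ 2) * gaussd 1 x)).
- exact: measurable_trunc.
- move=> x; rewrite /trunc; case: ifPn => [xN|_]; last first.
    by rewrite normr0 addr_ge0 ?sqr_ge0// mulr_ge0 ?expR_ge0// gaussd_ge0.
  have : 1 <= expR (pi * N%:R ^+ 2) * gaussd 1 x.
    rewrite /gaussd -expRD -[leLHS]expR0 ler_expR expr1n mulr1 mulNr -mulrBr.
    by rewrite mulr_ge0 ?pi_ge0// subr_ge0.
  have : `|u x| ^+ 2 = u x ^+ 2 by rewrite -normrX ger0_norm ?sqr_ge0.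
  by move=> <- *; nra.
- by apply: RsummableD Iu2 _; apply: RsummableZ; exact: Rsummable_gaussd.
Qed.

Lemma Rsummable_trunc_sqr u N : measurable_fun setT u ->
  Rsummable mu (fun x => u x ^+ 2) -> Rsummable mu (fun x => trunc u N x ^+ 2).
Proof.
move=> mu_ Iu2; apply: (le_Rsummable _ _ Iu2).
  by apply: measurable_funX; exact: measurable_trunc.
by move=> x; rewrite ger0_norm ?sqr_ge0// trunc_sqr_le.
Qed.

Lemma trunc_cvg u x : trunc u N x @[N --> \oo] --> u x.
Proof.
have hN k : k%:R <= k%:R ^+ 2 :> R.
  by case: k => [|k]; rewrite ?expr0n// expr2 ler_peMl// ler1n.
apply: cvg_near_cst; near=> N; rewrite /trunc ifT//.
have : sqn x <= N%:R.
  near: N; exists (Num.trunc (sqn x)).+1 => //= N /= xN.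
  by rewrite ltW// (lt_le_trans (truncnS_gt _))// ler_nat.
by move=> /le_trans; apply; exact: hN.
Unshelve. all: by end_near. Qed.

Section gauss_kernel.
Variable a : R.
Hypothesis a0 : 0 < a.

(** The transform of the weight [gaussd a]: an approximate identity of mass one as [a] tends to
    0. *)
Definition gauss_kernel x := a ^- n * gaussd a^-1 x.

Lemma gauss_kernel_ge0 x : 0 <= gauss_kernel x.
Proof. by rewrite mulr_ge0 ?gaussd_ge0// invr_ge0 exprn_ge0// ltW. Qed.

Lemma gauss_kernel_le x : gauss_kernel x <= a ^- n.
Proof. by rewrite ler_piMr ?gaussd_le1// invr_ge0 exprn_ge0// ltW. Qed.

Lemma Rsummable_gauss_kernel y : Rsummable mu (fun x => gauss_kernel (x - y)).
Proof. by apply: RsummableZ; apply: Rsummable_gaussd_center; rewrite invr_gt0. Qed.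

Lemma Rintegral_gauss_kernel y : \int[mu]_x gauss_kernel (x - y) = 1.
Proof.
rewrite RsumZ; last by apply: Rsummable_gaussd_center; rewrite invr_gt0.
rewrite Rintegral_gaussd_center ?invr_gt0// exprVn invrK mulVf//.
by rewrite expf_neq0// gt_eqF.
Qed.

Lemma measurable_gauss_kernel y : measurable_fun setT (fun x => gauss_kernel (x - y)).
Proof. exact: Rsummable_measurable (Rsummable_gauss_kernel y). Qed.

Lemma Rsummable_gauss_kernel_sqr y : Rsummable mu (fun x => gauss_kernel (x - y) ^+ 2).
Proof.
apply: (@le_Rsummable _ _ _ mu _ (fun x => a ^- n * gauss_kernel (x - y))).
- by apply: measurable_funX; exact: measurable_gauss_kernel.
- move=> x; rewrite ger0_norm ?sqr_ge0// expr2.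
  by apply: ler_wpM2r; [exact: gauss_kernel_ge0|exact: gauss_kernel_le].
- exact/RsummableZ/Rsummable_gauss_kernel.
Qed.

End gauss_kernel.

(** With r = min(1, c / (k + 1)), r (m + 1) <= 1 + c m / (k + 1) <= exp(c m / (k + 1)). The power k
    + 1 of this bounds the sequence by a multiple of 1/(m + 1). *)
Lemma pow_expR_cvg0 (k : nat) (c : R) : 0 < c ->
  m.+1%:R ^+ k * expR (- (c * m%:R)) @[m --> \oo] --> (0 : R).
Proof.
move=> c0; pose r := Num.min 1 (c / k.+1%:R).
have r0 : 0 < r by rewrite lt_min ltr01 divr_gt0.
have r1 : r <= 1 by rewrite ge_min lexx.
have rc : r <= c / k.+1%:R by rewrite ge_min lexx orbT.
have bd m : m.+1%:R ^+ k * expR (- (c * m%:R)) <= r ^- k.+1 * harmonic m.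
  have m0 : (0 : R) < m.+1%:R by [].
  have h1 : r * m.+1%:R <= expR (c * m%:R / k.+1%:R).
    apply: le_trans (expR_ge1Dx _); rewrite -natr1 mulrDr mulr1 addrC lerD//.
    by rewrite mulrAC ler_wpM2r.
  have h2 : (r * m.+1%:R) ^+ k.+1 <= expR (c * m%:R).
    have -> : c * m%:R = k.+1%:R * (c * m%:R / k.+1%:R) by rewrite [RHS]mulrC divfK.
    rewrite expRM_natl; apply: lerXn2r h1; rewrite nnegrE ?expR_ge0//.
    by rewrite mulr_ge0// ltW.
  rewrite expRN /harmonic /= ler_pdivrMr ?expR_gt0//.
  apply: le_trans (ler_wpM2l _ h2); last by rewrite mulr_ge0 ?invr_ge0 ?exprn_ge0// ltW.
  rewrite le_eqVlt; apply/orP; left; apply/eqP.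
  by rewrite exprMn mulrACA mulVf ?mul1r ?expf_neq0 ?gt_eqF// exprS mulKf// gt_eqF.
have cb : r ^- k.+1 * harmonic m @[m --> \oo] --> (0 : R).
  by rewrite -(mulr0 (r ^- k.+1)); apply: cvgMl_tmp; exact: cvg_harmonic.
apply: (squeeze_cvgr _ (cvg_cst 0) cb); apply: nearW => m.
by rewrite bd mulr_ge0 ?expR_ge0 ?exprn_ge0.
Qed.

(** In (m + 1)^2 |z|^2 = m^2 |z|^2 + 2 m |z|^2 + |z|^2, the last term is kept as the fixed Gaussian
    [gaussd 1] and one m |z|^2 is bounded below by m delta. The tail is thus a vanishing constant
    times a function independent of m. *)
Lemma gauss_kernel_tail (delta : R) (m : nat) z : 0 <= delta -> delta <= sqn z ->
  gauss_kernel (m.+1%:R^-1) z <=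
  m.+1%:R ^+ n * expR (- (pi * delta * m%:R)) * gaussd 1 z.
Proof.
move=> d0 dz; rewrite /gauss_kernel exprVn !invrK -mulrA.
apply: ler_wpM2l; first exact: exprn_ge0.
rewrite /gaussd -expRD ler_expR -[m.+1%:R]natr1.
have p0 := pi_gt0 R; have m0 : (0 : R) <= m%:R by [].
move: (pi : R) (m%:R : R) (sqn z) p0 m0 dz => p k s p0 k0 ds.
have pk : 0 <= p * k by rewrite mulr_ge0// ltW.
have : 0 <= p * k * (s - delta) by rewrite mulr_ge0// subr_ge0.
have : 0 <= p * k * s by apply: mulr_ge0 pk (le_trans d0 ds).
have : 0 <= p * k ^+ 2 * s.
  by apply: mulr_ge0 (le_trans d0 ds); apply: mulr_ge0 (sqr_ge0 _); exact: ltW.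
rewrite expr1n sqrrD1 => h1 h2 h3.
have -> : - (p * (k ^+ 2 + k *+ 2 + 1)) * s = - (p * k ^+ 2 * s) - 2 * (p * k * s) - p * s by ring.
by rewrite mulrBr in h3; lra.
Qed.

Section inversion.
Variables (u gr gi : 'rV[R]_n -> R).
Hypotheses (mu_ : measurable_fun setT u) (Iu2 : Rsummable mu (fun x => u x ^+ 2))
  (Ir : Rsummable mu gr) (Ii : Rsummable mu gi).
Hypothesis FT : (fun N => \int[mu]_xi
   ((gr xi - FTc (trunc u N) xi) ^+ 2 + (gi xi + FTs (trunc u N) xi) ^+ 2)%:E)%E
    @ \oo --> (0 : \bar R)%E.

Let Iuk a y : 0 < a -> Rsummable mu (fun x => u x * gauss_kernel a (x - y)).
Proof.
move=> a0; apply: Rsummable_mul => //; first exact: measurable_gauss_kernel.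
exact: Rsummable_gauss_kernel_sqr.
Qed.

(** The damped integrand of the inversion formula at y; [wN] below is the same for the transform of
    the truncation at radius N. *)
Let wI (a : R) y xi := gaussd a xi *
  (gr xi * cos (2 * pi * dotp y xi) - gi xi * sin (2 * pi * dotp y xi)).

Let Icg y : Rsummable mu (fun xi => gr xi * cos (2 * pi * dotp y xi)).
Proof.
apply: (@Rsummable_Mbounded _ _ _ mu _ _ 1 Ir); last by move=> ?; exact: cos_max.
exact: measurable_cos_phase.
Qed.

Let Isg y : Rsummable mu (fun xi => gi xi * sin (2 * pi * dotp y xi)).
Proof.
apply: (@Rsummable_Mbounded _ _ _ mu _ _ 1 Ii); last by move=> ?; exact: sin_max.
exact: measurable_sin_phase.
Qed.

Let mwI a y : measurable_fun setT (wI a y).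
Proof.
apply: measurable_funM; first exact: measurable_gaussd.
exact: Rsummable_measurable (RsummableB (Icg y) (Isg y)).
Qed.

Let IwI a y : Rsummable mu (wI a y).
Proof.
apply: (le_Rsummable (mwI a y) _ (Rsummable_norm (RsummableB (Icg y) (Isg y)))).
move=> xi; rewrite /wI normrM ler_piMl// ger0_norm ?gaussd_ge0//.
exact: gaussd_le1.
Qed.

Let wN (a : R) y N xi := gaussd a xi *
  (FTc (trunc u N) xi * cos (2 * pi * dotp y xi) + FTs (trunc u N) xi * sin (2 * pi * dotp y xi)).

Let IwN a y N : 0 < a -> Rsummable mu (wN a y N).
Proof.
move=> a0; have IN := Rsummable_trunc N mu_ Iu2.
apply: (@Rsummable_Mbounded _ _ _ mu _ _
  (\int[mu]_x `|trunc u N x| + \int[mu]_x `|trunc u N x|) (Rsummable_gaussd n a0)).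
  apply: measurable_funD; apply: measurable_funM.
  - exact: measurable_FTc.
  - exact: measurable_cos_phase.
  - exact: measurable_FTs.
  - exact: measurable_sin_phase.
move=> xi; apply: (le_trans (ler_normD _ _)); rewrite !normrM; apply: lerD.
  by rewrite -[leRHS]mulr1 ler_pM ?norm_FTc_le ?cos_max.
by rewrite -[leRHS]mulr1 ler_pM ?norm_FTs_le ?sin_max.
Qed.

Let cvg_wN a y : 0 < a ->
  \int[mu]_xi wN a y N xi @[N --> \oo] --> \int[mu]_xi wI a y xi.
Proof.
move=> a0; apply/cvgrPdist_le => /= e e0.
pose G := \int[mu]_xi gaussd a xi.
have G0 : 0 <= G by apply: Rintegral_ge0 => xi _; exact: gaussd_ge0.
(* AM-GM with parameter s bounds the error by s/2 times the squared L^2 distance of the transforms,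
   plus G / s. This s makes G / s at most e/2, and a squared distance below e / s makes the other
   term at most e/2. *)
pose s := (2 * G + 1) / e.
have s0 : 0 < s by rewrite divr_gt0// ltr_wpDl// mulr_ge0.
pose D N xi := (gr xi - FTc (trunc u N) xi) ^+ 2 + (gi xi + FTs (trunc u N) xi) ^+ 2.
have D0 N xi : 0 <= D N xi by rewrite addr_ge0 ?sqr_ge0.
have mD N : measurable_fun setT (D N).
  have IN := Rsummable_trunc N mu_ Iu2.
  apply: measurable_funD; apply: measurable_funX.
    apply: measurable_funB; first exact: Rsummable_measurable Ir.
    exact: measurable_FTc.
  apply: measurable_funD; first exact: Rsummable_measurable Ii.
  exact: measurable_FTs.
have es0 : 0 < e / s by rewrite divr_gt0.
have : \forall N \near \oo, (\int[mu]_xi (D N xi)%:E < (e / s)%:E)%E.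
  move: es0; apply: (cvge0P _).1 => // M.
  by apply: integral_ge0 => xi _; rewrite lee_fin D0.
apply: filterS => N DN.
have ID : Rsummable mu (D N) by apply/ge0_RsummableP => //; rewrite (lt_trans DN)// ltry.
have {}DN : \int[mu]_xi D N xi < e / s by rewrite -lte_fin RintegralE.
rewrite -(RsumB (IwI a y) (IwN y N a0)).
have IG := Rsummable_gaussd n a0.
have Ibd : Rsummable mu (fun xi => s / 2 * D N xi + s^-1 * gaussd a xi).
  by apply: RsummableD; apply: RsummableZ.
apply: le_trans (ler_norm_Rintegral _ Ibd _) _.
- exact: measurable_funB (mwI a y) (Rsummable_measurable (IwN y N a0)).
- move=> xi; rewrite /wI /wN /D.
  have -> : gaussd a xi * (gr xi * cos (2 * pi * dotp y xi) - gi xi * sin (2 * pi * dotp y xi)) -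
    gaussd a xi * (FTc (trunc u N) xi * cos (2 * pi * dotp y xi) + FTs (trunc u N) xi * sin (2 * pi * dotp y xi))
    = gaussd a xi * (gr xi - FTc (trunc u N) xi) * cos (2 * pi * dotp y xi)
     - gaussd a xi * (gi xi + FTs (trunc u N) xi) * sin (2 * pi * dotp y xi) by ring.
  have := gaussd_le1 a xi; have := gaussd_ge0 a xi.
  move: (gaussd a xi) (gr xi - _) (gi xi + _) => w A B w0 w1.
  have hc := cos_max (2 * pi * dotp y xi); have hs := sin_max (2 * pi * dotp y xi).
  apply: (@le_trans _ _ (w * `|A| + w * `|B|)).
    apply: (le_trans (ler_normB _ _)); rewrite !normrM (ger0_norm w0).
    by apply: lerD; rewrite ler_piMr// mulr_ge0.
  have aux C : w * `|C| <= s / 2 * C ^+ 2 + s^-1 / 2 * w.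
    have -> : C ^+ 2 = `|C| ^+ 2 by rewrite -normrX ger0_norm ?sqr_ge0.
    have h1 : 0 <= (s * `|C| - w) ^+ 2 * (s^-1 / 2) by rewrite mulr_ge0 ?sqr_ge0// mulr_ge0 ?invr_ge0// ltW.
    have h2 : (s * `|C| - w) ^+ 2 * (s^-1 / 2) = s / 2 * `|C| ^+ 2 - w * `|C| + s^-1 / 2 * w ^+ 2.
      by field; rewrite gt_eqF.
    have h3 : s^-1 / 2 * w ^+ 2 <= s^-1 / 2 * w.
      apply: ler_wpM2l; last by rewrite expr2 ler_piMr.
      by rewrite mulr_ge0 ?invr_ge0// ltW.
    by rewrite h2 in h1; lra.
  have := aux A; have := aux B; rewrite [s / 2 * (_ + _)]mulrDr.
  have -> : s^-1 * w = s^-1 / 2 * w + s^-1 / 2 * w by field; rewrite gt_eqF.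
  by lra.
rewrite RsumD; [|exact: RsummableZ|exact: RsummableZ].
rewrite (RsumZ _ ID) (RsumZ _ IG) -/G.
have h1 : s / 2 * \int[mu]_xi D N xi <= e / 2.
  have -> : e / 2 = s / 2 * (e / s) by field; rewrite gt_eqF.
  apply: ler_wpM2l (ltW DN); by rewrite divr_ge0// ltW.
have h2 : s^-1 * G <= e / 2.
  have G1 : 0 < 2 * G + 1 by rewrite ltr_wpDl// mulr_ge0.
  by rewrite /s invf_div mulrAC ler_pdivrMr//; nra.
by rewrite (le_trans (lerD h1 h2))// -splitr.
Qed.

(** [gauss_regularization] applies to summable functions, hence to the truncations of u; N then goes
    to infinity on both sides, by L^2 convergence on the left and by domination on the right. *)
Let regularized a y : 0 < a ->
  \int[mu]_xi wI a y xi = \int[mu]_x (u x * gauss_kernel a (x - y)).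
Proof.
move=> a0.
apply: (@cvg_unique _ _ (\int[mu]_xi wN a y N xi @[N --> \oo])).
- exact: Rhausdorff.
- exact: cvg_wN.
have -> : (fun N => \int[mu]_xi wN a y N xi) =
   (fun N => \int[mu]_x (trunc u N x * gauss_kernel a (x - y))).
  apply/funext => N; apply: gauss_regularization a0 _; exact: Rsummable_trunc.
have mk := measurable_gauss_kernel a0 y.
have [] := @Rintegral_dominated _ _ _ mu (fun N x => trunc u N x * gauss_kernel a (x - y))
  (fun x => u x * gauss_kernel a (x - y)) (fun x => `|u x * gauss_kernel a (x - y)|) => //.
- by move=> N; apply: measurable_funM mk; exact: measurable_trunc.
- exact: measurable_funM.
- by move=> x; apply: cvgMr_tmp; exact: trunc_cvg.
- exact: Rsummable_norm (Iuk y a0).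
- by move=> N x; rewrite !normrM ler_wpM2r// norm_trunc_le.
Qed.

Let cvg_wI y : \int[mu]_xi wI (m.+1%:R^-1) y xi @[m --> \oo] --> invFT gr gi y.
Proof.
have -> : invFT gr gi y = \int[mu]_xi
    (gr xi * cos (2 * pi * dotp y xi) - gi xi * sin (2 * pi * dotp y xi)).
  rewrite (RsumB (Icg y) (Isg y)) /invFT /FTc /FTs.
  by congr (_ - _); apply: eq_Rintegral => xi _; rewrite dotpC.
have I := RsummableB (Icg y) (Isg y).
have [] := @Rintegral_dominated _ _ _ mu (fun m xi => wI (m.+1%:R^-1) y xi) _ _
   (fun m => mwI _ y) (Rsummable_measurable I) _ (Rsummable_norm I) => //.
- move=> xi; rewrite /wI -[X in _ --> X]mul1r; apply: cvgMr_tmp.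
  exact: gaussd_cvg1.
- move=> m xi; rewrite /wI normrM ler_piMl// ger0_norm ?gaussd_ge0//.
  exact: gaussd_le1.
Qed.

Variable y : 'rV[R]_n.
Hypothesis u_cont : forall e, 0 < e -> exists2 delta, 0 < delta &
  forall x, (forall i, `|x 0 i - y 0 i| < delta) -> `|u x - u y| < e.

Let near_or_far delta x : 0 < delta ->
  (forall i, `|x 0 i - y 0 i| < delta) \/ delta ^+ 2 <= sqn (x - y).
Proof.
move=> d0; have [/forallP h|] := boolP [forall i, `|x 0 i - y 0 i| < delta]; first by left.
rewrite negb_forall => /existsP[i]; rewrite -leNgt => h; right.
rewrite /sqn (bigD1 i)//=; apply: ler_wpDr.
  by apply: sumr_ge0 => j _; exact: sqr_ge0.
rewrite !mxE -[leRHS]ger0_norm ?sqr_ge0// normrX lerXn2r ?nnegrE//.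
exact: ltW.
Qed.

(** Near y the continuity of u gives e/2. Far from y, u is merely square summable, and the tail
    bound leaves a vanishing factor times integrals of u and of u(y) against the fixed Gaussian
    centred at y. *)
Let cvg_approx_identity :
  \int[mu]_x (u x * gauss_kernel (m.+1%:R^-1) (x - y)) @[m --> \oo] --> u y.
Proof.
apply/cvgrPdist_le => /= e e0.
have e20 : 0 < e / 2 by rewrite divr_gt0.
have [delta d0 dh] := u_cont e20.
have Ig1 : Rsummable mu (fun x => gaussd 1 (x - y)) by exact: Rsummable_gaussd_center.
have Ig2 : Rsummable mu (fun x => gaussd 1 (x - y) ^+ 2).
  apply: (le_Rsummable _ _ Ig1).
    by apply: measurable_funX; exact: measurable_gaussd_center.
  move=> x; rewrite ger0_norm ?sqr_ge0// expr2.
  by apply: ler_piMr; [exact: gaussd_ge0|exact: gaussd_le1].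
have mnu : measurable_fun setT (fun x => `|u x|) by exact: measurableT_comp.
have Ib1 : Rsummable mu (fun x => `|u x| * gaussd 1 (x - y)).
  apply: Rsummable_mul => //; first exact: measurable_gaussd_center.
  have -> : (fun x => `|u x| ^+ 2) = (fun x => u x ^+ 2).
    by apply/funext => x; rewrite -normrX ger0_norm ?sqr_ge0.
  exact: Iu2.
pose B := \int[mu]_x (`|u x| * gaussd 1 (x - y) + `|u y| * gaussd 1 (x - y)).
have IB : Rsummable mu (fun x => `|u x| * gaussd 1 (x - y) + `|u y| * gaussd 1 (x - y)).
  by apply: RsummableD Ib1 _; exact: RsummableZ.
pose c (m : nat) := m.+1%:R ^+ n * expR (- (pi * delta ^+ 2 * m%:R)) : R.
have c0 m : 0 <= c m by rewrite mulr_ge0 ?expR_ge0 ?exprn_ge0.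
have cB : c m * B @[m --> \oo] --> (0 : R).
  rewrite -(mul0r B); apply: cvgMr_tmp; apply: pow_expR_cvg0.
  by rewrite mulr_gt0 ?pi_gt0 ?exprn_gt0.
move/cvgrPdist_le : cB => /(_ _ e20); apply: filterS => m; rewrite sub0r normrN => cBm.
have a0 : 0 < m.+1%:R^-1 :> R by [].
have IK := Rsummable_gauss_kernel a0 y.
have IuK := Iuk y a0.
have -> : u y = \int[mu]_x (u y * gauss_kernel m.+1%:R^-1 (x - y)).
  by rewrite (RsumZ _ IK) Rintegral_gauss_kernel// mulr1.
rewrite -(RsumB (RsummableZ _ IK) IuK).
have I2 : Rsummable mu (fun x => e / 2 * gauss_kernel m.+1%:R^-1 (x - y) +
   c m * (`|u x| * gaussd 1 (x - y) + `|u y| * gaussd 1 (x - y))).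
  by apply: RsummableD; [exact: RsummableZ IK|exact: RsummableZ IB].
apply: le_trans (ler_norm_Rintegral _ I2 _) _.
- exact: Rsummable_measurable (RsummableB (RsummableZ _ IK) IuK).
- move=> x; rewrite -mulrBl normrM (ger0_norm (gauss_kernel_ge0 a0 _)) distrC.
  have K0 := gauss_kernel_ge0 a0 (x - y).
  have g0 := gaussd_ge0 1 (x - y).
  have [h|h] := near_or_far x d0.
    apply: ler_wpDr; first by rewrite mulr_ge0 ?addr_ge0 ?mulr_ge0.
    by apply: (ler_wpM2r K0); exact/ltW/dh.
  apply: ler_wpDl; first by rewrite mulr_ge0// ltW.
  have := gauss_kernel_tail m (sqr_ge0 delta) h; rewrite -/(c m) => hc.
  apply: (le_trans (ler_wpM2l _ hc)); first exact: normr_ge0.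
  rewrite mulrCA; apply: ler_wpM2l => //; rewrite -mulrDl.
  by apply: (ler_wpM2r g0); exact: ler_normB.
rewrite (RsumD (RsummableZ _ IK) (RsummableZ _ IB)) (RsumZ _ IK) (RsumZ _ IB).
rewrite Rintegral_gauss_kernel// mulr1 -/B [leRHS]splitr lerD2l.
exact: le_trans (ler_norm _) cBm.
Qed.

(** Both are limits of the same sequence, the two sides of [regularized] at a = 1/(m + 1). The
    equality holds at the point y itself, not just almost everywhere. *)
Lemma fourier_inversion : u y = invFT gr gi y.
Proof.
apply: (@cvg_unique _ _ (\int[mu]_xi wI (m.+1%:R^-1) y xi @[m --> \oo])).
- exact: Rhausdorff.
- have -> : (fun m => \int[mu]_xi wI (m.+1%:R^-1) y xi) =
      (fun m => \int[mu]_x (u x * gauss_kernel (m.+1%:R^-1) (x - y))).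
    by apply/funext => m; exact: regularized.
  exact: cvg_approx_identity.
- exact: cvg_wI.
Qed.

End inversion.

End fourier_inversion.

(** * Fourier integrals of weighted L^2 functions *)

Section trigonometric_estimates.
Context {R : realType}.
Implicit Types a b : R.

Lemma lipschitz_of_derive (f f' : R -> R) : (forall x : R, is_derive x 1 f (f' x)) ->
  (forall x, `|f' x| <= 1) -> forall a b, `|f (a + b) - f a| <= `|b|.
Proof.
move=> df f'1.
have le_case (x y : R) : x <= y -> `|f y - f x| <= `|y - x|.
  move=> xy; have [|c _ ->] := @MVT_segment _ f f' x y xy (fun z _ => df z).
    by apply: continuous_subspaceT; exact: is_derive_continuous df.
  by rewrite normrM ler_piMl.
move=> a b; have [ab|ab] := leP a (a + b).
  by rewrite (le_trans (le_case _ _ ab))// addrAC subrr add0r.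
rewrite distrC (le_trans (le_case _ _ (ltW ab)))//.
by rewrite opprD addrA subrr add0r normrN.
Qed.

Lemma cos_lipschitz a b : `|cos (a + b) - cos a| <= `|b|.
Proof.
apply: (lipschitz_of_derive (f := cos) (f' := fun x => - sin x)) => x.
by rewrite normrN sin_max.
Qed.

Lemma sin_lipschitz a b : `|sin (a + b) - sin a| <= `|b|.
Proof.
by apply: (lipschitz_of_derive (f := sin) (f' := cos)) => x; exact: cos_max.
Qed.

(** By the mean value theorem the remainder is b (f'(c) - f'(a)) with c within |b| of a. *)
Lemma taylor_of_derive (f f' : R -> R) : (forall x : R, is_derive x 1 f (f' x)) ->
  (forall a b, `|f' (a + b) - f' a| <= `|b|) ->
  forall a b, `|f (a + b) - f a - b * f' a| <= b ^+ 2.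
Proof.
move=> df lip.
have cf := is_derive_continuous df.
have aux (x y c z : R) : `|c - z| <= `|y - x| ->
    `|f' c * (y - x) - (y - x) * f' z| <= (y - x) ^+ 2.
  move=> h; rewrite mulrC -mulrBr normrM.
  have -> : (y - x) ^+ 2 = `|y - x| * `|y - x|.
    by rewrite -expr2 -normrX ger0_norm ?sqr_ge0.
  apply: ler_wpM2l => //; apply: le_trans h.
  by have := lip z (c - z); rewrite [z + _]addrC subrK.
move=> a b; have [ab|ab] := leP a (a + b).
  have [|c + ->] := @MVT_segment _ f f' _ _ ab (fun z _ => df z).
    exact: continuous_subspaceT.
  rewrite in_itv/= => /andP[ac cb].
  have := @aux a (a + b) c a; rewrite addrAC subrr add0r; apply.
  by rewrite !ger0_norm; lra.
have [|c + E] := @MVT_segment _ f f' _ _ (ltW ab) (fun z _ => df z).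
  exact: continuous_subspaceT.
rewrite in_itv/= => /andP[bc ca].
have -> : f (a + b) - f a = f' c * b by rewrite -opprB E; ring.
have := @aux a (a + b) c a; rewrite addrAC subrr add0r; apply.
by rewrite !ler0_norm; lra.
Qed.

Lemma cos_taylor a b : `|cos (a + b) - cos a - b * - sin a| <= b ^+ 2.
Proof.
apply: (taylor_of_derive (f := cos) (f' := fun x => - sin x)) => x y.
by rewrite -opprD normrN; exact: sin_lipschitz.
Qed.

Lemma sin_taylor a b : `|sin (a + b) - sin a - b * cos a| <= b ^+ 2.
Proof. by apply: (taylor_of_derive (f := sin) (f' := cos)) => x y; exact: cos_lipschitz. Qed.

End trigonometric_estimates.

(** * Frequency pairs with finite weighted norm *)

Section weighted_pair.
Context {R : realType} {n : nat}.
Variable q : R.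
Hypothesis hq : n%:R / 2 + 1 < q.
Local Notation mu := (@leb R n).
Local Notation C0 := (\int[mu]_x ((1 + sqn x) `^ (- (q - 1)))).

(** The Japanese bracket; it dominates both 1 and every coordinate. *)
Definition jap (x : 'rV[R]_n) := (1 + sqn x) `^ (2^-1).

Lemma base_gt0 (x : 'rV[R]_n) : 0 < 1 + sqn x.
Proof. by rewrite ltr_wpDr ?sqn_ge0. Qed.

Lemma jap_ge1 (x : 'rV[R]_n) : 1 <= jap x.
Proof. by rewrite -(@powRr0 R (1 + sqn x)) ler_powR ?invr_ge0// lerDl sqn_ge0. Qed.

Lemma jap_ge0 (x : 'rV[R]_n) : 0 <= jap x. Proof. exact: powR_ge0. Qed.

Lemma jap_sqr (x : 'rV[R]_n) : jap x ^+ 2 = 1 + sqn x.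
Proof.
rewrite -powR_mulrn ?powR_ge0// -powRrM mulVf ?powRr1//.
exact/ltW/base_gt0.
Qed.

Lemma coord_le_jap (x : 'rV[R]_n) i : `|x 0 i| <= jap x.
Proof.
rewrite -(@ler_pXn2r _ 2)// ?nnegrE ?jap_ge0//.
rewrite jap_sqr -normrX ger0_norm ?sqr_ge0// /sqn (bigD1 i)//= addrCA lerDl.
by rewrite addr_ge0//; apply: sumr_ge0 => j _; exact: sqr_ge0.
Qed.

Lemma measurable_jap : measurable_fun setT jap.
Proof.
have m1 : measurable_fun setT (fun x : 'rV[R]_n => 1 + sqn x).
  by apply: measurable_funD => //; exact: measurable_sqn.
exact: (measurableT_comp (@measurable_powR R (2^-1)) m1).
Qed.

Lemma measurable_powR_base (s : R) :
  measurable_fun setT (fun x : 'rV[R]_n => (1 + sqn x) `^ s).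
Proof.
have m1 : measurable_fun setT (fun x : 'rV[R]_n => 1 + sqn x).
  by apply: measurable_funD => //; exact: measurable_sqn.
exact: (measurableT_comp (@measurable_powR R s) m1).
Qed.

Lemma Rsummable_C0 : Rsummable mu (fun x => (1 + sqn x) `^ (- (q - 1))).
Proof. by apply: Rsummable_weight; rewrite ltrBrDr. Qed.

Lemma powR_base_ge1 (x : 'rV[R]_n) : 1 <= (1 + sqn x) `^ q.
Proof.
rewrite -[leLHS](@powRr0 R (1 + sqn x)) ler_powR ?lerDl ?sqn_ge0//.
have : 0 <= n%:R / 2 :> R by rewrite divr_ge0.
by move: hq; lra.
Qed.

Lemma jap_sqr_le (x : 'rV[R]_n) : jap x ^+ 2 <= (1 + sqn x) `^ q.
Proof.
rewrite jap_sqr -[leLHS]powRr1; last exact/ltW/base_gt0.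
rewrite ler_powR ?lerDl ?sqn_ge0//.
have : 0 <= n%:R / 2 :> R by rewrite divr_ge0.
by move: hq; lra.
Qed.

Variables (gr gi : 'rV[R]_n -> R).
Hypotheses (mgr : measurable_fun setT gr) (mgi : measurable_fun setT gi).
Definition wpair (x : 'rV[R]_n) := (1 + sqn x) `^ q * (gr x ^+ 2 + gi x ^+ 2).
Hypothesis Iw : Rsummable mu wpair.

Let wpair_ge0 x : 0 <= wpair x.
Proof. by rewrite mulr_ge0 ?powR_ge0// addr_ge0 ?sqr_ge0. Qed.

Definition ampl (x : 'rV[R]_n) := `|gr x| + `|gi x|.

Lemma ampl_ge0 x : 0 <= ampl x. Proof. by rewrite addr_ge0. Qed.

Lemma measurable_ampl : measurable_fun setT ampl.
Proof. by apply: measurable_funD; exact: measurableT_comp. Qed.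

(* AM-GM, with the weight split as [(1 + sqn x)^(1/2) = (1 + sqn x)^(q/2) * (1 + sqn x)^((1-q)/2)]. *)
Lemma jap_ampl_le (t : R) (x : 'rV[R]_n) : 0 < t ->
  jap x * ampl x <= t / 2 * wpair x + t^-1 * (1 + sqn x) `^ (- (q - 1)).
Proof.
move=> t0.
have b0 := base_gt0 x.
pose A := (1 + sqn x) `^ (q / 2).
pose B := (1 + sqn x) `^ ((1 - q) / 2).
have A0 : 0 <= A by exact: powR_ge0.
have B0 : 0 <= B by exact: powR_ge0.
have bn : (1 + sqn x != 0) by rewrite gt_eqF.
have jE : jap x = A * B.
  rewrite /A /B -powRD ?bn ?implybT//; congr (_ `^ _).
  by field.
have AE : (1 + sqn x) `^ q = A ^+ 2.
  by rewrite -powR_mulrn// -powRrM divfK.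
have BE : (1 + sqn x) `^ (- (q - 1)) = B ^+ 2.
  by rewrite -powR_mulrn// -powRrM divfK// opprB.
have aux (g : R) : A * B * `|g| <= t / 2 * (A ^+ 2 * g ^+ 2) + t^-1 / 2 * B ^+ 2.
  have -> : g ^+ 2 = `|g| ^+ 2 by rewrite -normrX ger0_norm ?sqr_ge0.
  have h1 : 0 <= (t * (A * `|g|) - B) ^+ 2 * (t^-1 / 2).
    by rewrite mulr_ge0 ?sqr_ge0// divr_ge0// invr_ge0 ltW.
  have h2 : (t * (A * `|g|) - B) ^+ 2 * (t^-1 / 2) =
     t / 2 * (A ^+ 2 * `|g| ^+ 2) + t^-1 / 2 * B ^+ 2 - A * B * `|g|.
    by field; rewrite gt_eqF.
  by rewrite h2 in h1; lra.
rewrite jE /wpair AE BE /ampl.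
have := aux (gr x); have := aux (gi x).
have -> : t^-1 * B ^+ 2 = t^-1 / 2 * B ^+ 2 + t^-1 / 2 * B ^+ 2 by field; rewrite gt_eqF.
by lra.
Qed.

Lemma Rsummable_jap_ampl : Rsummable mu (fun x => jap x * ampl x).
Proof.
apply: (@le_Rsummable _ _ _ mu _ (fun x => 1 / 2 * wpair x + 1^-1 * (1 + sqn x) `^ (- (q - 1)))).
- by apply: measurable_funM; [exact: measurable_jap|exact: measurable_ampl].
- move=> x; rewrite ger0_norm; first exact: jap_ampl_le.
  by rewrite mulr_ge0 ?jap_ge0 ?ampl_ge0.
- apply: RsummableD; first exact: RsummableZ Iw.
  exact: RsummableZ Rsummable_C0.
Qed.

Lemma Rintegral_jap_ampl_le (t : R) : 0 < t ->
  \int[mu]_x (jap x * ampl x) <= t / 2 * \int[mu]_x wpair x + t^-1 * C0.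
Proof.
move=> t0.
rewrite -(RsumZ _ Iw) -(RsumZ _ Rsummable_C0) -RsumD.
- apply: ler_Rintegral.
  + exact: Rsummable_jap_ampl.
  + by apply: RsummableD; [exact: RsummableZ Iw|exact: RsummableZ Rsummable_C0].
  + by move=> x; exact: jap_ampl_le.
- exact: RsummableZ Iw.
- exact: RsummableZ Rsummable_C0.
Qed.

Lemma Rsummable_ampl : Rsummable mu ampl.
Proof.
apply: (le_Rsummable measurable_ampl _ Rsummable_jap_ampl) => x.
by rewrite ger0_norm ?ampl_ge0// ler_peMl ?ampl_ge0// jap_ge1.
Qed.

Lemma Rsummable_gr : Rsummable mu gr.
Proof. by apply: (le_Rsummable mgr _ Rsummable_ampl) => x; rewrite lerDl. Qed.

Lemma Rsummable_gi : Rsummable mu gi.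
Proof. by apply: (le_Rsummable mgi _ Rsummable_ampl) => x; rewrite lerDr. Qed.

Lemma gr_sqr_le_wpair x : gr x ^+ 2 <= wpair x.
Proof.
apply: (@le_trans _ _ (gr x ^+ 2 + gi x ^+ 2)); first by rewrite lerDl sqr_ge0.
by rewrite ler_peMl ?addr_ge0 ?sqr_ge0// powR_base_ge1.
Qed.

Lemma gi_sqr_le_wpair x : gi x ^+ 2 <= wpair x.
Proof.
apply: (@le_trans _ _ (gr x ^+ 2 + gi x ^+ 2)); first by rewrite lerDr sqr_ge0.
by rewrite ler_peMl ?addr_ge0 ?sqr_ge0// powR_base_ge1.
Qed.

Lemma Rsummable_gr_sqr : Rsummable mu (fun x => gr x ^+ 2).
Proof.
apply: (le_Rsummable _ _ Iw); first exact: measurable_funX.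
by move=> x; rewrite ger0_norm ?sqr_ge0// gr_sqr_le_wpair.
Qed.

Lemma Rsummable_gi_sqr : Rsummable mu (fun x => gi x ^+ 2).
Proof.
apply: (le_Rsummable _ _ Iw); first exact: measurable_funX.
by move=> x; rewrite ger0_norm ?sqr_ge0// gi_sqr_le_wpair.
Qed.

(* Frequency side of the partial derivative along [j]: multiplication by [2 i pi xi_j]. *)
Definition dgr (j : 'I_n) (xi : 'rV[R]_n) := - (2 * pi * xi 0 j) * gi xi.
Definition dgi (j : 'I_n) (xi : 'rV[R]_n) := 2 * pi * xi 0 j * gr xi.

Let twopi_ge0 : 0 <= 2 * pi :> R. Proof. by rewrite mulr_ge0 ?pi_ge0. Qed.

Lemma measurable_dgr j : measurable_fun setT (dgr j).
Proof.
apply: measurable_funM mgi; apply: measurable_funN; apply: measurable_funM => //.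
exact: measurable_coord.
Qed.

Lemma measurable_dgi j : measurable_fun setT (dgi j).
Proof.
apply: measurable_funM mgr; apply: measurable_funM => //.
exact: measurable_coord.
Qed.

Lemma dg_norm_le j xi : `|dgr j xi| + `|dgi j xi| <= 2 * pi * (jap xi * ampl xi).
Proof.
rewrite /dgr /dgi mulNr normrN !normrM ger0_norm// (ger0_norm (pi_ge0 R)).
rewrite -mulrDr [`|gi _| + _]addrC -/(ampl xi) -[X in X <= _]mulrA; apply: ler_wpM2l => //.
by apply: ler_wpM2r; [exact: ampl_ge0|exact: coord_le_jap].
Qed.

Lemma Rsummable_dgr j : Rsummable mu (dgr j).
Proof.
apply: (le_Rsummable (measurable_dgr j) _ (RsummableZ (2 * pi) Rsummable_jap_ampl)) => xi.
by apply: le_trans (dg_norm_le j xi); rewrite lerDl.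
Qed.

Lemma Rsummable_dgi j : Rsummable mu (dgi j).
Proof.
apply: (le_Rsummable (measurable_dgi j) _ (RsummableZ (2 * pi) Rsummable_jap_ampl)) => xi.
by apply: le_trans (dg_norm_le j xi); rewrite lerDr.
Qed.

Let coord_sqr_le (j : 'I_n) (xi : 'rV[R]_n) (g : R) :
  (2 * pi * xi 0 j * g) ^+ 2 <= (2 * pi) ^+ 2 * ((1 + sqn xi) `^ q * g ^+ 2).
Proof.
rewrite -[2 * pi * _ * g]mulrA exprMn; apply: ler_wpM2l; first exact: sqr_ge0.
rewrite exprMn; apply: ler_wpM2r; first exact: sqr_ge0.
apply: le_trans (jap_sqr_le xi).
have -> : xi 0 j ^+ 2 = `|xi 0 j| ^+ 2 by rewrite -normrX ger0_norm ?sqr_ge0.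
by rewrite lerXn2r ?nnegrE ?jap_ge0// coord_le_jap.
Qed.

Lemma Rsummable_dgr_sqr j : Rsummable mu (fun xi => dgr j xi ^+ 2).
Proof.
apply: (le_Rsummable _ _ (RsummableZ ((2 * pi) ^+ 2) Iw)).
  by apply: measurable_funX; exact: measurable_dgr.
move=> xi; rewrite ger0_norm ?sqr_ge0// /dgr mulNr sqrrN.
apply: (le_trans (coord_sqr_le _ _ _)); apply: ler_wpM2l; first exact: sqr_ge0.
by apply: ler_wpM2l; rewrite ?powR_ge0// lerDr sqr_ge0.
Qed.

Lemma Rsummable_dgi_sqr j : Rsummable mu (fun xi => dgi j xi ^+ 2).
Proof.
apply: (le_Rsummable _ _ (RsummableZ ((2 * pi) ^+ 2) Iw)).
  by apply: measurable_funX; exact: measurable_dgi.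
move=> xi; rewrite ger0_norm ?sqr_ge0// /dgi.
apply: (le_trans (coord_sqr_le _ _ _)); apply: ler_wpM2l; first exact: sqr_ge0.
by apply: ler_wpM2l; rewrite ?powR_ge0// lerDl sqr_ge0.
Qed.

End weighted_pair.

Section invFT_bounds.
Context {R : realType} {n : nat}.
Local Notation mu := (@leb R n).
Implicit Types a b : 'rV[R]_n -> R.

Lemma norm_invFT_le a b x : Rsummable mu a -> Rsummable mu b ->
  `|invFT a b x| <= \int[mu]_xi (`|a xi| + `|b xi|).
Proof.
move=> Ia Ib.
rewrite (RsumD (Rsummable_norm Ia) (Rsummable_norm Ib)).
apply: (le_trans (ler_normB _ _)); apply: lerD.
  exact: norm_FTc_le.
exact: norm_FTs_le.
Qed.

Lemma measurable_invFT a b : Rsummable mu a -> Rsummable mu b ->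
  measurable_fun setT (invFT a b).
Proof.
by move=> Ia Ib; apply: measurable_funB; [exact: measurable_FTc|exact: measurable_FTs].
Qed.

(** Bessel for a and b separately; the factor 2 comes from (y - z)^2 <= 2 y^2 + 2 z^2. *)
Lemma bessel_invFT a b : Rsummable mu a -> Rsummable mu b ->
  Rsummable mu (fun x => a x ^+ 2) -> Rsummable mu (fun x => b x ^+ 2) ->
  Rsummable mu (fun x => invFT a b x ^+ 2) /\
  \int[mu]_x invFT a b x ^+ 2 <= 2 * \int[mu]_x (a x ^+ 2 + b x ^+ 2).
Proof.
move=> Ia Ib Ia2 Ib2.
have [Ja Ba] := bessel Ia Ia2; have [Jb Bb] := bessel Ib Ib2.
pose F x := 2 * (FTc a x ^+ 2 + FTs a x ^+ 2) + 2 * (FTc b x ^+ 2 + FTs b x ^+ 2).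
have IF : Rsummable mu F.
  by apply: RsummableD; [exact: RsummableZ Ja|exact: RsummableZ Jb].
have le x : invFT a b x ^+ 2 <= F x.
  rewrite /invFT /F; move: (FTc a x) (FTs a x) (FTc b x) (FTs b x) => c1 s1 c2 s2.
  have := sqr_ge0 (c1 + s2); have := sqr_ge0 s1; have := sqr_ge0 c2.
  by rewrite sqrrB sqrrD; lra.
have I : Rsummable mu (fun x => invFT a b x ^+ 2).
  apply: (le_Rsummable _ _ IF).
    by apply: measurable_funX; exact: measurable_invFT.
  by move=> x; rewrite ger0_norm ?sqr_ge0.
split => //; apply: (le_trans (ler_Rintegral I IF le)).
rewrite /F (RsumD (RsummableZ 2 Ja) (RsummableZ 2 Jb)) (RsumZ _ Ja) (RsumZ _ Jb).
by rewrite (RsumD Ia2 Ib2) mulrDr; lra.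
Qed.

End invFT_bounds.

Section row_norm.
Context {R : realType} {n : nat}.
Implicit Types h : 'rV[R]_n.

Lemma norm_coord_le h i : `|h 0 i| <= `|h|.
Proof. by rewrite [leRHS]mx_normrE; exact: (le_bigmax _ (fun ij => `|h ij.1 ij.2|) (0, i)). Qed.

Lemma norm_row_le h (e : R) : 0 <= e -> (forall i, `|h 0 i| <= e) -> `|h| <= e.
Proof.
move=> e0 he; rewrite [leLHS]mx_normrE; apply: bigmax_le => // -[i j] _ /=.
by rewrite ord1.
Qed.

End row_norm.

(** * Modulus of continuity of the derivatives and Taylor remainder *)

Section modulus.
Context {R : realType} {n : nat}.
Variable q : R.
Hypothesis hq : n%:R / 2 + 1 < q.
Local Notation mu := (@leb R n).
Variables (gr gi : 'rV[R]_n -> R).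
Hypotheses (mgr : measurable_fun setT gr) (mgi : measurable_fun setT gi).
Hypothesis Iw : Rsummable mu (wpair q gr gi).

(** A dot product of n coordinates costs a factor n; taking n.+1 gives 2 pi <= c in dimension 0 as
    well. *)
Variable c : R.
Hypothesis hc : 2 * pi * n.+1%:R <= c.

Let twopi_le_c : 2 * pi <= c.
Proof. by apply: le_trans hc; rewrite ler_peMr ?ler1n// mulr_ge0 ?pi_ge0. Qed.

Let c_ge0 : 0 <= c.
Proof. by apply: le_trans twopi_le_c; rewrite mulr_ge0 ?pi_ge0. Qed.

Let Ij := Rsummable_jap_ampl hq mgr mgi Iw.

(** Majorant of the change of a derivative's integrand over a distance [tau]: the first factor
    bounds |2 pi xi_j g|, and cos or sin changes by at most 2 and by at most the change of phase,
    itself at most [c * jap xi * tau]. *)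
Let K (tau : R) (xi : 'rV[R]_n) :=
  c * (jap xi * ampl gr gi xi) * Num.min 2 (c * jap xi * tau).

Definition omega (tau : R) := \int[mu]_xi K tau xi.

Let K_ge0 tau xi : 0 <= tau -> 0 <= K tau xi.
Proof.
move=> t0; have j0 := jap_ge0 xi; have g0 := ampl_ge0 gr gi xi.
apply: mulr_ge0; first by rewrite !mulr_ge0.
rewrite le_min ler0n /=; apply: mulr_ge0 => //; exact: mulr_ge0.
Qed.

Let K_le tau xi : K tau xi <= 2 * c * (jap xi * ampl gr gi xi).
Proof.
have j0 := jap_ge0 xi; have g0 := ampl_ge0 gr gi xi.
rewrite /K -[leRHS]mulrA [leRHS]mulrC; apply: ler_wpM2l; first by rewrite !mulr_ge0.
by rewrite ge_min lexx.
Qed.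

Let mK tau : measurable_fun setT (K tau).
Proof.
apply: measurable_funM.
  by apply: measurable_funM => //; exact: Rsummable_measurable Ij.
apply: measurable_minr => //; apply: measurable_funM => //.
by apply: measurable_funM => //; exact: measurable_jap.
Qed.

Let IK tau : 0 <= tau -> Rsummable mu (K tau).
Proof.
move=> t0; apply: (le_Rsummable (mK tau) _ (RsummableZ (2 * c) Ij)) => xi.
by rewrite ger0_norm ?K_ge0// K_le.
Qed.

(** Dominated convergence along tau = 1/(m + 1), then monotonicity of [K] in tau for the values in
    between. *)
Lemma omega_small (e : R) : 0 < e ->
  exists2 delta, 0 < delta & forall tau, 0 <= tau <= delta -> omega tau <= e.
Proof.
move=> e0.
have m0 (m : nat) : 0 <= m.+1%:R^-1 :> R by [].
have cv0 xi : K m.+1%:R^-1 xi @[m --> \oo] --> (0 : R).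
  have bd (m : nat) : K m.+1%:R^-1 xi <= c * (jap xi * ampl gr gi xi) * (c * jap xi) * harmonic m.
    rewrite /K -[leRHS]mulrA; apply: ler_wpM2l; last by rewrite ge_min lexx orbT.
    by rewrite !mulr_ge0 ?jap_ge0 ?ampl_ge0.
  have cvh : c * (jap xi * ampl gr gi xi) * (c * jap xi) * harmonic m @[m --> \oo] --> (0 : R).
    rewrite -(mulr0 (c * (jap xi * ampl gr gi xi) * (c * jap xi))).
    by apply: cvgMl_tmp; exact: cvg_harmonic.
  by apply: (squeeze_cvgr _ (cvg_cst 0) cvh); apply: nearW => m; rewrite bd K_ge0.
have [_] := @Rintegral_dominated _ _ _ mu (fun m xi => K m.+1%:R^-1 xi) (cst 0) _
  (fun m => mK _) (measurable_cst _) cv0 (RsummableZ (2 * c) Ij)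
  (fun m xi => (le_trans (eq_ind_r (fun z => z <= K m.+1%:R^-1 xi) (lexx _) (ger0_norm (K_ge0 xi (m0 m)))) (K_le _ xi))).
rewrite Rintegral_cst// mul0r => /cvgrPdist_le/(_ e e0)[m _ /(_ m (leqnn m))].
rewrite sub0r normrN => h; exists m.+1%:R^-1 => // tau /andP[t0 tm].
apply: (le_trans _ (le_trans (ler_norm _) h)).
apply: ler_Rintegral; [exact: IK|exact: IK|move=> xi].
rewrite /K; apply: ler_wpM2l; first by rewrite !mulr_ge0 ?jap_ge0 ?ampl_ge0.
rewrite le_min ge_min lexx /= ge_min; apply/orP; right.
by apply: ler_wpM2l => //; rewrite mulr_ge0 ?jap_ge0.
Qed.

Let phase_le (xi h : 'rV[R]_n) : `|2 * pi * dotp xi h| <= c * jap xi * `|h|.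
Proof.
rewrite normrM ger0_norm ?mulr_ge0 ?pi_ge0// -mulrA.
apply: (@le_trans _ _ (2 * pi * n.+1%:R * (jap xi * `|h|))); last first.
  by apply: ler_wpM2r hc; rewrite mulr_ge0 ?jap_ge0.
rewrite -[leRHS]mulrA; apply: ler_wpM2l; first by rewrite mulr_ge0 ?pi_ge0.
apply: (@le_trans _ _ (n%:R * (jap xi * `|h|))).
  rewrite /dotp (le_trans (ler_norm_sum _ _ _))//.
  have -> : n%:R * (jap xi * `|h|) = \sum_(i < n) jap xi * `|h|.
    by rewrite sumr_const card_ord mulr_natl.
  apply: ler_sum => i _; rewrite normrM.
  by rewrite ler_pM ?coord_le_jap ?norm_coord_le.
by apply: ler_wpM2r; rewrite ?mulr_ge0 ?jap_ge0// ler_nat.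
Qed.

Lemma invFTE (a b : 'rV[R]_n -> R) x : Rsummable mu a -> Rsummable mu b ->
  invFT a b x = \int[mu]_xi (a xi * cos (2 * pi * dotp xi x) - b xi * sin (2 * pi * dotp xi x)).
Proof.
by move=> Ia Ib; rewrite (RsumB (Rsummable_cos x Ia) (Rsummable_sin x Ib)).
Qed.

Lemma Rsummable_invFT (a b : 'rV[R]_n -> R) x : Rsummable mu a -> Rsummable mu b ->
  Rsummable mu (fun xi => a xi * cos (2 * pi * dotp xi x) - b xi * sin (2 * pi * dotp xi x)).
Proof. by move=> Ia Ib; exact: RsummableB (Rsummable_cos x Ia) (Rsummable_sin x Ib). Qed.

Let dotpDr (xi x h : 'rV[R]_n) : 2 * pi * dotp xi (x + h) = 2 * pi * dotp xi x + 2 * pi * dotp xi h.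
Proof. by rewrite dotpC dotpDl !(dotpC _ xi) mulrDr. Qed.

Let min2 (u b : R) : `|u| <= 2 -> `|u| <= `|b| -> `|u| <= Num.min 2 `|b|.
Proof. by move=> u2 ub; rewrite le_min u2 ub. Qed.

Let dcos2 (u v : R) : `|cos u - cos v| <= 2.
Proof.
apply: (le_trans (ler_normB _ _)).
by have := cos_max u; have := cos_max v; lra.
Qed.

Let dsin2 (u v : R) : `|sin u - sin v| <= 2.
Proof.
apply: (le_trans (ler_normB _ _)).
by have := sin_max u; have := sin_max v; lra.
Qed.

Lemma invFT_deriv_modulus (j : 'I_n) x h :
  `|invFT (dgr gi j) (dgi gr j) (x + h) - invFT (dgr gi j) (dgi gr j) x| <= omega `|h|.
Proof.
have I1 := Rsummable_dgr hq mgr mgi Iw j.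
have I2 := Rsummable_dgi hq mgr mgi Iw j.
rewrite (invFTE _ I1 I2) (invFTE x I1 I2).
rewrite -(RsumB (Rsummable_invFT _ I1 I2) (Rsummable_invFT x I1 I2)).
apply: ler_norm_Rintegral.
- exact: Rsummable_measurable (RsummableB (Rsummable_invFT _ I1 I2) (Rsummable_invFT x I1 I2)).
- exact: IK.
move=> xi; rewrite dotpDr; have := phase_le xi h.
have := dg_norm_le gr gi j xi.
move: (2 * pi * dotp xi x) (2 * pi * dotp xi h) (dgr gi j xi) (dgi gr j xi) => a b u v duv hb.
have -> : u * cos (a + b) - v * sin (a + b) - (u * cos a - v * sin a) =
  u * (cos (a + b) - cos a) - v * (sin (a + b) - sin a) by ring.
have m1 := min2 (dcos2 (a + b) a) (cos_lipschitz a b).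
have m2 := min2 (dsin2 (a + b) a) (sin_lipschitz a b).
apply: (@le_trans _ _ ((`|u| + `|v|) * Num.min 2 `|b|)).
  apply: (le_trans (ler_normB _ _)); rewrite !normrM mulrDl.
  by apply: lerD; apply: ler_wpM2l.
have j0 := jap_ge0 xi; have g0 := ampl_ge0 gr gi xi.
rewrite /K; apply: ler_pM.
- by rewrite addr_ge0.
- by rewrite le_min normr_ge0 andbT.
- by apply: (le_trans duv); apply: ler_wpM2r; rewrite ?mulr_ge0.
- by rewrite le_min ge_min lexx /= ge_min hb orbT.
Qed.

(** With b the change of phase, the first-order remainder of cos and sin is at most 2 |b| and at
    most b^2, that is |b| min(2, |b|). The factor |b| supplies both |h| and the weight [jap]; the
    minimum is that of [K]. *)
Lemma invFT_remainder x h :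
  `|invFT gr gi (x + h) - invFT gr gi x -
    \sum_j h 0 j * invFT (dgr gi j) (dgi gr j) x| <= `|h| * omega `|h|.
Proof.
have Ir := Rsummable_gr hq mgr mgi Iw.
have Ii := Rsummable_gi hq mgr mgi Iw.
have I1 := Rsummable_dgr hq mgr mgi Iw.
have I2 := Rsummable_dgi hq mgr mgi Iw.
have ID j : Rsummable mu (fun xi => h 0 j *
   (dgr gi j xi * cos (2 * pi * dotp xi x) - dgi gr j xi * sin (2 * pi * dotp xi x))).
  exact: RsummableZ (Rsummable_invFT x (I1 j) (I2 j)).
have IS := Rsummable_sum (index_enum 'I_n) ID.
have -> : \sum_j h 0 j * invFT (dgr gi j) (dgi gr j) x = \int[mu]_xi (\sum_j h 0 j *
   (dgr gi j xi * cos (2 * pi * dotp xi x) - dgi gr j xi * sin (2 * pi * dotp xi x))).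
  rewrite (Rintegral_sum (index_enum 'I_n) ID); apply: eq_bigr => j _.
  by rewrite (RsumZ _ (Rsummable_invFT x (I1 j) (I2 j))) -invFTE.
rewrite (invFTE _ Ir Ii) (invFTE x Ir Ii).
have IB := RsummableB (Rsummable_invFT (x + h) Ir Ii) (Rsummable_invFT x Ir Ii).
rewrite -(RsumB (Rsummable_invFT _ Ir Ii) (Rsummable_invFT x Ir Ii)) -(RsumB IB IS).
rewrite -(RsumZ _ (IK (normr_ge0 h))).
apply: ler_norm_Rintegral.
- exact: Rsummable_measurable (RsummableB IB IS).
- exact: RsummableZ (IK (normr_ge0 h)).
move=> xi; rewrite dotpDr.
have -> : \sum_j h 0 j * (dgr gi j xi * cos (2 * pi * dotp xi x) - dgi gr j xi * sin (2 * pi * dotp xi x))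
   = 2 * pi * dotp xi h * (- gi xi * cos (2 * pi * dotp xi x) - gr xi * sin (2 * pi * dotp xi x)).
  move: (cos (2 * pi * dotp xi x)) (sin (2 * pi * dotp xi x)) => ca sa.
  rewrite [dotp xi h]/dotp mulr_sumr mulr_suml; apply: eq_bigr => j _.
  by rewrite /dgr /dgi; ring.
have := phase_le xi h.
move: (2 * pi * dotp xi x) (2 * pi * dotp xi h) => a b hb.
have -> : gr xi * cos (a + b) - gi xi * sin (a + b) - (gr xi * cos a - gi xi * sin a) -
   b * (- gi xi * cos a - gr xi * sin a) =
   gr xi * (cos (a + b) - cos a - b * - sin a) - gi xi * (sin (a + b) - sin a - b * cos a) by ring.
have aux (u : R) : `|u| <= `|b| -> forall w, `|w| <= 1 -> `|u - b * w| <= b ^+ 2 ->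
   `|u - b * w| <= `|b| * Num.min 2 `|b|.
  move=> ub w w1 h2; rewrite minr_pMr// le_min; apply/andP; split.
    apply: (le_trans (ler_normB _ _)); rewrite normrM.
    have : `|b| * `|w| <= `|b| by rewrite ler_piMr.
    by move: ub; lra.
  by apply: (le_trans h2); rewrite -[leRHS]expr2 -normrX ger0_norm ?sqr_ge0.
have m1 := aux _ (cos_lipschitz a b) (- sin a) _ (cos_taylor a b).
have m2 := aux _ (sin_lipschitz a b) (cos a) (cos_max a) (sin_taylor a b).
have {}m1 : `|cos (a + b) - cos a - b * - sin a| <= `|b| * Num.min 2 `|b|.
  by apply: m1; rewrite normrN sin_max.
apply: (@le_trans _ _ (ampl gr gi xi * (`|b| * Num.min 2 `|b|))).
  apply: (le_trans (ler_normB _ _)); rewrite !normrM mulrDl.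
  by apply: lerD; apply: ler_wpM2l.
have j0 := jap_ge0 xi; have g0 := ampl_ge0 gr gi xi.
rewrite /K.
have -> : `|h| * (c * (jap xi * ampl gr gi xi) * Num.min 2 (c * jap xi * `|h|)) =
  ampl gr gi xi * ((c * jap xi * `|h|) * Num.min 2 (c * jap xi * `|h|)) by ring.
apply: ler_wpM2l => //; apply: ler_pM => //.
by rewrite le_min ge_min lexx /= ge_min hb orbT.
Qed.

End modulus.

(** * The H^q norm *)

Section definitions_as_integrals.
Context {R : realType} {n : nat}.
Local Notation mu := (@leb R n).
Implicit Types u v gr gi kr ki : 'rV[R]_n -> R.

Lemma IintE u : Rsummable mu u -> Iint u = \int[mu]_x u x.
Proof.
move=> Iu; have mu_ := Rsummable_measurable Iu.
have mp : measurable_fun setT (fun x => Num.max (u x) 0) by exact: measurable_maxr.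
have mm : measurable_fun setT (fun x => Num.max (- u x) 0).
  by apply: measurable_maxr => //; exact: measurable_funN.
have Ip : Rsummable mu (fun x => Num.max (u x) 0).
  apply: (le_Rsummable mp _ (Rsummable_norm Iu)) => x.
  by rewrite ger0_norm ?le_max ?lexx ?orbT// ge_max ler_norm normr_ge0.
have Im : Rsummable mu (fun x => Num.max (- u x) 0).
  apply: (le_Rsummable mm _ (Rsummable_norm Iu)) => x.
  by rewrite ger0_norm ?le_max ?lexx ?orbT// ge_max normr_ge0 andbT -normrN ler_norm.
have -> : \int[mu]_x u x = \int[mu]_x (Num.max (u x) 0 - Num.max (- u x) 0).
  apply: eq_Rintegral => x _.
  by case: (lerP (u x) 0) => h; case: (lerP (- u x) 0) => h'; lra.
rewrite (RsumB Ip Im) /Iint.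
rewrite !iint_lebE; last 4 first.
- exact/measurable_EFinP.
- by move=> x; rewrite lee_fin le_max lexx orbT.
- exact/measurable_EFinP.
- by move=> x; rewrite lee_fin le_max lexx orbT.
by rewrite -(RintegralE Ip) -(RintegralE Im).
Qed.

Lemma L2P u : L2 u <-> measurable_fun setT u /\ Rsummable mu (fun x => u x ^+ 2).
Proof.
have E : measurable_fun setT u -> measurable_fun setT (fun x => u x ^+ 2) /\
    iint (fun x => (u x ^+ 2)%:E) = (\int[mu]_x (u x ^+ 2)%:E)%E.
  move=> mu_; have m2 : measurable_fun setT (fun x => u x ^+ 2) by exact: measurable_funX.
  split => //; apply: iint_lebE; first exact/measurable_EFinP.
  by move=> x; rewrite lee_fin sqr_ge0.
have s0 x : 0 <= u x ^+ 2 by exact: sqr_ge0.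
rewrite /L2; split=> -[mu_ Iu].
  move/rv_measurableE in mu_; have [m2 E2] := E mu_; split => //.
  by apply/ge0_RsummableP => //; rewrite -E2.
have [m2 E2] := E mu_; split; first exact/rv_measurableE.
by rewrite E2; exact/(ge0_RsummableP mu m2).
Qed.

Lemma FT_reE u (N : nat) xi : L2 u -> FT_re u N xi = FTc (trunc u N) xi.
Proof.
move=> /L2P[mu_ Iu2]; rewrite /FT_re /FTc -IintE; last first.
  exact: Rsummable_cos (Rsummable_trunc N mu_ Iu2).
congr Iint; apply/funext => x; rewrite /trunc; case: ifP => // _.
by rewrite mul0r.
Qed.

Lemma FT_imE u (N : nat) xi : L2 u -> FT_im u N xi = - FTs (trunc u N) xi.
Proof.
move=> /L2P[mu_ Iu2]; rewrite /FT_im /FTs -IintE; last first.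
  exact: Rsummable_sin (Rsummable_trunc N mu_ Iu2).
congr (- Iint _); apply/funext => x; rewrite /trunc; case: ifP => // _.
by rewrite mul0r.
Qed.

(** The integrand in [is_FT]; the plus sign in the second square is that of [FT_im] = - [FTs]. *)
Definition FTdist u (N : nat) gr gi xi :=
  (gr xi - FTc (trunc u N) xi) ^+ 2 + (gi xi + FTs (trunc u N) xi) ^+ 2.

Lemma FTdist_ge0 u N gr gi xi : 0 <= FTdist u N gr gi xi.
Proof. by rewrite addr_ge0 ?sqr_ge0. Qed.

Lemma measurable_FTdist u N gr gi : L2 u -> measurable_fun setT gr ->
  measurable_fun setT gi -> measurable_fun setT (FTdist u N gr gi).
Proof.
move=> /L2P[mu_ Iu2] mr mi; have It := Rsummable_trunc N mu_ Iu2.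
apply: measurable_funD; apply: measurable_funX.
  by apply: measurable_funB => //; exact: measurable_FTc.
by apply: measurable_funD => //; exact: measurable_FTs.
Qed.

Lemma is_FTP u gr gi : L2 u -> is_FT u gr gi <->
  [/\ measurable_fun setT gr, measurable_fun setT gi &
   forall e : R, 0 < e ->
   \forall N \near \oo, (\int[mu]_xi (FTdist u N gr gi xi)%:E < e%:E)%E].
Proof.
move=> Lu.
have E N : measurable_fun setT gr -> measurable_fun setT gi ->
    iint (fun xi => ((gr xi - FT_re u N xi) ^+ 2 + (gi xi - FT_im u N xi) ^+ 2)%:E) =
    (\int[mu]_xi (FTdist u N gr gi xi)%:E)%E.
  move=> mr mi.
  have -> : (fun xi => ((gr xi - FT_re u N xi) ^+ 2 + (gi xi - FT_im u N xi) ^+ 2)%:E) =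
      (fun xi => (FTdist u N gr gi xi)%:E).
    by apply/funext => xi; rewrite FT_reE// FT_imE// opprK.
  rewrite iint_lebE//.
    by apply/measurable_EFinP; exact: measurable_FTdist.
  by move=> xi; rewrite lee_fin FTdist_ge0.
have ge0 N : (0 <= \int[mu]_xi (FTdist u N gr gi xi)%:E)%E.
  by apply: integral_ge0 => xi _; rewrite lee_fin FTdist_ge0.
split.
  move=> [/rv_measurableE mr [/rv_measurableE mi]]; under eq_fun do rewrite E//.
  by move/(cvge0P ge0).
move=> [mr mi h]; split; first exact/rv_measurableE.
split; first exact/rv_measurableE.
by under eq_fun do rewrite E//; exact/(cvge0P ge0).
Qed.

Lemma L2B u v : L2 u -> L2 v -> L2 (u \- v).
Proof.
move=> /L2P[mu_ Iu] /L2P[mv Iv]; apply/L2P; split; first exact: measurable_funB.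
have I := RsummableD (RsummableZ 2 Iu) (RsummableZ 2 Iv).
apply: (le_Rsummable _ _ I).
  by apply: measurable_funX; exact: measurable_funB.
move=> x /=; rewrite ger0_norm ?sqr_ge0//.
by have := sqr_ge0 (u x + v x); rewrite sqrrB sqrrD; lra.
Qed.

Lemma truncB u v N : trunc (u \- v) N = (fun x => trunc u N x - trunc v N x).
Proof. by apply/funext => x; rewrite /trunc; case: ifP => //; rewrite subrr. Qed.

Lemma FTcB u v : Rsummable mu u -> Rsummable mu v ->
  FTc (fun x => u x - v x) = (fun x => FTc u x - FTc v x).
Proof.
move=> Iu Iv; apply/funext => xi.
rewrite /FTc -(RsumB (Rsummable_cos xi Iu) (Rsummable_cos xi Iv)).
by apply: eq_Rintegral => x _; rewrite mulrBl.
Qed.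

Lemma FTsB u v : Rsummable mu u -> Rsummable mu v ->
  FTs (fun x => u x - v x) = (fun x => FTs u x - FTs v x).
Proof.
move=> Iu Iv; apply/funext => xi.
rewrite /FTs -(RsumB (Rsummable_sin xi Iu) (Rsummable_sin xi Iv)).
by apply: eq_Rintegral => x _; rewrite mulrBl.
Qed.

Lemma invFTB gr gi kr ki x : Rsummable mu gr -> Rsummable mu gi ->
  Rsummable mu kr -> Rsummable mu ki ->
  invFT (gr \- kr) (gi \- ki) x = invFT gr gi x - invFT kr ki x.
Proof.
by move=> I1 I2 I3 I4; rewrite /invFT FTcB// FTsB//; ring.
Qed.

Lemma ge0_integral_le2 (f g h : 'rV[R]_n -> R) (a b e1 e2 : R) :
  0 <= a -> 0 <= b ->
  measurable_fun setT f -> measurable_fun setT g -> measurable_fun setT h ->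
  (forall x, 0 <= f x) -> (forall x, 0 <= g x) -> (forall x, 0 <= h x) ->
  (forall x, f x <= a * g x + b * h x) ->
  (\int[mu]_x (g x)%:E < e1%:E)%E -> (\int[mu]_x (h x)%:E < e2%:E)%E ->
  Rsummable mu f /\ \int[mu]_x f x <= a * e1 + b * e2.
Proof.
move=> a0 b0 mf mg mh f0 g0 h0 le ge he.
have Ig : Rsummable mu g by apply/ge0_RsummableP => //; rewrite (lt_trans ge)// ltry.
have Ih : Rsummable mu h by apply/ge0_RsummableP => //; rewrite (lt_trans he)// ltry.
have I := RsummableD (RsummableZ a Ig) (RsummableZ b Ih).
have If : Rsummable mu f.
  by apply: (le_Rsummable mf _ I) => x; rewrite ger0_norm.
split => //; apply: (le_trans (ler_Rintegral If I le)).
rewrite (RsumD (RsummableZ a Ig) (RsummableZ b Ih)) (RsumZ _ Ig) (RsumZ _ Ih).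
rewrite -(RintegralE Ig) lte_fin in ge; rewrite -(RintegralE Ih) lte_fin in he.
by apply: lerD; apply: ler_wpM2l => //; exact: ltW.
Qed.

Lemma is_FTB u v gr gi kr ki : L2 u -> L2 v -> is_FT u gr gi -> is_FT v kr ki ->
  is_FT (u \- v) (gr \- kr) (gi \- ki).
Proof.
move=> Lu Lv; have LB := L2B Lu Lv.
move=> /(is_FTP _ _ Lu)[mgr mgi hu] /(is_FTP _ _ Lv)[mkr mki hv].
apply/(is_FTP _ _ LB); split; [exact: measurable_funB|exact: measurable_funB|].
(* The two squared distances each enter with a factor 2, for a total of e/2. *)
move=> e e0; have e8 : 0 < e / 8 by rewrite divr_gt0.
apply: filterS2 (hu _ e8) (hv _ e8) => N uN vN.
have mB : measurable_fun setT (FTdist (u \- v) N (gr \- kr) (gi \- ki)).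
  by apply: measurable_FTdist => //; exact: measurable_funB.
have [| | |I le] := @ge0_integral_le2 _ _ _ 2 2 _ _ _ _ mB
  (measurable_FTdist N Lu mgr mgi) (measurable_FTdist N Lv mkr mki)
  (FTdist_ge0 _ _ _ _) (FTdist_ge0 _ _ _ _) (FTdist_ge0 _ _ _ _) _ uN vN => //.
  move=> xi; have /L2P[mu_ Iu] := Lu; have /L2P[mv Iv] := Lv.
  have Iu' := Rsummable_trunc N mu_ Iu; have Iv' := Rsummable_trunc N mv Iv.
  rewrite /FTdist truncB FTcB// FTsB//=.
  move: (gr xi) (kr xi) (gi xi) (ki xi) (FTc _ _) (FTc _ _) (FTs _ _) (FTs _ _) => a b c d p p' s s'.
  have := sqr_ge0 ((a - p) + (b - p')); have := sqr_ge0 ((c + s) + (d + s')).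
  by nra.
by rewrite -RintegralE// lte_fin; lra.
Qed.

(** Both pairs are close in L^2 to the transform of one and the same truncation, so their squared
    distance has integral at most any e > 0. *)
Lemma is_FT_ae_unique u gr gi kr ki : L2 u -> is_FT u gr gi -> is_FT u kr ki ->
  {ae mu, forall xi, gr xi = kr xi /\ gi xi = ki xi}.
Proof.
move=> Lu /(is_FTP _ _ Lu)[mgr mgi hg] /(is_FTP _ _ Lu)[mkr mki hk].
pose f xi := (gr xi - kr xi) ^+ 2 + (gi xi - ki xi) ^+ 2.
have f0 xi : 0 <= f xi by rewrite addr_ge0 ?sqr_ge0.
have mf : measurable_fun setT f.
  by apply: measurable_funD; apply: measurable_funX; exact: measurable_funB.
have If0 : (\int[mu]_xi (f xi)%:E = 0)%E.
  apply/eqP; rewrite eq_le; apply/andP; split; last first.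
    by apply: integral_ge0 => xi _; rewrite lee_fin.
  apply/lee_addgt0Pr => e e0; rewrite add0e.
  have e4 : 0 < e / 4 by rewrite divr_gt0.
  have [N _ /(_ N (leqnn N))[gN kN]] := filterI (hg _ e4) (hk _ e4).
  have [| | |I le] := @ge0_integral_le2 f _ _ 2 2 _ _ _ _ mf
    (measurable_FTdist N Lu mgr mgi) (measurable_FTdist N Lu mkr mki)
    f0 (FTdist_ge0 _ _ _ _) (FTdist_ge0 _ _ _ _) _ gN kN => //.
    move=> xi; rewrite /FTdist /f.
    move: (gr xi) (kr xi) (gi xi) (ki xi) (FTc _ _) (FTs _ _) => a b c d p s.
    have := sqr_ge0 ((a - p) + (b - p)); have := sqr_ge0 ((c + s) + (d + s)).
    by nra.
  by rewrite -RintegralE// lee_fin; lra.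
have mF : measurable_fun setT (EFin \o f) by exact/measurable_EFinP.
have /(ae_eq_integral_abs mu measurableT mF) : (\int[mu]_xi `|(EFin \o f) xi| = 0)%E.
  by rewrite -[RHS]If0; apply: eq_integral => xi _; rewrite /= ger0_norm.
apply: filterS => xi /(_ I) /= -[] /eqP.
rewrite paddr_eq0 ?sqr_ge0// !sqrf_eq0 !subr_eq0 => /andP[/eqP -> /eqP ->].
by split.
Qed.

Lemma is_FT_measurable u gr gi : is_FT u gr gi ->
  measurable_fun setT gr /\ measurable_fun setT gi.
Proof. by move=> [/rv_measurableE mr [/rv_measurableE mi _]]. Qed.

End definitions_as_integrals.

(** * The H^q norm computed on representatives *)

Section sobolev_norm.
Context {R : realType} {n : nat}.
Variable q : R.
Local Notation mu := (@leb R n).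
Implicit Types (u v : 'rV[R]_n -> 'rV[R]_n) (gr gi kr ki : 'I_n -> 'rV[R]_n -> R).

Definition mpairs gr gi :=
  forall i, measurable_fun setT (gr i) /\ measurable_fun setT (gi i).

Definition wsummable gr gi := forall i, Rsummable mu (wpair q (gr i) (gi i)).

Definition wnorm2 gr gi := \sum_(i < n) \int[mu]_x wpair q (gr i) (gi i) x.

Lemma wpair_ge0 (a b : 'rV[R]_n -> R) x : 0 <= wpair q a b x.
Proof. by rewrite mulr_ge0 ?powR_ge0// addr_ge0 ?sqr_ge0. Qed.

Lemma measurable_wpair (a b : 'rV[R]_n -> R) : measurable_fun setT a ->
  measurable_fun setT b -> measurable_fun setT (wpair q a b).
Proof.
move=> ma mb; apply: measurable_funM; first exact: measurable_powR_base.
by apply: measurable_funD; exact: measurable_funX.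
Qed.

Lemma wnorm2_ge0 gr gi : 0 <= wnorm2 gr gi.
Proof. by apply: sumr_ge0 => i _; apply: Rintegral_ge0 => x _; exact: wpair_ge0. Qed.

Let sumw gr gi x := \sum_(i < n) wpair q (gr i) (gi i) x.

Let sumw_ge0 gr gi x : 0 <= sumw gr gi x.
Proof. by apply: sumr_ge0 => i _; exact: wpair_ge0. Qed.

Let msumw gr gi : mpairs gr gi -> measurable_fun setT (sumw gr gi).
Proof.
by move=> m; apply: measurable_sum => i; have [? ?] := m i; exact: measurable_wpair.
Qed.

Lemma Hq_weightedE gr gi : mpairs gr gi ->
  Hq_weighted q gr gi = (\int[mu]_x (\sum_(i < n) wpair q (gr i) (gi i) x)%:E)%E.
Proof.
move=> m; rewrite -iint_lebE.
- by congr iint; apply/funext => x; rewrite mulr_sumr.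
- by apply/measurable_EFinP; exact: msumw.
- by move=> x; rewrite lee_fin sumw_ge0.
Qed.

Lemma Hq_weighted_lty gr gi : mpairs gr gi ->
  (Hq_weighted q gr gi < +oo)%E <-> wsummable gr gi.
Proof.
move=> m; rewrite Hq_weightedE//; split.
  move=> /(ge0_RsummableP mu (msumw m) (sumw_ge0 _ _)) I i; have [? ?] := m i.
  apply: (le_Rsummable _ _ I); first exact: measurable_wpair.
  move=> x; rewrite ger0_norm ?wpair_ge0// /sumw (bigD1 i)//= lerDl.
  by apply: sumr_ge0 => j _; exact: wpair_ge0.
by move=> I; apply/(ge0_RsummableP mu (msumw m) (sumw_ge0 _ _)); exact: Rsummable_sum.
Qed.

Lemma Hq_weighted_wnorm2 gr gi : mpairs gr gi -> wsummable gr gi ->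
  Hq_weighted q gr gi = (wnorm2 gr gi)%:E.
Proof.
by move=> m I; rewrite Hq_weightedE// -RintegralE ?Rintegral_sum//; exact: Rsummable_sum.
Qed.

Definition Hrep u gr gi := [/\ forall i, L2 (Defs.comp u i),
  forall i, is_FT (Defs.comp u i) (gr i) (gi i) & wsummable gr gi].

Lemma Hrep_measurable u gr gi : Hrep u gr gi -> mpairs gr gi.
Proof. by move=> [_ hf _] i; exact: is_FT_measurable (hf i). Qed.

Lemma in_HqP u : in_Hq q u <-> exists gr gi, Hrep u gr gi.
Proof.
split=> [[L [gr [gi [hf lt]]]]|[gr [gi H]]].
  exists gr, gi; split => //; apply/Hq_weighted_lty => // i; exact: is_FT_measurable (hf i).
have m := Hrep_measurable H; case: H => L hf I; split => //.
by exists gr, gi; split => //; exact/Hq_weighted_lty.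
Qed.

(** Transforms are unique almost everywhere, so the infimum is taken over a single value. *)
Lemma Hq_sqnormE u gr gi : Hrep u gr gi -> Hq_sqnorm q u = (wnorm2 gr gi)%:E.
Proof.
move=> H; have m := Hrep_measurable H; case: H => L hf I.
rewrite /Hq_sqnorm; set A := [set v | _].
suff -> : A = [set (wnorm2 gr gi)%:E] by exact: ereal_inf1.
apply/seteqP; split => [_ [kr [ki [hk ->]]]|_ ->]; last first.
  by exists gr, gi; split => //; rewrite Hq_weighted_wnorm2.
have mk : mpairs kr ki by move=> i; exact: is_FT_measurable (hk i).
rewrite /= -Hq_weighted_wnorm2// !Hq_weightedE//.
apply: ge0_ae_eq_integral => //.
- by apply/measurable_EFinP; exact: msumw.
- by apply/measurable_EFinP; exact: msumw.
- by move=> x _; rewrite lee_fin sumw_ge0.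
- by move=> x _; rewrite lee_fin sumw_ge0.
have : {ae mu, forall x, forall i, kr i x = gr i x /\ ki i x = gi i x}.
  by apply: filter_forall => i; exact: (is_FT_ae_unique (L i) (hk i) (hf i)).
apply: filterS => x h _; congr EFin; apply: eq_bigr => i _.
by rewrite /wpair; have [-> ->] := h i.
Qed.

Lemma Hq_normE u gr gi : Hrep u gr gi -> Hq_norm q u = Num.sqrt (wnorm2 gr gi).
Proof. by move=> H; rewrite /Hq_norm (Hq_sqnormE H). Qed.

Definition pairB gr kr i := gr i \- kr i.

(** The gap between the two sides is a weighted sum of squares of the form (t y + z)^2 / t. Keeping
    t free allows it to be optimised after integration. *)
Lemma wpairB_le (a b c d : 'rV[R]_n -> R) (t : R) x : 0 < t ->
  wpair q (a \- c) (b \- d) x <= (1 + t) * wpair q a b x + (1 + t^-1) * wpair q c d x.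
Proof.
move=> t0; rewrite /wpair /=; move: (powR_ge0 (1 + sqn x) q) => w0.
have sq (y z : R) : (y - z) ^+ 2 <= (1 + t) * y ^+ 2 + (1 + t^-1) * z ^+ 2.
  rewrite -subr_ge0.
  have -> : (1 + t) * y ^+ 2 + (1 + t^-1) * z ^+ 2 - (y - z) ^+ 2 = t^-1 * (t * y + z) ^+ 2.
    by field; rewrite gt_eqF.
  by rewrite mulr_ge0 ?sqr_ge0// invr_ge0 ltW.
rewrite [leRHS](_ : _ = (1 + sqn x) `^ q *
  (((1 + t) * a x ^+ 2 + (1 + t^-1) * c x ^+ 2) + ((1 + t) * b x ^+ 2 + (1 + t^-1) * d x ^+ 2))); last by ring.
by apply: ler_wpM2l => //; apply: lerD; exact: sq.
Qed.

Lemma wsummableB gr gi kr ki : mpairs gr gi -> mpairs kr ki ->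
  wsummable gr gi -> wsummable kr ki -> wsummable (pairB gr kr) (pairB gi ki).
Proof.
move=> mg mk Ig Ik i; have [? ?] := mg i; have [? ?] := mk i.
apply: (le_Rsummable _ _ (RsummableD (RsummableZ (1 + 1) (Ig i)) (RsummableZ (1 + 1^-1) (Ik i)))).
  by apply: measurable_wpair; exact: measurable_funB.
by move=> x; rewrite ger0_norm ?wpair_ge0//; exact: wpairB_le.
Qed.

Lemma wnorm2B_le gr gi kr ki (t : R) : 0 < t -> mpairs gr gi -> mpairs kr ki ->
  wsummable gr gi -> wsummable kr ki ->
  wnorm2 (pairB gr kr) (pairB gi ki) <= (1 + t) * wnorm2 gr gi + (1 + t^-1) * wnorm2 kr ki.
Proof.
move=> t0 mg mk Ig Ik; rewrite /wnorm2 !mulr_sumr -big_split /=; apply: ler_sum => i _.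
have I1 := RsummableZ (1 + t) (Ig i); have I2 := RsummableZ (1 + t^-1) (Ik i).
rewrite -(RsumZ _ (Ig i)) -(RsumZ _ (Ik i)) -(RsumD I1 I2).
apply: (ler_Rintegral (wsummableB mg mk Ig Ik i) (RsummableD I1 I2)) => x.
exact: wpairB_le.
Qed.

Lemma HrepB u v gr gi kr ki : Hrep u gr gi -> Hrep v kr ki ->
  Hrep (u \- v) (pairB gr kr) (pairB gi ki).
Proof.
move=> Hu Hv; have mg := Hrep_measurable Hu; have mk := Hrep_measurable Hv.
case: Hu => Lu Fu Iu; case: Hv => Lv Fv Iv.
have E i : Defs.comp (u \- v) i = Defs.comp u i \- Defs.comp v i.
  by apply/funext => x; rewrite /Defs.comp/= !mxE.
split.
- by move=> i; rewrite E; exact: L2B.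
- by move=> i; rewrite E; exact: is_FTB.
- exact: wsummableB.
Qed.

(** At t = sqrt b / sqrt a the right-hand side of the hypothesis is (sqrt a + sqrt b)^2: this turns
    the inequalities in t into a triangle inequality. *)
Lemma sqrt_le_add (a b c : R) : 0 <= a -> 0 <= b ->
  (forall t, 0 < t -> c <= (1 + t) * a + (1 + t^-1) * b) ->
  Num.sqrt c <= Num.sqrt a + Num.sqrt b.
Proof.
move=> a0 b0 h; apply/ler_addgt0Pr => e e0.
(* The shift by e/2 makes the quotient y / x meaningful and positive when a or b is 0. *)
pose x := Num.sqrt a + e / 2; pose y := Num.sqrt b + e / 2.
have x0 : 0 < x by rewrite ltr_wpDl ?sqrtr_ge0// divr_gt0.
have y0 : 0 < y by rewrite ltr_wpDl ?sqrtr_ge0// divr_gt0.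
have ax : a <= x ^+ 2.
  rewrite -[leLHS](sqr_sqrtr a0) lerXn2r ?nnegrE ?sqrtr_ge0 ?(ltW x0)//.
  by rewrite lerDl divr_ge0// ltW.
have bx : b <= y ^+ 2.
  rewrite -[leLHS](sqr_sqrtr b0) lerXn2r ?nnegrE ?sqrtr_ge0 ?(ltW y0)//.
  by rewrite lerDl divr_ge0// ltW.
have -> : Num.sqrt a + Num.sqrt b + e = x + y by rewrite /x /y; lra.
have xy0 : 0 <= x + y by rewrite addr_ge0 ?ltW.
rewrite -[leRHS](ger0_norm xy0) -sqrtr_sqr; apply: ler_wsqrtr.
have t0 : 0 < y / x by rewrite divr_gt0.
apply: (le_trans (h _ t0)).
apply: (@le_trans _ _ ((1 + y / x) * x ^+ 2 + (1 + (y / x)^-1) * y ^+ 2)).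
  apply: lerD; apply: ler_wpM2l => //; first by rewrite addr_ge0// ltW.
  by rewrite addr_ge0// invr_ge0 ltW.
have -> // : (1 + y / x) * x ^+ 2 + (1 + (y / x)^-1) * y ^+ 2 = (x + y) ^+ 2.
by field; rewrite !gt_eqF.
Qed.

Lemma wnormB_le gr gi kr ki : mpairs gr gi -> mpairs kr ki ->
  wsummable gr gi -> wsummable kr ki ->
  Num.sqrt (wnorm2 (pairB gr kr) (pairB gi ki)) <=
  Num.sqrt (wnorm2 gr gi) + Num.sqrt (wnorm2 kr ki).
Proof.
move=> mg mk Ig Ik; apply: sqrt_le_add; [exact: wnorm2_ge0|exact: wnorm2_ge0|].
by move=> t t0; exact: wnorm2B_le.
Qed.

Lemma wnorm2_sym gr gi kr ki :
  wnorm2 (pairB gr kr) (pairB gi ki) = wnorm2 (pairB kr gr) (pairB ki gi).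
Proof.
apply: eq_bigr => i _; apply: eq_Rintegral => x _; rewrite /wpair /pairB /=.
by congr (_ * (_ + _)); rewrite -sqrrN opprB.
Qed.

End sobolev_norm.

(** * The jacobian *)

Section determinant_bounds.
Context {R : realType}.

(** Telescoping: one factor is replaced at a time while the others are bounded by K, and 1 <= K
    allows every power to be rounded up to K^n. *)
Lemma prod_dist_le n (a b : 'I_n -> R) (K e : R) : 1 <= K -> 0 <= e ->
  (forall i, `|a i| <= K) -> (forall i, `|b i| <= K) ->
  (forall i, `|a i - b i| <= e) ->
  `|\prod_i a i - \prod_i b i| <= n%:R * K ^+ n * e.
Proof.
move=> K1 e0; have K0 : 0 <= K by apply: le_trans K1.
elim: n a b => [|n ih] a b aK bK abe; first by rewrite !big_ord0 subrr normr0 !mul0r.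
rewrite !big_ord_recl /=.
set p := \prod_(i < n) _; set p' := \prod_(i < n) _.
have pK : `|p| <= K ^+ n.
  rewrite /p normr_prod -[in leRHS](card_ord n) -prodr_const.
  by apply: ler_prod => i _; rewrite normr_ge0 aK.
have -> : a ord0 * p - b ord0 * p' = (a ord0 - b ord0) * p + b ord0 * (p - p') by ring.
apply: (le_trans (ler_normD _ _)); rewrite !normrM.
have -> : n.+1%:R * K ^+ n.+1 * e = e * K ^+ n.+1 + K * (n%:R * K ^+ n * e).
  by rewrite -natr1 exprS; ring.
apply: lerD; apply: ler_pM => //.
  by apply: (le_trans pK); rewrite ler_weXn2l.
by apply: ih => i.
Qed.

Lemma det_dist_le n (A B : 'M[R]_n) (K e : R) : 1 <= K -> 0 <= e ->
  (forall i j, `|A i j| <= K) -> (forall i j, `|B i j| <= K) ->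
  (forall i j, `|A i j - B i j| <= e) ->
  `|\det A - \det B| <= (n`! * n)%:R * K ^+ n * e.
Proof.
move=> K1 e0 AK BK ABe; rewrite /determinant -sumrB.
apply: (le_trans (ler_norm_sum _ _ _)).
have -> : (n`! * n)%:R * K ^+ n * e = \sum_(s : 'S_n) n%:R * K ^+ n * e.
  by rewrite sumr_const card_Sn natrM -[RHS]mulr_natl -!mulrA.
apply: ler_sum => s _; rewrite -mulrBr normrM normrX normrN1 expr1n mul1r.
exact: prod_dist_le.
Qed.

End determinant_bounds.

Section differential.
Context {R : realType} {n : nat}.
Variable q : R.
Hypothesis hq : n%:R / 2 + 1 < q.
Local Notation mu := (@leb R n).
Implicit Types gr gi : 'I_n -> 'rV[R]_n -> R.

Definition invFTrow gr gi (x : 'rV[R]_n) : 'rV[R]_n := \row_i invFT (gr i) (gi i) x.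

(** Entry (j, i) is the j-th partial derivative of the i-th component: the transposed Jacobian
    matrix, as row vectors are multiplied on the right. *)
Definition dinvFT gr gi (x : 'rV[R]_n) : 'M[R]_n :=
  \matrix_(j, i) invFT (dgr (gi i) j) (dgi (gr i) j) x.

Let c : R := 2 * pi * n.+1%:R.

Lemma near_row_dist_le (x : 'rV[R]_n) (e : R) : 0 < e -> \forall y \near x, `|x - y| <= e.
Proof. by move=> e0; exact: (@cvgr_dist_le R 'rV[R]_n _ _ (nbhs_filter x) id x cvg_id e e0). Qed.

Lemma continuous_mulmxr (A : 'M[R]_n) : continuous (mulmxr A : 'rV[R]_n -> 'rV[R]_n).
Proof.
pose K := \sum_i \sum_j `|A i j|.
have K0 : 0 <= K by apply: sumr_ge0 => i _; apply: sumr_ge0.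
have bd (h : 'rV[R]_n) : `|h *m A| <= K * `|h|.
  apply: norm_row_le => [|j]; first by rewrite mulr_ge0.
  rewrite mxE (le_trans (ler_norm_sum _ _ _))// /K mulr_suml; apply: ler_sum => i _.
  rewrite normrM mulrC; apply: ler_pM => //; last exact: norm_coord_le.
  by rewrite (bigD1 j)//= lerDl sumr_ge0.
move=> x; apply/(@cvgrPdist_le R _ _ _ (nbhs_filter x)) => e e0.
have K1 : 0 < K + 1 by rewrite ltr_wpDl.
have : \forall y \near x, `|x - y| <= (K + 1)^-1 * e.
  by apply: near_row_dist_le; rewrite mulr_gt0// invr_gt0.
apply: filterS => y xy; rewrite /= -mulmxBl (le_trans (bd _))//.
apply: (@le_trans _ _ ((K + 1) * `|x - y|)); last by rewrite -ler_pdivlMl.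
by apply: ler_wpM2r => //; rewrite lerDl.
Qed.

Variables gr gi : 'I_n -> 'rV[R]_n -> R.
Hypotheses (mg : mpairs gr gi) (Iw : wsummable q gr gi).

Let mgr i : measurable_fun setT (gr i). Proof. by have [] := mg i. Qed.
Let mgi i : measurable_fun setT (gi i). Proof. by have [] := mg i. Qed.

Let F x := x + invFTrow gr gi x.

Let F_expansion x : F \o shift x = cst (F x) + mulmxr (1%:M + dinvFT gr gi x) +o_ (0 : 'rV[R]_n) id.
Proof.
apply/eqaddoP => e e0.
have om i : \forall h \near (0 : 'rV[R]_n), omega (gr i) (gi i) c `|h| <= e.
  have [delta d0 hd] := omega_small hq (mgr i) (mgi i) (Iw i) (lexx c) e0.
  have : \forall h \near (0 : 'rV[R]_n), `|0 - h| <= delta.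
    exact: near_row_dist_le.
  by apply: filterS => h; rewrite sub0r normrN => h_le; apply: hd; rewrite normr_ge0.
have := @filter_forall _ _ _ _ (nbhs_filter (0 : 'rV[R]_n)) om; apply: filterS => h om_h.
rewrite (_ : (_ - _) h = F (h + x) - (F x + h *m (1%:M + dinvFT gr gi x)))//.
apply: norm_row_le => [|i]; first by rewrite mulr_ge0// ltW.
have := invFT_remainder hq (mgr i) (mgi i) (Iw i) (lexx c) x h.
move=> /le_trans/(_ (ler_wpM2l (normr_ge0 h) (om_h i))); rewrite [e * _]mulrC.
apply: le_trans; rewrite le_eqVlt; apply/orP; left; apply/eqP; congr (`|_|).
rewrite /F /= mulmxDr mulmx1 !mxE [h + x]addrC.
have -> : \sum_(j < n) h ord0 j * dinvFT gr gi x j i =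
          \sum_(j < n) h 0 j * invFT (dgr (gi i) j) (dgi (gr i) j) x.
  by apply: eq_bigr => j _; rewrite mxE.
by ring.
Qed.

Lemma diff_id_invFT x : 'd F x = mulmxr (1%:M + dinvFT gr gi x) :> ('rV[R]_n -> 'rV[R]_n).
Proof. by apply: diff_unique; [exact: continuous_mulmxr|exact: F_expansion]. Qed.

Lemma differentiable_id_invFT x : differentiable F x.
Proof.
apply/diff_locallyP; rewrite diff_id_invFT.
by split; [exact: continuous_mulmxr|exact: F_expansion].
Qed.

Lemma jac_det_invFT x : jac_det F x = \det (1%:M + dinvFT gr gi x).
Proof.
rewrite /jac_det; congr (\det _); apply/row_matrixP => i.
by rewrite !rowE mul_rV_lin1 diff_id_invFT.
Qed.

End differential.

(** * Decay at infinity of uniformly continuous L^2 functions *)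

Section decay.
Context {R : realType} {n : nat}.
Local Notation mu := (@leb R n).
Implicit Types (g : 'rV[R]_n -> R) (x y z : 'rV[R]_n).

Lemma sqr_norm_le_sqn z : `|z| ^+ 2 <= sqn z.
Proof.
have s0 := sqn_ge0 z.
suff : `|z| <= Num.sqrt (sqn z).
  by move=> h; rewrite -[leRHS](sqr_sqrtr s0) lerXn2r ?nnegrE ?sqrtr_ge0.
apply: norm_row_le; first exact: sqrtr_ge0.
move=> i; rewrite -sqrtr_sqr; apply: ler_wsqrtr.
by rewrite /sqn (bigD1 i)//= lerDl; apply: sumr_ge0 => j _; exact: sqr_ge0.
Qed.

Lemma gaussd_le_inv (a : R) z : gaussd a z <= (1 + pi * a ^+ 2 * sqn z)^-1.
Proof.
have t0 : 0 <= pi * a ^+ 2 * sqn z by apply: mulr_ge0 (sqn_ge0 z); apply: mulr_ge0 (pi_ge0 R) (sqr_ge0 a).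
rewrite /gaussd mulNr expRN lef_pV2 ?posrE ?expR_gt0//; first exact: expR_ge1Dx.
by rewrite ltr_wpDr.
Qed.

(* If [|g x| > e], then [|g| > e/2] near [x], so that the mass of [g^2] against a
   narrow Gaussian centred at [x] stays bounded below; it tends to 0 as [x] goes to infinity. *)
Lemma vanishes_at_infinity g : measurable_fun setT g ->
  Rsummable mu (fun x => g x ^+ 2) ->
  (forall e, 0 < e -> exists2 delta, 0 < delta &
     forall x h, `|h| <= delta -> `|g (x + h) - g x| <= e) ->
  forall e, 0 < e -> exists M, forall x, M <= `|x| -> `|g x| <= e.
Proof.
move=> mg Ig ucg e e0; apply: contrapT => H.
have /choice[x_ xP] : forall k : nat, exists x, k%:R <= `|x| /\ e < `|g x|.
  move=> k; apply: contrapT => Hk; apply: H; exists k%:R => x kx.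
  by rewrite leNgt; apply/negP => ex; apply: Hk; exists x.
have e2 : 0 < e / 2 by rewrite divr_gt0.
have [delta d0 ucd] := ucg _ e2.
have d2 : 0 < delta ^+ 2 by rewrite exprn_gt0.
pose c_ (m : nat) : R := m.+1%:R ^+ n * expR (- (pi * delta ^+ 2 * m%:R)).
(* The width is chosen so that beyond distance [delta] the kernel is at most half of [gaussd 1]. *)
have [m cm] : exists m, c_ m <= 2^-1.
  have p0 : 0 < pi * delta ^+ 2 by rewrite mulr_gt0 ?pi_gt0.
  have /cvgrPdist_le/(_ 2^-1) := pow_expR_cvg0 n p0.
  move=> /(_ ltac:(by rewrite invr_gt0))[m _ /(_ m (leqnn m))].
  by rewrite sub0r normrN => /(le_trans (ler_norm _)) ?; exists m.
have c0 : 0 <= c_ m by rewrite mulr_ge0 ?expR_ge0// exprn_ge0.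
pose a : R := m.+1%:R^-1.
have a0 : 0 < a by rewrite invr_gt0.
have kge z := gauss_kernel_ge0 a0 z; have kle z := gauss_kernel_le a0 z.
pose F k y := g y ^+ 2 * gauss_kernel a (y - x_ k).
have mF k : measurable_fun setT (F k).
  by apply: measurable_funM; [exact: measurable_funX|exact: measurable_gauss_kernel].
have IG := RsummableZ (a ^- n) Ig.
have FG k y : `|F k y| <= a ^- n * g y ^+ 2.
  rewrite /F ger0_norm; last by rewrite mulr_ge0 ?sqr_ge0.
  by rewrite mulrC; apply: ler_wpM2r; [exact: sqr_ge0|exact: kle].
have an0 : 0 <= a ^- n by rewrite invr_ge0 exprn_ge0// ltW.
have F0 y : F k y @[k --> \oo] --> (0 : R).
  rewrite -(mulr0 (g y ^+ 2)); apply: cvgMl_tmp.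
  apply/cvgrPdist_le => eta eta0.
  pose B := a ^- n / eta.
  have B0 : 0 <= B by rewrite divr_ge0// ltW.
  pose b := pi * (a^-1) ^+ 2.
  have b0 : 0 < b by rewrite mulr_gt0 ?pi_gt0// exprn_gt0// invr_gt0.
  exists (Num.trunc (`|y| + (B / b + 1))).+1 => // k /= hk.
  have hk' : `|y| + (B / b + 1) <= k%:R.
    by rewrite ltW// (lt_le_trans (truncnS_gt _))// ler_nat.
  have xk := (xP k).1.
  rewrite sub0r normrN ger0_norm// /gauss_kernel.
  have ny : B / b + 1 <= `|y - x_ k|.
    have : `|x_ k| <= `|y| + `|y - x_ k|.
      by rewrite -[X in `|X|](subrK y) addrC (le_trans (ler_normD _ _))// [in leRHS]distrC lexx.
    by move: hk' xk; lra.
  have Bb : 0 <= B / b by rewrite divr_ge0// ltW.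
  have nB : B <= b * sqn (y - x_ k).
    rewrite -ler_pdivrMl// mulrC; apply: (le_trans _ (sqr_norm_le_sqn _)).
    by move: ny Bb; move: (B / b) `|_| => u v uv u0; nra.
  have t0 : 0 < 1 + b * sqn (y - x_ k) by rewrite ltr_wpDr// (le_trans B0).
  apply: (le_trans (ler_wpM2l an0 (gaussd_le_inv _ _))).
  rewrite -/b ler_pdivrMr// mulrC -ler_pdivrMr// -/B.
  by apply: (le_trans nB); rewrite lerDr.
have [_ ] := Rintegral_dominated mF (measurable_cst (0 : R)) F0 IG FG.
rewrite Rintegral_cst// mul0r.
(* The masses will be shown to be at least (e/2)^2 (1 - c_ m) >= (e/2)^2 / 2, so half of that is
   enough for a contradiction. *)
have q0 : 0 < (e / 2) ^+ 2 / 2 / 2 by rewrite !divr_gt0// exprn_gt0// divr_gt0.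
move=> /cvgrPdist_le/(_ _ q0)[k _ /(_ k (leqnn k))].
rewrite sub0r normrN => /(le_trans (ler_norm _)) small.
have Ik := Rsummable_gauss_kernel a0 (x_ k).
have Ig1 := @Rsummable_gaussd_center R 1 n (x_ k) ltr01.
have Icg := RsummableZ (c_ m) Ig1.
have IL := RsummableZ ((e / 2) ^+ 2) (RsummableB Ik Icg).
have IF : Rsummable mu (F k) by exact: (le_Rsummable (mF k) (FG k) IG).
(* Within distance delta of x_ k, |g| >= e/2 and the subtracted term only helps; farther away the
   tail estimate makes the left integrand nonpositive. *)
have : \int[mu]_y ((e / 2) ^+ 2 * (gauss_kernel a (y - x_ k) - c_ m * gaussd 1 (y - x_ k))) <=
    \int[mu]_y F k y.
  apply: (ler_Rintegral IL IF) => y; rewrite /F.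
  have [yx|yx] := leP `|y - x_ k| delta; last first.
    have dz : delta ^+ 2 <= sqn (y - x_ k).
      apply: le_trans (sqr_norm_le_sqn _).
      by rewrite lerXn2r ?nnegrE ?(ltW d0)// ltW.
    have kt := gauss_kernel_tail m (ltW d2) dz.
    apply: (@le_trans _ _ 0); last by rewrite mulr_ge0 ?sqr_ge0.
    by rewrite mulr_ge0_le0 ?sqr_ge0// subr_le0.
  have := ucd (x_ k) (y - x_ k) yx; rewrite addrCA subrr addr0 => gy.
  have ge : e / 2 <= `|g y|.
    have := (xP k).2; have := lerB_dist (g (x_ k)) (g y); rewrite distrC in gy.
    by move: gy; lra.
  have g2 : (e / 2) ^+ 2 <= g y ^+ 2.
    rewrite -[leRHS]ger0_norm ?sqr_ge0// normrX.
    by rewrite lerXn2r ?nnegrE ?(ltW e2).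
  apply: (@le_trans _ _ ((e / 2) ^+ 2 * gauss_kernel a (y - x_ k))); last exact: ler_wpM2r.
  apply: ler_wpM2l; first exact: sqr_ge0.
  by rewrite gerBl mulr_ge0// gaussd_ge0.
rewrite (RsumZ _ (RsummableB Ik Icg)) (RsumB Ik Icg) (RsumZ _ Ig1).
rewrite Rintegral_gauss_kernel// Rintegral_gaussd_center// expr1n invr1 mulr1.
have := sqr_ge0 (e / 2).
by move: small cm q0; nra.
Qed.

End decay.

(** * The global chart and the embedding into C^1 bounded functions *)

Section chart.
Context {R : realType} {n : nat}.
Variable q : R.
Hypothesis hq : n%:R / 2 + 1 < q.
Local Notation mu := (@leb R n).
Implicit Types (gr gi kr ki : 'I_n -> 'rV[R]_n -> R) (phi psi : 'rV[R]_n -> 'rV[R]_n).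

Let C0 : R := \int[mu]_x ((1 + sqn x) `^ (- (q - 1))).

Let C0_ge0 : 0 <= C0. Proof. by apply: Rintegral_ge0 => x _; exact: powR_ge0. Qed.

(** The embedding constant: it bounds the sup norms of u and du per unit of H^q norm. *)
Definition supC := 2 * pi * (2^-1 + C0).

Lemma supC_ge0 : 0 <= supC.
Proof. by apply: mulr_ge0; [rewrite mulr_ge0 ?pi_ge0|rewrite addr_ge0// invr_ge0]. Qed.

Lemma Rintegral_wpair_le_wnorm2 gr gi i : mpairs gr gi -> wsummable q gr gi ->
  \int[mu]_x wpair q (gr i) (gi i) x <= wnorm2 q gr gi.
Proof.
move=> mg Iw; rewrite /wnorm2 (bigD1 i)//= lerDl.
by apply: sumr_ge0 => j _; apply: Rintegral_ge0 => x _; exact: wpair_ge0.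
Qed.

(** The choice t = 1/r in the AM-GM bound makes both of its terms proportional to r. *)
Lemma Rintegral_jap_ampl_le_norm gr gi i r : mpairs gr gi -> wsummable q gr gi ->
  0 < r -> wnorm2 q gr gi <= r ^+ 2 ->
  \int[mu]_x (jap x * ampl (gr i) (gi i) x) <= (2^-1 + C0) * r.
Proof.
move=> mg Iw r0 Wr; have [mr mi] := mg i.
have r1 : 0 < r^-1 by rewrite invr_gt0.
apply: (le_trans (Rintegral_jap_ampl_le hq mr mi (Iw i) r1)).
rewrite -/C0 invrK mulrDl; apply: lerD; last by rewrite mulrC.
apply: (@le_trans _ _ (r^-1 / 2 * r ^+ 2)).
  apply: ler_wpM2l; first by rewrite divr_ge0// ltW.
  exact: le_trans (Rintegral_wpair_le_wnorm2 i mg Iw) Wr.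
by rewrite expr2 mulrAC mulKf ?gt_eqF// mulrC.
Qed.

Lemma norm_dinvFT_le gr gi r x j i : mpairs gr gi -> wsummable q gr gi ->
  0 < r -> wnorm2 q gr gi <= r ^+ 2 -> `|dinvFT gr gi x j i| <= supC * r.
Proof.
move=> mg Iw r0 Wr; have [mr mi] := mg i.
have Ia := Rsummable_dgr hq mr mi (Iw i) j.
have Ib := Rsummable_dgi hq mr mi (Iw i) j.
have Ij := Rsummable_jap_ampl hq mr mi (Iw i).
rewrite mxE; apply: (le_trans (norm_invFT_le _ Ia Ib)).
have le := ler_Rintegral (RsummableD (Rsummable_norm Ia) (Rsummable_norm Ib))
  (RsummableZ (2 * pi) Ij) (dg_norm_le (gr i) (gi i) j).
apply: (le_trans le); rewrite (RsumZ _ Ij) /supC -[leRHS]mulrA.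
apply: ler_wpM2l; first by rewrite mulr_ge0 ?pi_ge0.
exact: Rintegral_jap_ampl_le_norm.
Qed.

Lemma norm_invFTrow_le gr gi r x i : mpairs gr gi -> wsummable q gr gi ->
  0 < r -> wnorm2 q gr gi <= r ^+ 2 -> `|invFTrow gr gi x 0 i| <= supC * r.
Proof.
move=> mg Iw r0 Wr; have [mr mi] := mg i.
have Ia := Rsummable_gr hq mr mi (Iw i).
have Ib := Rsummable_gi hq mr mi (Iw i).
have Ij := Rsummable_jap_ampl hq mr mi (Iw i).
rewrite mxE; apply: (le_trans (norm_invFT_le _ Ia Ib)).
have le : \int[mu]_xi (`|gr i xi| + `|gi i xi|) <= \int[mu]_x (jap x * ampl (gr i) (gi i) x).
  apply: (ler_Rintegral (RsummableD (Rsummable_norm Ia) (Rsummable_norm Ib)) Ij) => xi.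
  by rewrite ler_peMl ?addr_ge0// jap_ge1.
apply: (le_trans le); apply: (le_trans (Rintegral_jap_ampl_le_norm i mg Iw r0 Wr)).
rewrite /supC -mulrA ler_peMl//; last by have := pi_ge2 R; lra.
by rewrite mulr_ge0 ?(ltW r0)// addr_ge0// invr_ge0.
Qed.

Lemma invFTrowB gr gi kr ki x : mpairs gr gi -> mpairs kr ki ->
  wsummable q gr gi -> wsummable q kr ki ->
  invFTrow (pairB gr kr) (pairB gi ki) x = invFTrow gr gi x - invFTrow kr ki x.
Proof.
move=> mg mk Ig Ik; apply/rowP => i; rewrite !mxE.
have [mgr mgi] := mg i; have [mkr mki] := mk i.
apply: invFTB; [exact: (Rsummable_gr hq mgr mgi (Ig i))|exact: (Rsummable_gi hq mgr mgi (Ig i))|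
  exact: (Rsummable_gr hq mkr mki (Ik i))|exact: (Rsummable_gi hq mkr mki (Ik i))].
Qed.

Lemma dinvFTB gr gi kr ki x : mpairs gr gi -> mpairs kr ki ->
  wsummable q gr gi -> wsummable q kr ki ->
  dinvFT (pairB gr kr) (pairB gi ki) x = dinvFT gr gi x - dinvFT kr ki x.
Proof.
move=> mg mk Ig Ik; apply/matrixP => j i; rewrite !mxE.
have [mgr mgi] := mg i; have [mkr mki] := mk i.
have -> : dgr (pairB gi ki i) j = dgr (gi i) j \- dgr (ki i) j.
  by apply/funext => xi; rewrite /dgr /pairB /=; ring.
have -> : dgi (pairB gr kr i) j = dgi (gr i) j \- dgi (kr i) j.
  by apply/funext => xi; rewrite /dgi /pairB /=; ring.
apply: invFTB; [exact: (Rsummable_dgr hq mgr mgi (Ig i))|exact: (Rsummable_dgi hq mgr mgi (Ig i))|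
  exact: (Rsummable_dgr hq mkr mki (Ik i))|exact: (Rsummable_dgi hq mkr mki (Ik i))].
Qed.

(** The second clause is a pointwise identity, whereas the transform alone determines phi - id only
    almost everywhere. *)
Definition chart phi gr gi :=
  Hrep q (phi \- id) gr gi /\ phi = (fun x => x + invFTrow gr gi x).

(** Fourier inversion at every y and in every component; continuity of phi comes from its
    differentiability. *)
Lemma Dq_chart phi : Dq q phi -> exists gr gi, chart phi gr gi.
Proof.
move=> [/in_HqP[gr [gi H]] [dphi _]]; exists gr, gi; split => //.
have mg := Hrep_measurable H; case: H => L hf Iw.
apply/funext => y; apply/eqP; rewrite addrC -subr_eq; apply/eqP/rowP => i.
have [mr mi] := mg i; have /L2P[mu_ Iu] := L i.
rewrite [RHS]mxE.
apply: (fourier_inversion mu_ Iu (Rsummable_gr hq mr mi (Iw i)) (Rsummable_gi hq mr mi (Iw i))).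
  have [_ _ hF] := (is_FTP _ _ (L i)).1 (hf i).
  by apply/cvge0P => // N; apply: integral_ge0 => xi _; rewrite lee_fin FTdist_ge0.
move=> e e0; have e2 : 0 < e / 2 by rewrite divr_gt0.
have cphi : {for y, continuous phi} by exact: differentiable_continuous.
have := (@cvgr_dist_lt R _ _ _ (nbhs_filter y) phi _ cphi _ e2).
move=> /nbhs_ballP[delta /= d0 hd].
exists (Num.min delta (e / 2)); first by rewrite lt_min d0 e2.
move=> x hx; have bx : ball y delta x.
  split => // k j; rewrite ord1 /ball/= distrC.
  by have := hx j; rewrite lt_min => /andP[].
have := hd _ bx => /=; have := norm_coord_le (phi y - phi x) i.
rewrite !mxE; have := hx i; rewrite lt_min => /andP[_ h1] h2 h3.
rewrite /Defs.comp /= !mxE.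
have -> : phi x 0 i - x 0 i - (phi y 0 i - y 0 i) =
  - (phi y 0 i - phi x 0 i) - (x 0 i - y 0 i) by ring.
apply: (le_lt_trans (ler_normB _ _)); rewrite normrN.
by move: (le_lt_trans h2 h3) h1; lra.
Qed.

Lemma chart_mpairs phi gr gi : chart phi gr gi -> mpairs gr gi.
Proof. by move=> [/Hrep_measurable]. Qed.

Lemma chart_wsummable phi gr gi : chart phi gr gi -> wsummable q gr gi.
Proof. by move=> [[]]. Qed.

Lemma jac_det_chart phi gr gi x : chart phi gr gi ->
  jac_det phi x = \det (1%:M + dinvFT gr gi x).
Proof.
move=> c; have mg := chart_mpairs c; have Iw := chart_wsummable c.
by case: c => _ ->; exact: (jac_det_invFT hq mg Iw).
Qed.

Lemma chartB phi psi gr gi kr ki : chart phi gr gi -> chart psi kr ki ->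
  Hrep q (phi \- psi) (pairB gr kr) (pairB gi ki).
Proof.
move=> [H1 _] [H2 _]; have := HrepB H1 H2.
suff -> : (phi \- id) \- (psi \- id) = phi \- psi by [].
by apply/funext => x /=; rewrite opprB addrA subrK.
Qed.

(** The radius r = 1 + W is positive and satisfies W <= r^2 for the squared norm W; the leading 1
    accounts for the identity matrix. *)
Definition entryK gr gi := 1 + supC * (1 + wnorm2 q gr gi).

Lemma entryK_ge1 gr gi : 1 <= entryK gr gi.
Proof. by rewrite /entryK lerDl mulr_ge0 ?supC_ge0// addr_ge0// wnorm2_ge0. Qed.

Lemma norm_entry_le gr gi x j i : mpairs gr gi -> wsummable q gr gi ->
  `|(1%:M + dinvFT gr gi x) j i| <= entryK gr gi.
Proof.
move=> mg Iw; rewrite mxE (le_trans (ler_normD _ _))//; apply: lerD.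
  by rewrite mxE; case: eqP; rewrite ?normr1 ?normr0.
have W0 := wnorm2_ge0 q gr gi.
apply: norm_dinvFT_le => //; first by rewrite ltr_wpDr.
by move: (wnorm2 q gr gi) W0 => W; nra.
Qed.

Lemma det_entry_dist_le gr gi (A : 'M[R]_n) K e x : mpairs gr gi -> wsummable q gr gi ->
  entryK gr gi <= K -> 0 <= e ->
  (forall i j, `|A i j| <= K) ->
  (forall i j, `|A i j - (1%:M + dinvFT gr gi x) i j| <= e) ->
  `|\det A - \det (1%:M + dinvFT gr gi x)| <= (n`! * n)%:R * K ^+ n * e.
Proof.
move=> mg Iw gK e0 AK Ae; apply: det_dist_le => //.
- exact: le_trans (entryK_ge1 gr gi) gK.
- by move=> i j; apply: le_trans gK; exact: norm_entry_le.
Qed.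

Lemma det_dinvFT_dist_le gr gi x y e : mpairs gr gi -> wsummable q gr gi -> 0 <= e ->
  (forall i j, `|dinvFT gr gi x i j - dinvFT gr gi y i j| <= e) ->
  `|\det (1%:M + dinvFT gr gi x) - \det (1%:M + dinvFT gr gi y)| <=
  (n`! * n)%:R * entryK gr gi ^+ n * e.
Proof.
move=> mg Iw e0 h; apply: det_entry_dist_le => // [i j|i j]; first exact: norm_entry_le.
have -> : (1%:M + dinvFT gr gi x) i j - (1%:M + dinvFT gr gi y) i j =
  dinvFT gr gi x i j - dinvFT gr gi y i j by rewrite !mxE; ring.
exact: h.
Qed.

Lemma dinvFT_unif_continuous gr gi e : mpairs gr gi -> wsummable q gr gi -> 0 < e ->
  exists2 delta, 0 < delta & forall x h, `|h| <= delta ->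
    forall j i, `|dinvFT gr gi (x + h) j i - dinvFT gr gi x j i| <= e.
Proof.
move=> mg Iw e0.
have om i : exists delta, 0 < delta /\ forall x h, `|h| <= delta ->
    forall j, `|dinvFT gr gi (x + h) j i - dinvFT gr gi x j i| <= e.
  have [mr mi] := mg i.
  have [delta d0 hd] := omega_small hq mr mi (Iw i) (lexx (2 * pi * n.+1%:R)) e0.
  exists delta; split => // x h hle j; rewrite !mxE.
  apply: (le_trans (invFT_deriv_modulus hq mr mi (Iw i) (lexx _) j x h)).
  by apply: hd; rewrite normr_ge0.
have /choice[D DP] := om.
exists (\big[Num.min/1]_i D i).
  by apply: lt_bigmin => // i _; exact: (DP i).1.
move=> x h hle j i; apply: (DP i).2; apply: (le_trans hle).
exact: bigmin_le.
Qed.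

End chart.

(** * Lower bound for the jacobian determinant *)

Section jacobian.
Context {R : realType} {n : nat}.
Variable q : R.
Hypothesis hq : n%:R / 2 + 1 < q.
Local Notation mu := (@leb R n).
Implicit Types (gr gi kr ki : 'I_n -> 'rV[R]_n -> R) (phi psi : 'rV[R]_n -> 'rV[R]_n).

Lemma dinvFT_vanishes gr gi e : mpairs gr gi -> wsummable q gr gi -> 0 < e ->
  exists M, forall x, M <= `|x| -> forall j i, `|dinvFT gr gi x j i| <= e.
Proof.
move=> mg Iw e0.
have one (ji : 'I_n * 'I_n) : exists M, forall x, M <= `|x| -> `|dinvFT gr gi x ji.1 ji.2| <= e.
  case: ji => j i /=; have [mr mi] := mg i.
  have Ia := Rsummable_dgr hq mr mi (Iw i) j.
  have Ib := Rsummable_dgi hq mr mi (Iw i) j.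
  have [I2 _] := bessel_invFT Ia Ib (Rsummable_dgr_sqr hq mi (Iw i) j)
    (Rsummable_dgi_sqr hq mr (Iw i) j).
  have uc e' : 0 < e' -> exists2 delta, 0 < delta & forall x h, `|h| <= delta ->
      `|invFT (dgr (gi i) j) (dgi (gr i) j) (x + h) - invFT (dgr (gi i) j) (dgi (gr i) j) x| <= e'.
    move=> e'0; have [delta d0 hd] := dinvFT_unif_continuous hq mg Iw e'0.
    by exists delta => // x h hle; have := hd x h hle j i; rewrite !mxE.
  have [M hM] := vanishes_at_infinity (measurable_invFT Ia Ib) I2 uc e0.
  by exists M => x Mx; rewrite mxE; exact: hM.
have /choice[M_ MP] := one.
exists (\big[Num.max/0]_ji M_ ji) => x hx j i; apply: (MP (j, i)).
by apply: le_trans hx; exact: le_bigmax.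
Qed.

Let L gr gi : R := (n`! * n)%:R * entryK q gr gi ^+ n.

Let L_ge0 gr gi : 0 <= L gr gi.
Proof. by rewrite mulr_ge0// exprn_ge0// (le_trans ler01)// entryK_ge1. Qed.

Lemma continuous_det_dinvFT gr gi : mpairs gr gi -> wsummable q gr gi ->
  continuous (fun x => \det (1%:M + dinvFT gr gi x)).
Proof.
move=> mg Iw x; apply/(@cvgrPdist_le R _ _ _ (nbhs_filter x)) => e e0.
have L1 : 0 < L gr gi + 1 by rewrite ltr_wpDl.
have e1 : 0 < e / (L gr gi + 1) by rewrite divr_gt0.
have [delta d0 hd] := dinvFT_unif_continuous hq mg Iw e1.
apply: filterS (near_row_dist_le x d0) => y xy.
apply: (le_trans (det_dinvFT_dist_le (x := x) (y := y) hq mg Iw (ltW e1) _)).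
  by move=> i j; have := hd y (x - y) xy i j; rewrite addrCA subrr addr0.
rewrite -/(L gr gi) mulrA ler_pdivrMr// mulrC; apply: ler_wpM2l; first exact: ltW.
by rewrite lerDl.
Qed.

(** Outside a ball du is small enough for the determinant to be within 1/2 of det I = 1, so its
    inverse is at most 2; on the closed ball, which is compact, the inverse is continuous. *)
Lemma det_dinvFT_inv_bounded gr gi : mpairs gr gi -> wsummable q gr gi ->
  (forall x, 0 < \det (1%:M + dinvFT gr gi x)) ->
  exists2 M, 0 < M & forall x, (\det (1%:M + dinvFT gr gi x))^-1 <= M.
Proof.
move=> mg Iw pos; pose f x := (\det (1%:M + dinvFT gr gi x))^-1.
have L1 : 0 < 2 * (L gr gi + 1) by rewrite mulr_gt0// ltr_wpDl.
have e1 : 0 < (2 * (L gr gi + 1))^-1 by rewrite invr_gt0.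
have [rho hrho] := dinvFT_vanishes mg Iw e1.
have far x : rho <= `|x| -> f x <= 2.
  move=> rx.
  have : `|\det (1%:M : 'M[R]_n) - \det (1%:M + dinvFT gr gi x)| <= 2^-1.
    apply: (@le_trans _ _ (L gr gi * (2 * (L gr gi + 1))^-1)).
      apply: (det_entry_dist_le hq mg Iw (lexx _) (ltW e1)) => i j.
        apply: le_trans (entryK_ge1 q gr gi).
        by rewrite mxE; case: eqP; rewrite ?normr1 ?normr0.
      have -> : (1%:M : 'M[R]_n) i j - (1%:M + dinvFT gr gi x) i j =
        - dinvFT gr gi x i j by rewrite !mxE; ring.
      by rewrite normrN; exact: hrho.
    rewrite ler_pdivrMr// mulrA mulVf// mul1r lerDl//.
  rewrite det1 => /(le_trans (ler_norm _)) h.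
  rewrite /f -[leRHS]invrK lef_pV2 ?posrE ?invr_gt0//.
  by move: h; lra.
have cf : continuous f.
  by move=> x; exact: (@cvgV _ _ _ (nbhs_filter x) _ _ (lt0r_neq0 (pos x)) (continuous_det_dinvFT mg Iw (x := x))).
pose A := [set x : 'rV[R]_n | `|x| <= rho].
have cA : compact A.
  apply: bounded_closed_compact.
    exists rho; split; first exact: num_real.
    by move=> N rN x /= /le_trans; apply; exact: ltW.
  apply: (@closed_comp _ _ (@Num.norm R 'rV[R]_n) [set r | r <= rho]).
    by move=> x _; exact: norm_continuous.
  exact: closed_le.
have cfA : {within A, continuous f} by exact: continuous_subspaceT.
have [M [_ HM]] := compact_bounded (continuous_compact cfA cA).
exists (Num.max 2 (M + 1)); first by rewrite lt_max ltr0n.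
move=> x; rewrite le_max; have [rx|rx] := leP rho `|x|; first by rewrite far.
apply/orP; right; apply: (le_trans (ler_norm _)).
by apply: (HM (M + 1)); [rewrite ltrDl|exists x => //; exact: ltW].
Qed.

Lemma Dq_jac_inv_bounded phi : Dq q phi ->
  exists2 M, 0 < M & forall x, (jac_det phi x)^-1 <= M.
Proof.
move=> D; have [gr [gi c]] := Dq_chart hq D; have [_ [_ pos]] := D.
have [|M M0 hM] := det_dinvFT_inv_bounded (chart_mpairs c) (chart_wsummable c).
  by move=> x; rewrite -(jac_det_chart hq x c).
by exists M => // x; rewrite (jac_det_chart hq x c).
Qed.

End jacobian.

#[local] Opaque jac_det Hq_norm.

(** * The sup distance between inverse jacobians *)

Section inverse_jacobian_distance.
Context {R : realType} {n : nat}.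
Variable q : R.
Hypothesis hq : n%:R / 2 + 1 < q.
Implicit Types (phi psi : 'rV[R]_n -> 'rV[R]_n) (g : 'rV[R]_n -> R).
Implicit Types gr gi kr ki : 'I_n -> 'rV[R]_n -> R.

Lemma supnorm_e_le g M : (forall x, `|g x| <= M) -> (supnorm_e g <= M%:E)%E.
Proof. by move=> h; apply: ge_ereal_sup => _ [x _ <-]; rewrite lee_fin. Qed.

Lemma le_supnorm_e g x : (`|g x|%:E <= supnorm_e g)%E.
Proof. by apply: ereal_sup_ubound; exists x. Qed.

Lemma eq_supnorm_e f g : (forall x, `|f x| = `|g x|) -> supnorm_e f = supnorm_e g.
Proof.
by move=> fg; rewrite /supnorm_e; under [in LHS]eq_fun do rewrite fg.
Qed.

Lemma supnorm_e_ge0 g : (0 <= supnorm_e g)%E.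
Proof. by apply: le_trans (le_supnorm_e g 0); rewrite lee_fin. Qed.

Definition invdet_dist phi psi : R := fine (invdet_dist_e phi psi).

Lemma invdet_dist_ge0 phi psi : 0 <= invdet_dist phi psi.
Proof. by apply: fine_ge0; exact: supnorm_e_ge0. Qed.

Lemma invdet_dist_le phi psi M :
  (forall x, `|(jac_det phi x)^-1 - (jac_det psi x)^-1| <= M) -> invdet_dist phi psi <= M.
Proof.
move=> h; have le := supnorm_e_le h; rewrite -lee_fin fineK//.
by rewrite ge0_fin_numE ?supnorm_e_ge0// (le_lt_trans le)// ltry.
Qed.

Lemma invdet_dist_e_lty phi psi : Dq q phi -> Dq q psi -> (invdet_dist_e phi psi < +oo)%E.
Proof.
move=> D1 D2; have [M1 _ h1] := Dq_jac_inv_bounded hq D1.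
have [M2 _ h2] := Dq_jac_inv_bounded hq D2.
have [_ [_ p1]] := D1; have [_ [_ p2]] := D2.
suff : (invdet_dist_e phi psi <= (M1 + M2)%:E)%E by move=> /le_lt_trans; apply; rewrite ltry.
apply: supnorm_e_le => x; apply: (le_trans (ler_normB _ _)).
have n1 : 0 <= (jac_det phi x)^-1 by rewrite invr_ge0; exact: ltW.
have n2 : 0 <= (jac_det psi x)^-1 by rewrite invr_ge0; exact: ltW.
by apply: lerD; [rewrite (ger0_norm n1); exact: h1|rewrite (ger0_norm n2); exact: h2].
Qed.

(** [fine] sends +oo to 0, so the finiteness of the supremum is essential here; it comes from the
    bounds on both inverse jacobians. *)
Lemma le_invdet_dist phi psi x : Dq q phi -> Dq q psi ->
  `|(jac_det phi x)^-1 - (jac_det psi x)^-1| <= invdet_dist phi psi.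
Proof.
move=> D1 D2; have lt := invdet_dist_e_lty D1 D2.
rewrite -lee_fin fineK; first exact: (le_supnorm_e (fun x => (jac_det phi x)^-1 - (jac_det psi x)^-1)).
by rewrite ge0_fin_numE ?supnorm_e_ge0.
Qed.

Lemma invdet_dist_sym phi psi : invdet_dist phi psi = invdet_dist psi phi.
Proof.
have E x : `|(jac_det phi x)^-1 - (jac_det psi x)^-1| =
  `|(jac_det psi x)^-1 - (jac_det phi x)^-1| by exact: distrC.
exact: (congr1 (@fine R) (eq_supnorm_e E)).
Qed.

Lemma invdet_dist_triangle phi1 phi2 phi3 : Dq q phi1 -> Dq q phi2 -> Dq q phi3 ->
  invdet_dist phi1 phi3 <= invdet_dist phi1 phi2 + invdet_dist phi2 phi3.
Proof.
move=> D1 D2 D3; apply: invdet_dist_le => x.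
apply: (le_trans (ler_distD (jac_det phi2 x)^-1 _ _)).
by apply: lerD; exact: le_invdet_dist.
Qed.

(** As a >= 1/M and eta <= 1/(2M), also b >= 1/(2M); so 1/(a b) <= 2 M^2. *)
Lemma invr_dist_le (a b M eta : R) : 0 < M -> 0 < a -> a^-1 <= M ->
  `|a - b| <= eta -> eta <= (2 * M)^-1 -> `|a^-1 - b^-1| <= 2 * M ^+ 2 * eta.
Proof.
move=> M0 a0 aM ab etaM.
have aM' : M^-1 <= a by rewrite -[leRHS]invrK lef_pV2 ?posrE ?invr_gt0.
have bM : (2 * M)^-1 <= b.
  have : a - b <= eta by apply: le_trans ab; exact: ler_norm.
  have : (2 * M)^-1 = M^-1 / 2 by rewrite invfM mulrC.
  by move: etaM aM'; lra.
have b0 : 0 < b by apply: lt_le_trans bM; rewrite invr_gt0 mulr_gt0.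
have bM' : b^-1 <= 2 * M by rewrite -[leRHS]invrK lef_pV2 ?posrE ?invr_gt0 ?mulr_gt0.
have -> : a^-1 - b^-1 = (b - a) * (a^-1 * b^-1) by field; rewrite !gt_eqF.
rewrite normrM distrC mulrC; apply: ler_pM => //.
have ia : 0 <= a^-1 by rewrite invr_ge0 ltW.
have ib : 0 <= b^-1 by rewrite invr_ge0 ltW.
rewrite normrM (ger0_norm ia) (ger0_norm ib).
have -> : 2 * M ^+ 2 = M * (2 * M) by ring.
exact: ler_pM.
Qed.

Lemma dqE phi psi : dq q phi psi = Hq_norm q (phi \- psi) + invdet_dist phi psi.
Proof. by []. Qed.

Lemma det_dinvFT_near gr gi eta : mpairs gr gi -> wsummable q gr gi -> 0 < eta ->
  exists2 delta, 0 < delta & forall kr ki, mpairs kr ki -> wsummable q kr ki ->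
    wnorm2 q (pairB gr kr) (pairB gi ki) <= delta ^+ 2 -> forall x,
    `|\det (1%:M + dinvFT gr gi x) - \det (1%:M + dinvFT kr ki x)| <= eta.
Proof.
move=> mg Iw eta0.
(* One more than the bound on the entries for [gr], [gi], so as to cover matrices whose entries
   differ by at most 1. *)
pose K := entryK q gr gi + 1.
have K1 : 1 <= K by rewrite lerDr (le_trans ler01)// entryK_ge1.
pose L : R := (n`! * n)%:R * K ^+ n.
have L0 : 0 <= L by rewrite mulr_ge0// exprn_ge0// (le_trans ler01).
pose S := supC (n := n) q; have S0 : 0 <= S by exact: supC_ge0.
have S1 : 0 < S + 1 by rewrite ltr_wpDl.
have LS0 : 0 <= L * S by rewrite mulr_ge0.
have LS1 : 0 < L * S + 1 by rewrite ltr_wpDl.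
(* The first bound keeps the entries within 1 of each other; the second brings the determinants
   within eta. *)
pose delta := Num.min (S + 1)^-1 (eta / (L * S + 1)).
have d0 : 0 < delta by rewrite lt_min invr_gt0 S1 divr_gt0.
exists delta => // kr ki mk Ik W x.
have dS : S * delta <= 1.
  apply: (@le_trans _ _ ((S + 1) * (S + 1)^-1)); last by rewrite mulfV// gt_eqF.
  by apply: ler_pM => //; rewrite ?(ltW d0)// ?lerDl// ge_min lexx.
have dL : L * (S * delta) <= eta.
  rewrite mulrA; apply: (@le_trans _ _ ((L * S + 1) * (eta / (L * S + 1)))).
    by apply: ler_pM => //; rewrite ?(ltW d0)// ?lerDl// ge_min lexx orbT.
  by rewrite mulrC divfK// gt_eqF.
have mB : mpairs (pairB gr kr) (pairB gi ki).
  by move=> i; have [? ?] := mg i; have [? ?] := mk i; split; exact: measurable_funB.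
have hd j i : `|dinvFT gr gi x j i - dinvFT kr ki x j i| <= S * delta.
  have := norm_dinvFT_le hq x j i mB (wsummableB mg mk Iw Ik) d0 W.
  have subE (A B : 'M[R]_n) : (A - B) j i = A j i - B j i by rewrite !mxE.
  by rewrite (dinvFTB hq x mg mk Iw Ik) subE.
have gK i j : `|(1%:M + dinvFT gr gi x) i j| <= entryK q gr gi by exact: norm_entry_le.
have gk i j : (1%:M + dinvFT gr gi x) i j - (1%:M + dinvFT kr ki x) i j =
  dinvFT gr gi x i j - dinvFT kr ki x i j by rewrite !mxE; ring.
apply: le_trans dL; apply: det_dist_le => //.
- by rewrite mulr_ge0// ltW.
- by move=> i j; apply: (le_trans (gK i j)); rewrite lerDl.
- move=> i j; rewrite -[_ i j](subKr ((1%:M + dinvFT gr gi x) i j)) gk.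
  apply: (le_trans (ler_normB _ _)); apply: lerD; first exact: gK.
  exact: le_trans (hd i j) dS.
- by move=> i j; rewrite gk.
Qed.

(* The chart is bicontinuous: near [phi] the term in the inverse jacobians is controlled by
   the H^q distance, since H^q embeds in C^1_b and [det (d phi)] is bounded away from 0. *)
Lemma dq_small phi e : Dq q phi -> 0 < e ->
  exists2 delta, 0 < delta & forall psi, Dq q psi -> Hq_norm q (phi \- psi) < delta ->
    dq q phi psi < e.
Proof.
move=> D e0; have [gr [gi c]] := Dq_chart hq D.
have mg := chart_mpairs c; have Iw := chart_wsummable c.
have [M M0 hM] := Dq_jac_inv_bounded hq D; have [_ [_ pos]] := D.
(* The first bound is what [invr_dist_le] requires; the second makes its conclusion at most e/4,
   while the H^q part takes e/2. *)
pose eta := Num.min (2 * M)^-1 (e / (8 * M ^+ 2)).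
have eta0 : 0 < eta by rewrite lt_min invr_gt0 mulr_gt0//= divr_gt0// mulr_gt0// exprn_gt0.
have [delta d0 hdet] := det_dinvFT_near mg Iw eta0.
have e2 : 0 < e / 2 by rewrite divr_gt0.
exists (Num.min delta (e / 2)); first by rewrite lt_min d0 e2.
move=> psi Dpsi; have [kr [ki ck]] := Dq_chart hq Dpsi.
have mk := chart_mpairs ck; have Ik := chart_wsummable ck.
rewrite dqE (Hq_normE (chartB c ck)) lt_min => /andP[hlt hlt2].
have W : wnorm2 q (pairB gr kr) (pairB gi ki) <= delta ^+ 2.
  have W0 := wnorm2_ge0 q (pairB gr kr) (pairB gi ki).
  by rewrite -[leLHS](sqr_sqrtr W0) lerXn2r ?nnegrE ?sqrtr_ge0// ltW.
have inv : invdet_dist phi psi <= 2 * M ^+ 2 * eta.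
  apply: invdet_dist_le => x; apply: invr_dist_le => //; last by rewrite ge_min lexx.
  rewrite (jac_det_chart hq x c) (jac_det_chart hq x ck); exact: hdet.
have : 2 * M ^+ 2 * eta <= e / 4.
  apply: (@le_trans _ _ (2 * M ^+ 2 * (e / (8 * M ^+ 2)))).
    by apply: ler_wpM2l; [rewrite mulr_ge0// sqr_ge0|rewrite ge_min lexx orbT].
  by rewrite le_eqVlt; apply/orP; left; apply/eqP; field; rewrite gt_eqF.
by move: hlt2 inv e0; lra.
Qed.

End inverse_jacobian_distance.

(** * Completeness of weighted L^2 *)

Section almost_everywhere_limit.
Context d (T : measurableType d) (R : realType) (mu : {measure set T -> \bar R}).

Lemma cvg_of_geometric_increments (u : R^nat) (C : R) :
  (forall m, `|u m.+1 - u m| <= C * (2^-1) ^+ m) -> cvgn u.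
Proof.
move=> h; have C0 : 0 <= C by have := h 0; rewrite expr0 mulr1; apply: le_trans.
have cs : cvgn (series (fun m => u m.+1 - u m)).
  apply: normed_cvg; apply: (@series_le_cvg R (fun m => `|u m.+1 - u m|) (geometric C 2^-1)).
  - by move=> m.
  - by move=> m; rewrite /= mulr_ge0// exprn_ge0// invr_ge0.
  - by move=> m; exact: h.
  - by apply: is_cvg_geometric_series; rewrite ger0_norm ?invr_ge0// invf_lt1// ltr1n.
have -> : u = (fun m => u 0 + series (fun m => u m.+1 - u m) m).
  by apply/funext => m; rewrite seriesEnat /= telescope_sumr// addrC subrK.
by apply: is_cvgD => //; exact: is_cvg_cst.
Qed.

(* Summability of [4^m (f (m+1) - f m)^2] makes the increments at almost every point O(2^-m). *)
Lemma ae_cvg_of_increments (f : nat -> T -> R) :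
  (forall m, measurable_fun setT (f m)) ->
  (forall m, Rsummable mu (fun x => (f m.+1 x - f m x) ^+ 2)) ->
  (forall m, \int[mu]_x (f m.+1 x - f m x) ^+ 2 <= 16^-1 ^+ m) ->
  exists2 g : T -> R, measurable_fun setT g &
    {ae mu, forall x, f m x @[m --> \oo] --> g x}.
Proof.
move=> mf IDl le; pose D m x := 4 ^+ m * (f m.+1 x - f m x) ^+ 2.
have D0 m x : 0 <= D m x by rewrite mulr_ge0 ?sqr_ge0// exprn_ge0.
have ID m : Rsummable mu (D m) by exact: RsummableZ.
have Dle m : \int[mu]_x D m x <= 4^-1 ^+ m.
  rewrite (RsumZ _ (IDl m)).
  apply: (@le_trans _ _ (4 ^+ m * 16^-1 ^+ m)); first by apply: ler_wpM2l; rewrite ?exprn_ge0.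
  rewrite -exprMn; have -> // : 4 * 16^-1 = 4^-1 :> R by field.
pose H x := (\sum_(m <oo) (D m x)%:E)%E.
pose S M x := (\sum_(0 <= m < M) (D m x)%:E)%E.
have SE M x : S M x = (\sum_(0 <= m < M) D m x)%:E by rewrite /S sumEFin.
have IS M : Rsummable mu (fun x => \sum_(0 <= m < M) D m x) by exact: Rsummable_sum.
have cS x : S M x @[M --> \oo] --> H x.
  by apply: is_cvg_nneseries => m _ _; rewrite lee_fin.
have mS M : measurable_fun setT (S M).
  rewrite (_ : S M = EFin \o (fun x => \sum_(0 <= m < M) D m x)).
    by apply/measurable_EFinP; exact: Rsummable_measurable (IS M).
  by apply/funext => x; rewrite SE.
have mH : measurable_fun setT H by apply: (emeasurable_fun_cvg S) => // x _.
have H0 x : (0 <= H x)%E by apply: nneseries_ge0 => m _ _; rewrite lee_fin.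
have IH : (\int[mu]_x H x <= 2%:E)%E.
  apply: (@fatou_le _ _ _ mu S) => //.
  - by move=> M x; rewrite SE lee_fin; apply: sumr_ge0.
  - by apply: aeW => x; exact: cS.
  - move=> M; under eq_integral do rewrite SE.
    rewrite -RintegralE// lee_fin Rintegral_sum//.
    apply: (@le_trans _ _ (\sum_(0 <= m < M) 4^-1 ^+ m)); first by apply: ler_sum.
    elim: M => [|M ih]; first by rewrite big_nil.
    (* The bound 2 is strengthened to one that the induction preserves. *)
    suff : \sum_(0 <= m < M.+1) 4^-1 ^+ m <= 2 - 4^-1 ^+ M :> R.
      by move=> /le_trans; apply; rewrite gerBl exprn_ge0.
    elim: M {ih} => [|M ih]; first by rewrite big_nat1 expr0; lra.
    rewrite big_nat_recr//=; apply: (le_trans (lerD ih (lexx _))).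
    rewrite exprS.
    have : 0 <= 4^-1 ^+ M :> R by rewrite exprn_ge0.
    by move: (_ ^+ _) => z; lra.
have Hi : mu.-integrable setT H.
  apply/integrableP; split => //; under eq_integral do rewrite gee0_abs//.
  by apply: le_lt_trans IH _; rewrite ltry.
(* A lower limit is measurable and defined everywhere; it equals the limit wherever the sequence
   converges. *)
pose g x := fine (limn_einf (fun m => (f m x)%:E)).
exists g.
  apply: (@measurableT_comp _ _ _ _ _ _ fine); first exact: fine_measurable.
  under eq_fun do rewrite limn_einf_lim.
  apply: (emeasurable_fun_cvg (fun m x => einfs (fun m => (f m x)%:E) m)).
    move=> m; apply: measurable_fun_einfs => k; exact/measurable_EFinP.
  by move=> x _; exact: is_cvg_einfs.
apply: filterS (integrable_ae measurableT Hi) => x /(_ I) Hfin.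
have cf : cvgn (fun m => f m x).
  (* The increments satisfy |f (m+1) x - f m x|^2 <= C 4^-m; adding 1 gives C <= C^2, hence
     increments at most C 2^-m. *)
  pose C := fine (H x) + 1.
  have C1 : 1 <= C by rewrite lerDr fine_ge0.
  apply: (@cvg_of_geometric_increments _ C) => m.
  have DC : D m x <= C.
    apply: (@le_trans _ _ (fine (H x))); last by rewrite lerDl.
    rewrite -lee_fin fineK//; apply: le_trans (nneseries_lim_ge m.+1 _); last first.
      by move=> k _ _; rewrite lee_fin.
    by rewrite sumEFin lee_fin big_nat_recr//= lerDr sumr_ge0.
  have p2 : 0 < 2^-1 ^+ m :> R by rewrite exprn_gt0// invr_gt0.
  rewrite -(@ler_pXn2r _ 2)// ?nnegrE//; last by rewrite mulr_ge0 ?ltW// (lt_le_trans ltr01).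
  rewrite -normrX ger0_norm ?sqr_ge0// exprMn.
  have e4 : (2^-1 ^+ m) ^+ 2 = (4 ^+ m)^-1 :> R.
    by rewrite exprAC -exprVn; congr (_ ^+ _); rewrite expr2; field.
  have p4 : 0 < 4 ^+ m :> R by rewrite exprn_gt0.
  rewrite e4 ler_pdivlMr// mulrC; apply: (le_trans DC).
  by rewrite expr2 ler_peMr// (le_trans ler01).
have cE : (f m x)%:E @[m --> \oo] --> (lim (f m x @[m --> \oo]))%:E.
  by apply: cvg_EFin => //; exact: nearW.
rewrite /g is_cvg_limn_einfE; last by apply/cvg_ex; eexists; exact: cE.
by rewrite (cvg_lim _ cE)//.
Qed.

End almost_everywhere_limit.

Section weighted_completeness.
Context {R : realType} {n : nat}.
Variable q : R.
Hypothesis hq : n%:R / 2 + 1 < q.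
Local Notation mu := (@leb R n).
Variables G K : nat -> 'I_n -> 'rV[R]_n -> R.
Hypothesis mGK : forall k, mpairs (G k) (K k).
Hypothesis IGK : forall k, wsummable q (G k) (K k).
Hypothesis cauchyGK : forall e, 0 < e -> exists N : nat, forall k l : nat, (N <= k)%N -> (N <= l)%N ->
  wnorm2 q (pairB (G k) (G l)) (pairB (K k) (K l)) <= e.

Let IB k l := wsummableB (mGK k) (mGK l) (IGK k) (IGK l).

Lemma rapid_subsequence : exists s : nat -> nat, (forall m, (m <= s m)%N) /\
  forall m, wnorm2 q (pairB (G (s m.+1)) (G (s m))) (pairB (K (s m.+1)) (K (s m))) <= 16^-1 ^+ m.
Proof.
have /choice[N_ NP] : forall m : nat, exists N : nat, forall k l : nat, (N <= k)%N -> (N <= l)%N ->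
    wnorm2 q (pairB (G k) (G l)) (pairB (K k) (K l)) <= 16^-1 ^+ m.
  by move=> m; apply: cauchyGK; rewrite exprn_gt0// invr_gt0.
have Ns m k : (m <= k)%N -> (N_ m <= k + \sum_(i < k.+1) N_ i)%N.
  rewrite -ltnS => mk; apply: (@leq_trans (\sum_(i < k.+1) N_ i)); last by rewrite leq_addl.
  by rewrite (bigD1 (Ordinal mk))//= leq_addr.
(* This index exceeds m and every N_ i with i <= m, so s m and s (m+1) both lie beyond N_ m. *)
exists (fun m => m + \sum_(i < m.+1) N_ i)%N; split=> m; first by rewrite leq_addr.
by apply: NP; apply: Ns.
Qed.

(** Riesz-Fischer: a rapidly converging subsequence has almost everywhere limits in each component,
    and Fatou passes the Cauchy bounds to these limits for the whole sequence. *)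
Lemma weighted_complete : exists gr gi, [/\ mpairs gr gi, wsummable q gr gi &
  forall e, 0 < e -> exists N : nat, forall k : nat, (N <= k)%N ->
    wnorm2 q (pairB (G k) gr) (pairB (K k) gi) <= e].
Proof.
have [s [sm sP]] := rapid_subsequence.
have comp_le i m : \int[mu]_x wpair q (pairB (G (s m.+1)) (G (s m)) i)
    (pairB (K (s m.+1)) (K (s m)) i) x <= 16^-1 ^+ m.
  apply: le_trans (sP m); apply: (@Rintegral_wpair_le_wnorm2 _ _ q) (IB _ _).
  move=> j; have [? ?] := mGK (s m.+1) j; have [? ?] := mGK (s m) j.
  by split; exact: measurable_funB.
have limG i : exists2 g : 'rV[R]_n -> R, measurable_fun setT g &
    {ae mu, forall x, G (s m) i x @[m --> \oo] --> g x}.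
  have mi m : measurable_fun setT (G (s m) i) by have [] := mGK (s m) i.
  have I2 m : Rsummable mu (fun x => (G (s m.+1) i x - G (s m) i x) ^+ 2).
    have mB : measurable_fun setT (pairB (G (s m.+1)) (G (s m)) i) by exact: measurable_funB.
    exact: (Rsummable_gr_sqr hq mB (IB _ _ i)).
  apply: (@ae_cvg_of_increments _ _ _ mu (fun m => G (s m) i)) => // m.
  apply: le_trans (comp_le i m); apply: (ler_Rintegral (I2 m) (IB _ _ i)) => x.
  exact: (gr_sqr_le_wpair hq).
have limK i : exists2 g : 'rV[R]_n -> R, measurable_fun setT g &
    {ae mu, forall x, K (s m) i x @[m --> \oo] --> g x}.
  have mi m : measurable_fun setT (K (s m) i) by have [] := mGK (s m) i.
  have I2 m : Rsummable mu (fun x => (K (s m.+1) i x - K (s m) i x) ^+ 2).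
    have mB : measurable_fun setT (pairB (K (s m.+1)) (K (s m)) i) by exact: measurable_funB.
    exact: (Rsummable_gi_sqr hq mB (IB _ _ i)).
  apply: (@ae_cvg_of_increments _ _ _ mu (fun m => K (s m) i)) => // m.
  apply: le_trans (comp_le i m); apply: (ler_Rintegral (I2 m) (IB _ _ i)) => x.
  exact: (gi_sqr_le_wpair hq).
have /choice[gr grP] : forall i, exists g : 'rV[R]_n -> R, measurable_fun setT g /\
    {ae mu, forall x, G (s m) i x @[m --> \oo] --> g x}.
  by move=> i; have [g ? ?] := limG i; exists g.
have /choice[gi giP] : forall i, exists g : 'rV[R]_n -> R, measurable_fun setT g /\
    {ae mu, forall x, K (s m) i x @[m --> \oo] --> g x}.
  by move=> i; have [g ? ?] := limK i; exists g.
have mg : mpairs gr gi by move=> i; split; [exact: (grP i).1|exact: (giP i).1].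
have mB k : mpairs (pairB (G k) gr) (pairB (K k) gi).
  by move=> i; have [? ?] := mGK k i; have [? ?] := mg i; split; exact: measurable_funB.
have bound e : 0 < e -> exists N : nat, forall k : nat, (N <= k)%N ->
    forall i, (\int[mu]_x (wpair q (pairB (G k) gr i) (pairB (K k) gi i) x)%:E <= e%:E)%E.
  move=> e0; have [N NP] := cauchyGK e0; exists N => k Nk i.
  apply: (@fatou_le _ _ _ mu (fun m x =>
    (wpair q (pairB (G k) (G (s (m + N))) i) (pairB (K k) (K (s (m + N))) i) x)%:E)).
  - by move=> m; apply/measurable_EFinP; exact: Rsummable_measurable (IB _ _ i).
  - by apply/measurable_EFinP; have [? ?] := mB k i; exact: measurable_wpair.
  - by move=> m x; rewrite lee_fin wpair_ge0.
  - apply: filterS2 (grP i).2 (giP i).2 => x hG hK; apply: cvg_EFin; first exact: nearW.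
    rewrite /wpair /pairB /=.
    have hG' : G (s (m + N)) i x @[m --> \oo] --> gr i x by rewrite (cvg_shiftn N (fun m => G (s m) i x)).
    have hK' : K (s (m + N)) i x @[m --> \oo] --> gi i x by rewrite (cvg_shiftn N (fun m => K (s m) i x)).
    apply: cvgMl_tmp; apply: cvgD.
      by apply: (cvg_comp _ (fun z : R => z ^+ 2)); [apply: cvgB; [exact: cvg_cst|exact: hG']|exact: exprn_continuous].
    by apply: (cvg_comp _ (fun z : R => z ^+ 2)); [apply: cvgB; [exact: cvg_cst|exact: hK']|exact: exprn_continuous].
  - move=> m; rewrite -(RintegralE (IB _ _ i)) lee_fin.
    have Ns : (N <= s (m + N))%N by apply: leq_trans (sm _); rewrite leq_addl.
    apply: le_trans (NP k (s (m + N)) Nk Ns).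
    apply: (@Rintegral_wpair_le_wnorm2 _ _ q) (IB _ _) => j.
    by have [? ?] := mGK k j; have [? ?] := mGK (s (m + N)) j; split; exact: measurable_funB.
have IBg e k i : (\int[mu]_x (wpair q (pairB (G k) gr i) (pairB (K k) gi i) x)%:E <= e%:E)%E ->
    Rsummable mu (wpair q (pairB (G k) gr i) (pairB (K k) gi i)).
  move=> h; have [m1 m2] := mB k i; apply/ge0_RsummableP.
  - exact: measurable_wpair.
  - by move=> x; exact: wpair_ge0.
  - by apply: le_lt_trans h _; rewrite ltry.
exists gr, gi; split => //.
  have [k hk] := bound 1 ltr01; have {}hk := hk k (leqnn k).
  have Ik : wsummable q (pairB (G k) gr) (pairB (K k) gi) by move=> i; exact: IBg (hk i).
  (* The limit is written as G k - (G k - limit), a difference of two pairs of finite norm. *)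
  have := wsummableB (mGK k) (mB k) (IGK k) Ik.
  have -> : pairB (G k) (pairB (G k) gr) = gr.
    by apply/funext => i; apply/funext => x; rewrite /pairB /= subKr.
  have -> // : pairB (K k) (pairB (K k) gi) = gi.
  by apply/funext => i; apply/funext => x; rewrite /pairB /= subKr.
(* Each of the n components gets e / (n + 1), which stays meaningful in dimension 0. *)
move=> e e0; have en : 0 < e / n.+1%:R by rewrite divr_gt0.
have [N NP] := bound _ en; exists N => k Nk; have {}NP := NP k Nk.
rewrite /wnorm2; apply: (@le_trans _ _ (\sum_(i < n) e / n.+1%:R)).
  apply: ler_sum => i _; rewrite -lee_fin (RintegralE (IBg _ _ _ (NP i))).
  exact: NP.
rewrite sumr_const card_ord -[leLHS]mulr_natr -mulrA ler_piMr ?(ltW e0)//.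
by rewrite mulrC ler_pdivrMr// mul1r ler_nat.
Qed.

End weighted_completeness.

(** * Stability of transform pairs under L^2 limits *)

Section plancherel_limit.
Context {R : realType} {n : nat}.
Local Notation mu := (@leb R n).
Implicit Types a b : 'rV[R]_n -> R.

Definition L12 a := Rsummable mu a /\ Rsummable mu (fun x => a x ^+ 2).

Lemma L12_measurable a : L12 a -> measurable_fun setT a.
Proof. by move=> [/Rsummable_measurable]. Qed.

Lemma L12B a b : L12 a -> L12 b -> L12 (a \- b).
Proof.
move=> [Ia Ia2] [Ib Ib2]; split; first exact: RsummableB.
apply: (le_Rsummable _ _ (RsummableD (RsummableZ 2 Ia2) (RsummableZ 2 Ib2))).
  by apply: measurable_funX; exact: Rsummable_measurable (RsummableB Ia Ib).
move=> x /=; rewrite ger0_norm ?sqr_ge0//.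
by have := sqr_ge0 (a x + b x); rewrite sqrrB sqrrD; lra.
Qed.

Lemma L2_invFT a b : L12 a -> L12 b -> L2 (invFT a b).
Proof.
move=> [Ia Ia2] [Ib Ib2]; apply/L2P; split; first exact: measurable_invFT.
by have [] := bessel_invFT Ia Ib Ia2 Ib2.
Qed.

Lemma sqr_sum3_le (x y z : R) : (x + y + z) ^+ 2 <= 3 * (x ^+ 2 + y ^+ 2 + z ^+ 2).
Proof.
have := sqr_ge0 (x - y); have := sqr_ge0 (y - z); have := sqr_ge0 (x - z).
by nra.
Qed.

(** Three errors: that of the approximating pair, e'; the distance between the pairs, e; and the
    transform of the truncated difference of functions, at most 2 e by [bessel] followed by
    [bessel_invFT]. The last two bounds do not depend on N. *)
Lemma FTdist_approx_le a b a' b' N e e' : L12 a -> L12 b -> L12 a' -> L12 b' ->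
  \int[mu]_xi ((a xi - a' xi) ^+ 2 + (b xi - b' xi) ^+ 2) <= e ->
  (\int[mu]_xi (FTdist (invFT a' b') N a' b' xi)%:E < e'%:E)%E ->
  (\int[mu]_xi (FTdist (invFT a b) N a b xi)%:E <= (3 * (e' + e + 2 * e))%:E)%E.
Proof.
move=> La Lb La' Lb' le lt.
pose u := invFT a b; pose u' := invFT a' b'.
have Lu : L2 u by exact: L2_invFT.
have Lu' : L2 u' by exact: L2_invFT.
have [mu_ Iu2] := (L2P u).1 Lu; have [mu' Iu2'] := (L2P u').1 Lu'.
have [ma mb] := (L12_measurable La, L12_measurable Lb).
have [ma' mb'] := (L12_measurable La', L12_measurable Lb').
have [LBa LBb] := (L12B La La', L12B Lb Lb').
have [IBa IBa2] := LBa; have [IBb IBb2] := LBb.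
have [IU leU] := bessel_invFT IBa IBb IBa2 IBb2.
pose w := trunc (u \- u') N.
have uE : u \- u' = invFT (a \- a') (b \- b').
  by apply/funext => x; rewrite invFTB//; [exact: La.1|exact: Lb.1|exact: La'.1|exact: Lb'.1].
have mB : measurable_fun setT (u \- u') by exact: measurable_funB.
have IB2 : Rsummable mu (fun x => (u \- u') x ^+ 2) by rewrite uE.
have Iw := Rsummable_trunc N mB IB2; have Iw2 := Rsummable_trunc_sqr N mB IB2.
have [Ibes bes] := bessel Iw Iw2.
have Id : Rsummable mu (fun xi => (a xi - a' xi) ^+ 2 + (b xi - b' xi) ^+ 2).
  exact: RsummableD IBa2 IBb2.
pose f' := FTdist u' N a' b'.
have mf' : measurable_fun setT f' by exact: measurable_FTdist.
have If' : Rsummable mu f'.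
  apply/ge0_RsummableP => //; first by move=> x; exact: FTdist_ge0.
  by apply: lt_trans lt _; rewrite ltry.
have I3 := RsummableZ 3 (RsummableD (RsummableD If' Id) Ibes).
have mf : measurable_fun setT (FTdist u N a b) by exact: measurable_FTdist.
have pw xi : FTdist u N a b xi <= 3 * (f' xi + ((a xi - a' xi) ^+ 2 + (b xi - b' xi) ^+ 2)
    + (FTc w xi ^+ 2 + FTs w xi ^+ 2)).
  have Iu := Rsummable_trunc N mu_ Iu2; have Iu' := Rsummable_trunc N mu' Iu2'.
  rewrite /f' /w /FTdist (truncB u u' N) (FTcB Iu Iu') (FTsB Iu Iu') /=.
  move: (a xi) (a' xi) (b xi) (b' xi) (FTc _ _) (FTc _ _) (FTs _ _) (FTs _ _) => x x' y y' c' c s' s.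
  have := sqr_sum3_le (x' - c') (x - x') (- (c - c')).
  have := sqr_sum3_le (y' + s') (y - y') (s - s').
  have -> : x' - c' + (x - x') + - (c - c') = x - c by ring.
  have -> : y' + s' + (y - y') + (s - s') = y + s by ring.
  by rewrite sqrrN; lra.
have If : Rsummable mu (FTdist u N a b).
  by apply: (le_Rsummable mf _ I3) => xi; rewrite ger0_norm ?FTdist_ge0//; exact: pw.
rewrite -(RintegralE If) lee_fin; apply: (le_trans (ler_Rintegral If I3 pw)).
rewrite (RsumZ _ (RsummableD (RsummableD If' Id) Ibes)).
rewrite (RsumD (RsummableD If' Id) Ibes) (RsumD If' Id).
apply: ler_wpM2l => //; apply: lerD; first apply: lerD => //.
  by rewrite -(RintegralE If') lte_fin in lt; exact: ltW.
apply: (le_trans bes); apply: (@le_trans _ _ (\int[mu]_x (u \- u') x ^+ 2)).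
  by apply: (ler_Rintegral Iw2 IB2) => x; exact: trunc_sqr_le.
by rewrite uE; apply: (le_trans leU); apply: ler_wpM2l.
Qed.

(** The approximating pair is fixed first and N is then taken large for that pair alone, which the
    uniformity in N permits. *)
Lemma is_FT_of_approx a b : L12 a -> L12 b ->
  (forall e, 0 < e -> exists a' b', [/\ L12 a', L12 b', is_FT (invFT a' b') a' b' &
     \int[mu]_xi ((a xi - a' xi) ^+ 2 + (b xi - b' xi) ^+ 2) <= e]) ->
  is_FT (invFT a b) a b.
Proof.
move=> La Lb approx; apply/is_FTP; first exact: L2_invFT.
split; [exact: L12_measurable|exact: L12_measurable|].
(* The bound 3 (e' + e + 2 e) becomes 12/13 of e, hence strictly less. *)
move=> e e0; have e13 : 0 < e / 13 by rewrite divr_gt0.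
have [a' [b' [La' Lb' hF le]]] := approx _ e13.
have [_ _ hF'] := (is_FTP _ _ (L2_invFT La' Lb')).1 hF.
apply: filterS (hF' _ e13) => N lt.
apply: le_lt_trans (FTdist_approx_le La Lb La' Lb' le lt) _.
by rewrite lte_fin; lra.
Qed.

End plancherel_limit.

(** * The metric *)

Section metric.
Context {R : realType} {n : nat}.
Variable q : R.
Hypothesis hq : n%:R / 2 + 1 < q.
Local Notation mu := (@leb R n).
Implicit Types (phi psi : 'rV[R]_n -> 'rV[R]_n) (gr gi kr ki : 'I_n -> 'rV[R]_n -> R).

Lemma chart_Hq_norm phi psi gr gi kr ki : chart q phi gr gi -> chart q psi kr ki ->
  Hq_norm q (phi \- psi) = Num.sqrt (wnorm2 q (pairB gr kr) (pairB gi ki)).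
Proof. by move=> c ck; exact: Hq_normE (chartB c ck). Qed.

Lemma Hq_norm_ge0 (v : 'rV[R]_n -> 'rV[R]_n) : 0 <= Hq_norm q v.
Proof. exact: sqrtr_ge0. Qed.

Lemma Hq_dist_lty phi psi : Dq q phi -> Dq q psi -> (Hq_sqnorm q (phi \- psi)%R < +oo)%E.
Proof.
move=> /(Dq_chart hq)[gr [gi c]] /(Dq_chart hq)[kr [ki ck]].
by rewrite (Hq_sqnormE (chartB c ck)) ltry.
Qed.

Lemma Hq_dist_sym phi psi : Dq q phi -> Dq q psi ->
  Hq_norm q (phi \- psi) = Hq_norm q (psi \- phi).
Proof.
move=> /(Dq_chart hq)[gr [gi c]] /(Dq_chart hq)[kr [ki ck]].
by rewrite (chart_Hq_norm c ck) (chart_Hq_norm ck c) wnorm2_sym.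
Qed.

Lemma Hq_dist_triangle phi1 phi2 phi3 : Dq q phi1 -> Dq q phi2 -> Dq q phi3 ->
  Hq_norm q (phi1 \- phi3) <= Hq_norm q (phi1 \- phi2) + Hq_norm q (phi2 \- phi3).
Proof.
(* Both differences are now taken from phi2, so that phi1 - phi3 is their difference and [wnormB_le]
   applies. *)
move=> D1 D2 D3; rewrite (Hq_dist_sym D2 D3).
have [g1 [h1 c1]] := Dq_chart hq D1; have [g2 [h2 c2]] := Dq_chart hq D2.
have [g3 [h3 c3]] := Dq_chart hq D3.
rewrite (chart_Hq_norm c1 c3) (chart_Hq_norm c1 c2) (chart_Hq_norm c3 c2).
have [m12 m32] := (Hrep_measurable (chartB c1 c2), Hrep_measurable (chartB c3 c2)).
have [_ _ I12] := chartB c1 c2; have [_ _ I32] := chartB c3 c2.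
have := wnormB_le m12 m32 I12 I32.
have E (a b c : 'I_n -> 'rV[R]_n -> R) : pairB (pairB a b) (pairB c b) = pairB a c.
  by apply/funext => i; apply/funext => x; rewrite /pairB /= opprB addrA subrK.
by rewrite !E.
Qed.

Lemma dq_refl phi : Dq q phi -> dq q phi phi = 0.
Proof.
move=> D; have [gr [gi c]] := Dq_chart hq D.
rewrite dqE (chart_Hq_norm c c).
have -> : wnorm2 q (pairB gr gr) (pairB gi gi) = 0.
  apply: big1 => i _.
  transitivity (\int[mu]_x (0 : R)); last by rewrite Rintegral_cst// mul0r.
  by apply: eq_Rintegral => x _; rewrite /wpair /pairB /= !subrr expr0n/= addr0 mulr0.
rewrite sqrtr0 add0r; apply/eqP; rewrite eq_le invdet_dist_ge0 andbT.
by apply: invdet_dist_le => x; rewrite subrr normr0.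
Qed.

(** Equality at every point is required. A squared norm 0 is below r^2 for every r > 0, so the sup
    bound makes the inverse transform of the difference vanish everywhere. *)
Lemma Hq_dist0_eq phi psi : Dq q phi -> Dq q psi -> Hq_norm q (phi \- psi) = 0 -> phi = psi.
Proof.
move=> D1 D2; have [gr [gi c]] := Dq_chart hq D1; have [kr [ki ck]] := Dq_chart hq D2.
have [mg Iw] := (chart_mpairs c, chart_wsummable c).
have [mk Ik] := (chart_mpairs ck, chart_wsummable ck).
rewrite (chart_Hq_norm c ck) => /eqP; rewrite sqrtr_eq0 => W.
have [mB [_ _ IB]] := (Hrep_measurable (chartB c ck), chartB c ck).
have E : invFTrow (pairB gr kr) (pairB gi ki) = fun=> 0.
  apply/funext => x; apply/rowP => i; rewrite [RHS]mxE; apply/eqP.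
  rewrite -normr_eq0 eq_le normr_ge0 andbT; apply/ler_addgt0Pr => e e0; rewrite add0r.
  have S1 : 0 < supC (n := n) q + 1 by rewrite ltr_wpDl ?supC_ge0.
  have r0 : 0 < e / (supC (n := n) q + 1) by rewrite divr_gt0.
  have W' : wnorm2 q (pairB gr kr) (pairB gi ki) <= (e / (supC (n := n) q + 1)) ^+ 2.
    by apply: (le_trans W); exact: sqr_ge0.
  apply: (le_trans (norm_invFTrow_le hq x i mB IB r0 W')).
  rewrite mulrA ler_pdivrMr// mulrC; apply: ler_wpM2l; first exact: ltW.
  by rewrite lerDl.
have [_ ->] := c; have [_ ->] := ck; apply/funext => x; congr (x + _).
by apply/eqP; rewrite -subr_eq0 -(invFTrowB hq x mg mk Iw Ik) E.
Qed.

Lemma Hq_le_dq phi psi : Hq_norm q (phi \- psi) <= dq q phi psi.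
Proof. by rewrite dqE lerDl invdet_dist_ge0. Qed.

Lemma dq_sym phi psi : Dq q phi -> Dq q psi -> dq q phi psi = dq q psi phi.
Proof. by move=> D1 D2; rewrite !dqE (Hq_dist_sym D1 D2) invdet_dist_sym. Qed.

Lemma sum_sqr_le_wpair (a b : 'rV[R]_n -> R) x : a x ^+ 2 + b x ^+ 2 <= wpair q a b x.
Proof. by rewrite ler_peMl ?addr_ge0 ?sqr_ge0// (powR_base_ge1 hq). Qed.

Lemma L12_wsummable (a b : 'I_n -> 'rV[R]_n -> R) i : mpairs a b -> wsummable q a b -> L12 (a i) /\ L12 (b i).
Proof.
move=> m I; have [ma mb] := m i; split; split.
- exact: (Rsummable_gr hq ma mb (I i)).
- exact: (Rsummable_gr_sqr hq ma (I i)).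
- exact: (Rsummable_gi hq ma mb (I i)).
- exact: (Rsummable_gi_sqr hq mb (I i)).
Qed.

Section completeness.
Variable u : nat -> 'rV[R]_n -> 'rV[R]_n.
Hypothesis Du : forall k, Dq q (u k).
Hypothesis cauchy_u : forall e : R, 0 < e -> exists N : nat, forall m k : nat,
  (N <= m)%N -> (N <= k)%N -> dq q (u m) (u k) < e.
Variables G K : nat -> 'I_n -> 'rV[R]_n -> R.
Hypothesis cGK : forall k, chart q (u k) (G k) (K k).

Let mGK k := chart_mpairs (cGK k).
Let IGK k := chart_wsummable (cGK k).

Lemma chart_cauchy e : 0 < e -> exists N : nat, forall k l : nat, (N <= k)%N -> (N <= l)%N ->
  wnorm2 q (pairB (G k) (G l)) (pairB (K k) (K l)) <= e.
Proof.
move=> e0; have s0 : 0 < Num.sqrt e by rewrite sqrtr_gt0.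
have [N NP] := cauchy_u s0.
exists N => k l Nk Nl; have := le_lt_trans (Hq_le_dq _ _) (NP k l Nk Nl).
rewrite (chart_Hq_norm (cGK k) (cGK l)) ltr_sqrt//; exact: ltW.
Qed.

Variables gr gi : 'I_n -> 'rV[R]_n -> R.
Hypotheses (mg : mpairs gr gi) (Iw : wsummable q gr gi).
Hypothesis lim_g : forall e, 0 < e -> exists N : nat, forall k : nat, (N <= k)%N ->
  wnorm2 q (pairB (G k) gr) (pairB (K k) gi) <= e.

Let phi x := x + invFTrow gr gi x.

Let comp_phi i : Defs.comp (phi \- id) i = invFT (gr i) (gi i).
Proof. by apply/funext => x; rewrite /Defs.comp /phi /= addrC addKr mxE. Qed.

Let comp_u k i : Defs.comp (u k \- id) i = invFT (G k i) (K k i).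
Proof.
have [_ ->] := cGK k.
by apply/funext => x; rewrite /Defs.comp /= addrC addKr mxE.
Qed.

(** The pairs of the u k approximate (gr, gi) in the weighted norm, hence in L^2, and each is the
    transform of its own [invFT]; this property passes to the limit. *)
Lemma chart_limit : chart q phi gr gi.
Proof.
split=> //; split=> // i; rewrite comp_phi; have [Lr Li] := L12_wsummable i mg Iw.
  exact: L2_invFT.
apply: is_FT_of_approx => // e e0; have [N NP] := lim_g e0.
have [LG LK] := L12_wsummable i (mGK N) (IGK N).
exists (G N i), (K N i); split => //.
  by have [[_ hF _] _] := cGK N; rewrite -comp_u.
have mB : mpairs (pairB gr (G N)) (pairB gi (K N)).
  by move=> j; have [? ?] := mg j; have [? ?] := mGK N j; split; exact: measurable_funB.
have IB := wsummableB mg (mGK N) Iw (IGK N).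
apply: le_trans (NP N (leqnn N)); rewrite wnorm2_sym.
apply: le_trans (Rintegral_wpair_le_wnorm2 i mB IB).
apply: (ler_Rintegral _ (IB i)).
  exact: RsummableD (L12B Lr LG).2 (L12B Li LK).2.
by move=> x; exact: (@sum_sqr_le_wpair (pairB gr (G N) i) (pairB gi (K N) i) x).
Qed.

Lemma limit_near delta : 0 < delta -> exists N : nat, forall k : nat, (N <= k)%N ->
  wnorm2 q (pairB gr (G k)) (pairB gi (K k)) <= delta ^+ 2.
Proof.
move=> d0; have [N NP] := lim_g (exprn_gt0 2 d0).
by exists N => k Nk; rewrite wnorm2_sym; exact: NP.
Qed.

(* The inverse jacobians are uniformly Cauchy, hence uniformly bounded, which keeps
   the jacobian of the limit positive. *)
Lemma jac_limit_gt0 x : 0 < \det (1%:M + dinvFT gr gi x).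
Proof.
have [N NP] := cauchy_u ltr01.
have [M M0 hM] := Dq_jac_inv_bounded hq (Du N).
have aux (a b v s m : R) : `|a - b| <= v -> 0 <= s -> s + v < 1 -> b <= m -> a <= m + 1.
  by have := ler_norm (a - b); lra.
have lower k : (N <= k)%N -> (M + 1)^-1 <= jac_det (u k) x.
  move=> Nk; have [_ [_ pos]] := Du k.
  have M1 : 0 < M + 1 by rewrite addr_gt0.
  have ik : (jac_det (u k) x)^-1 <= M + 1.
    have lt := NP k N Nk (leqnn N); rewrite dqE in lt.
    apply: (aux _ _ _ _ _ (le_invdet_dist hq x (Du k) (Du N)) _ _ (hM x)).
      exact: Hq_norm_ge0 (u k \- u N).
    exact: lt.
  have ik0 : 0 < (jac_det (u k) x)^-1 by rewrite invr_gt0; exact: pos.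
  rewrite -[leRHS]invrK lef_pV2 ?posrE; [exact: ik|exact: M1|exact: ik0].
(* The jacobians are at least 1/(M + 1) from rank N on; an error of half this size leaves the limit
   positive. *)
have M2 : 0 < (M + 1)^-1 / 2 by rewrite divr_gt0// invr_gt0 addr_gt0.
have [delta d0 hd] := det_dinvFT_near hq mg Iw M2.
have [N' NP'] := limit_near d0.
have := lower (maxn N N') (leq_maxl _ _); rewrite (jac_det_chart hq x (cGK _)).
have := hd _ _ (mGK _) (IGK _) (NP' (maxn N N') (leq_maxr _ _)) x.
rewrite distrC => /(le_trans (ler_norm _)).
by move: M2; move: (\det _) (\det _) => a b; lra.
Qed.

Lemma Dq_limit : Dq q phi.
Proof.
split; first by apply/in_HqP; exists gr, gi; have [] := chart_limit.
split=> x; first exact: (differentiable_id_invFT hq mg Iw).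
by rewrite (jac_det_chart hq x chart_limit); exact: jac_limit_gt0.
Qed.

(** Once phi is known to lie in D^q, [dq_small] at phi upgrades H^q convergence to convergence for
    d_q. *)
Lemma dq_limit : (fun k => dq q (u k) phi) @ \oo --> (0 : R).
Proof.
apply/cvgrPdist_lt => e e0; have [delta d0 hd] := dq_small hq Dq_limit e0.
have d2 : 0 < delta / 2 by rewrite divr_gt0.
have [N NP] := limit_near d2; exists N => // k Nk.
have dq0 : 0 <= dq q (u k) phi by apply: le_trans (Hq_le_dq _ _); exact: Hq_norm_ge0.
rewrite sub0r normrN ger0_norm// (dq_sym (Du k) Dq_limit).
apply: hd (Du k) _; rewrite (chart_Hq_norm chart_limit (cGK k)).
apply: (@le_lt_trans _ _ (delta / 2)); last by rewrite ltr_pdivrMr// ltr_pMr// ltr1n.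
by rewrite -[leRHS](ger0_norm (ltW d2)) -sqrtr_sqr; apply: ler_wsqrtr; exact: NP.
Qed.

End completeness.

Lemma dq_complete (u : nat -> 'rV[R]_n -> 'rV[R]_n) : (forall k, Dq q (u k)) ->
  (forall e : R, 0 < e -> exists N : nat, forall m k : nat,
    (N <= m)%N -> (N <= k)%N -> dq q (u m) (u k) < e) ->
  exists2 phi, Dq q phi & (fun k => dq q (u k) phi) @ \oo --> (0 : R).
Proof.
move=> Du cu.
have /choice[G /choice[K cGK]] := fun k => Dq_chart hq (Du k).
have [gr [gi [mg Iw lim_g]]] := weighted_complete hq (fun k => chart_mpairs (cGK k))
  (fun k => chart_wsummable (cGK k)) (chart_cauchy cu cGK).
exists (fun x => x + invFTrow gr gi x); first exact: (Dq_limit Du cu cGK mg Iw lim_g).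
exact: (dq_limit Du cu cGK mg Iw lim_g).
Qed.

(** A d_q ball contains an H^q ball by [dq_small], and the converse follows from [Hq_le_dq].
    Symmetry intervenes because [manifold_open] measures psi - phi and d_q measures phi - psi. *)
Lemma dq_open_manifold_open (U : set ('rV[R]_n -> 'rV[R]_n)) : U `<=` Dq q ->
  dq_open q U <-> manifold_open q U.
Proof.
move=> UD; split=> hU phi Uphi; have [e e0 he] := hU phi Uphi; have Dphi := UD _ Uphi.
  have [delta d0 hd] := dq_small hq Dphi e0.
  exists delta; first exact: d0.
  move=> psi Dpsi lt; apply: (he psi Dpsi (hd psi Dpsi _)).
  exact: (eq_ind _ (fun t => t < delta) lt _ (Hq_dist_sym Dpsi Dphi)).
exists e; first exact: e0.
move=> psi Dpsi lt; apply: (he psi Dpsi).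
have := le_lt_trans (Hq_le_dq phi psi) lt.
exact: (eq_ind _ (fun t => t < e -> _) id _ (Hq_dist_sym Dpsi Dphi)).
Qed.

End metric.

Theorem theorem2p7 (R : realType) (d : nat) (q : R)
    (hq : d%:R / 2 + 1 < q) :
  (* d_q is a well-defined (finite-valued) metric on D^q *)
  (forall phi1 phi2 : 'rV[R]_d -> 'rV[R]_d, Dq q phi1 -> Dq q phi2 ->
      (Hq_sqnorm q (phi1 \- phi2)%R < +oo)%E /\
      (invdet_dist_e phi1 phi2 < +oo)%E) /\
  (forall phi : 'rV[R]_d -> 'rV[R]_d, Dq q phi -> dq q phi phi = 0) /\
  (forall phi1 phi2 : 'rV[R]_d -> 'rV[R]_d, Dq q phi1 -> Dq q phi2 ->
      dq q phi1 phi2 = 0 -> phi1 = phi2) /\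
  (forall phi1 phi2 : 'rV[R]_d -> 'rV[R]_d, Dq q phi1 -> Dq q phi2 ->
      dq q phi1 phi2 = dq q phi2 phi1) /\
  (forall phi1 phi2 phi3 : 'rV[R]_d -> 'rV[R]_d, Dq q phi1 -> Dq q phi2 -> Dq q phi3 ->
      dq q phi1 phi3 <= dq q phi1 phi2 + dq q phi2 phi3) /\
  (* completeness *)
  (forall u : nat -> ('rV[R]_d -> 'rV[R]_d),
      (forall n, Dq q (u n)) ->
      (forall e : R, 0 < e -> exists N : nat, forall m n : nat,
          (N <= m)%N -> (N <= n)%N -> dq q (u m) (u n) < e) ->
      exists2 phi, Dq q phi & (fun n => dq q (u n) phi) @ \oo --> (0 : R)) /\
  (* the metric topology coincides with the Hilbert manifold topology *)
  (forall U : set ('rV[R]_d -> 'rV[R]_d), U `<=` Dq q ->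
      (dq_open q U <-> manifold_open q U)).
Proof.
split.
  by move=> phi1 phi2 D1 D2; split; [exact: Hq_dist_lty|exact: invdet_dist_e_lty D1 D2].
split; first exact: dq_refl.
split.
  move=> phi1 phi2 D1 D2 dq0; apply: (Hq_dist0_eq hq D1 D2).
  apply/eqP; rewrite eq_le Hq_norm_ge0 andbT.
  by rewrite -dq0; exact: Hq_le_dq.
split; first exact: dq_sym.
split.
  move=> phi1 phi2 phi3 D1 D2 D3; rewrite !dqE.
  apply: (le_trans (lerD (Hq_dist_triangle hq D1 D2 D3) (invdet_dist_triangle hq D1 D2 D3))).
  by rewrite addrACA.
split; first exact: dq_complete.
exact: dq_open_manifold_open.
Qed.
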